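(* Fix any phase $\alpha\in\mathbb S^1$ and select a Stokes sector $V\subset\mathbb C_\tau$. Let $U\subset\mathbb C_t$ be its projection to the $t$-plane, and let $\hat q(t,\hbar)$ be the distinguished branch on $U$ of the multivalued formal solution of the deformed Painlevé I equation. Then the deformed Painlevé I equation $\hbar^2\partial_t^2q=6q^2+t$ has a unique holomorphic solution $q=q(t,\hbar)$ defined on a domain $\mathbb U\subset U\times\mathbb C_\hbar$ which is locally uniformly asymptotic to $\hat q$ of uniform factorial type: $$q(t,\hbar)\simeq\hat q(t,\hbar)\quad\text{as }\hbar\to0\text{ uniformly along }\mathrm{Arc}_\pi(\alpha),$$ locally uniformly for all $t\in U$.
   Context: Formal solution. $\hat q(t,\hbar)=\sum_{n\ge0}q_n(t)\hbar^n$ is the formal solution of $\hbar^2\partial_t^2q=6q^2+t$ with locally holomorphic coefficients on $\mathbb C_t^*$; a branch is determined by a root $q_0(t)$ of $6q_0^2+t=0$, and then $q_{2n-1}=0$, $q_{2n}=\frac1{12q_0}(\ddot q_{2n-2}-6\sum_{i+j=n,\,i,j\ne0}q_{2i}q_{2j})$. Let $\mathbb C_\tau\to\mathbb C_t$ be the double cover $\tau^2=-t/6$, on which $q_0=\tau$. Stokes lines and sectors. For a phase $\alpha\in\mathbb S^1=\mathbb R/2\pi\mathbb Z$, a Stokes line in the $\tau$-plane is a ray $e^{i\theta}\mathbb R_+$ with $5\theta\equiv2\alpha\pmod{2\pi}$ (there are five). A Stokes sector is a connected component $V$ of the complement in $\mathbb C_\tau$ of the union of all Stokes lines. Its projection $U\subset\mathbb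 C_t$ is its image under $\tau\mapsto t=-6\tau^2$ (injective on $V$); the distinguished branch of $\hat q$ on $U$ is the one with $q_0(t)=\tau$ for $\tau\in V$. Sectors and asymptotics. $\mathrm{Arc}_\pi(\alpha)=(\alpha-\frac\pi2,\alpha+\frac\pi2)$. A sectorial neighbourhood of the origin with opening $A$ is a simply connected domain $S\subset\mathbb C_\hbar^*$ such that some simply connected open subset of the real-oriented blowup $\mathbb C_\hbar^*\sqcup\mathbb S^1$ of $\mathbb C_\hbar$ at $0$ meets $\mathbb C_\hbar^*$ in $S$ and the boundary circle in $A$. The asymptotic condition means: each $t_0\in U$ has a neighbourhood $U_0\subset U$, a sectorial neighbourhood $S_0$ with opening $\mathrm{Arc}_\pi(\alpha)$ with $U_0\times S_0\subset\mathbb U$, and constants $C,M>0$ with $|q(t,\hbar)-\sum_{k<n}q_k(t)\hbar^k|\le CM^nn!|\hbar|^n$ for all $n\ge0$, $t\in U_0$, $\hbar\in S_0$. *)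

(* Defs.v *)
From HB Require Import structures.
From mathcomp Require Import all_boot all_order all_algebra.
From mathcomp Require Import all_classical all_reals all_analysis.
From mathcomp.real_closed Require Export complex.
Import Order.TTheory GRing.Theory Num.Theory.
Import numFieldNormedType.Exports.

Set Implicit Arguments.
Unset Strict Implicit.
Unset Printing Implicit Defensive.

Local Open Scope classical_set_scope.
Local Open Scope ring_scope.
Local Open Scope complex_scope.

(* [R[i]] as a normed module over itself: the topology is that of the modulus,
   and derivatives and differentials are complex ones. *)
HB.instance Definition _ (R : rcfType) := NormedModule.copy R[i] R[i]^o.

Section Topology.
Context {R : realType} {T : topologicalType}.
Implicit Types A : set T.

Definition domain A := [/\ open A, A !=set0 & connected A].

Definition path_in A (x y : T) (g : R -> T) :=
  [/\ {within `[0, 1], continuous g},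
      (forall s, s \in `[0, 1] -> A (g s)), g 0 = x & g 1 = y].

Definition null_homotopic_in A (x : T) (g : R -> T) :=
  exists H : R * R -> T,
    [/\ {within `[0, 1] `*` `[0, 1], continuous H},
        (forall r s, r \in `[0, 1] -> s \in `[0, 1] -> A (H (r, s))),
        (forall s, s \in `[0, 1] -> H (0, s) = g s /\ H (1, s) = x) &
        (forall r, r \in `[0, 1] -> H (r, 0) = x /\ H (r, 1) = x)].

Definition simply_connected A :=
  [/\ A !=set0,
      (forall x y, A x -> A y -> exists g, path_in A x y g) &
      (forall x g, path_in A x x g -> null_homotopic_in A x g)].

End Topology.
Arguments simply_connected R {T} A.

Section PainleveI.
Context {R : realType}.
Local Notation C := R[i].

Definition cis (theta : R) : C := cos theta +i* sin theta.

(* A phase, an element of R / 2 pi Z, is given by a real representative. *)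

(* The rays contain the origin; otherwise the five sectors would be joined
   through it in the complement. *)
Definition stokes_lines (alpha : R) : set C :=
  [set tau | exists theta r : R,
    [/\ 0 <= r,
        exists k : int, 5 * theta = 2 * alpha + 2 * pi * k%:~R &
        tau = r%:C * cis theta]].

Definition stokes_sector (alpha : R) (V : set C) :=
  exists2 tau, (~` stokes_lines alpha) tau &
    V = connected_component (~` stokes_lines alpha) tau.

Definition proj_t (tau : C) : C := - 6 * tau ^+ 2.

Definition holomorphic_on (E : normedModType C) (D : set E) (f : E -> C) :=
  forall x, D x -> differentiable f x.

(* [qhat n] is the coefficient of [hbar ^ n]; the last two clauses are the
   coefficients of [hbar ^ n] in [hbar^2 d^2 qhat / dt^2 = 6 qhat^2 + t],
   for [n < 2] and for [n >= 2]. *)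
Definition formal_solution (U : set C) (qhat : nat -> C -> C) :=
  [/\ (forall n, holomorphic_on U (qhat n)),
      (forall t, U t -> forall n, (n < 2)%N ->
        0 = 6 * (\sum_(i < n.+1) qhat i t * qhat (n - i)%N t)
            + (if n == 0%N then t else 0)) &
      (forall t, U t -> forall n,
        derive1n 2 (qhat n) t =
          6 * \sum_(i < n.+3) qhat i t * qhat (n.+2 - i)%N t)].

Definition distinguished_branch (V : set C) (qhat : nat -> C -> C) :=
  formal_solution (proj_t @` V) qhat /\
  forall tau, V tau -> qhat 0%N (proj_t tau) = tau.

(* The circle of directions is realised as the unit circle of [C]. *)
Definition Arc_pi (alpha : R) : set C :=
  [set cis theta | theta in `]alpha - pi / 2, alpha + pi / 2[].

(* The real-oriented blowup of [C] at 0 in polar coordinates: [(r, u)] with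
   [r > 0] is the point [r u] of [C \ 0], and [(0, u)] is the point [u] of the
   boundary circle. *)
Definition blowup : set (R * C) := [set p | 0 <= p.1 /\ `|p.2| = 1].

Definition sectorial_nbhd (A S : set C) :=
  [/\ domain S, simply_connected R S, ~ S 0 &
    exists B : set (R * C),
      [/\ B `<=` blowup, open (B : set (subspace blowup)),
          simply_connected R B,
          S = [set p.1%:C * p.2 | p in B `&` [set p | 0 < p.1]] &
          A = [set u | B (0, u)]]].

Definition painleve1_solution (D : set (C * C)) (q : C * C -> C) :=
  forall t hbar, D (t, hbar) ->
    hbar ^+ 2 * derive1n 2 (fun s => q (s, hbar)) t = 6 * q (t, hbar) ^+ 2 + t.

(* Locally uniform asymptotics of uniform factorial type along [A]. *)
Definition asymptotic_to (A U : set C) (D : set (C * C))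
    (q : C * C -> C) (qhat : nat -> C -> C) :=
  forall t0, U t0 -> exists U0 S0 : set C,
    [/\ nbhs t0 U0, U0 `<=` U, sectorial_nbhd A S0, U0 `*` S0 `<=` D &
      exists K M : R, [/\ 0 < K, 0 < M &
        forall n t hbar, U0 t -> S0 hbar ->
          `|q (t, hbar) - \sum_(k < n) qhat k t * hbar ^+ k|
            <= (K * M ^+ n * n`!%:R)%:C * `|hbar| ^+ n]].

Definition asymptotic_solution (alpha : R) (U : set C) (qhat : nat -> C -> C)
    (D : set (C * C)) (q : C * C -> C) :=
  [/\ holomorphic_on D q, painleve1_solution D q &
      asymptotic_to (Arc_pi alpha) U D q qhat].

End PainleveI.

(* Main.v *)
(* With [tau = tc x^(1/2)], [t = -6 tau^2], [Z = x^(5/4)], [hbar = e^(i alpha) h],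
   [z = Z / h] and [q = tau Y(z)], where [tc^5 = 25/6912 e^(2 i alpha)] is chosen so
   that [x] runs over the sector [0 < arg x < 4 pi / 5] and [Z] over the upper
   half-plane, the equation becomes Boutroux' equation
   [Y'' + Y' / z = (Y^2 - 1) / 2 + (4 / 25) Y / z^2] for a function of [z] alone.

   Existence: the solution asymptotic to 1 is a fixed point on the half-planes
   [+-Re z + m Im z > 32 / m], [0 < m <= 1], which are invariant under the
   directions [+-m + i]; integrating [Y'' = Y + ...] along these rays is a
   contraction, and the solutions agree on overlaps.  The factorial bounds come
   from the same estimate applied to the difference with the truncated formal
   series.

   Uniqueness: the domain is taken to be the image of the union of all these
   half-planes.  For fixed [hbar] close to the direction [alpha], another solution
   gives a solution [Y2] of Boutroux' equation on a whole half-plane in [z].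
   Being holomorphic it satisfies [|Y2| <= C / dist^2 + 1] by the Cauchy estimates,
   so far inside [Y2^2 - 1] is small; asymptotics at one point select [Y2] near 1,
   and the contraction gives [Y2 = Y].  The identity theorem concludes. *)

From HB Require Import structures.
Require Import Defs.
From mathcomp Require Import all_boot all_order all_algebra.
From mathcomp Require Import all_classical all_reals all_analysis.
From mathcomp Require Import ring lra.
Import Order.TTheory GRing.Theory Num.Theory.
Import numFieldNormedType.Exports.
Import ComplexField.Normc.

Set Implicit Arguments.
Unset Strict Implicit.
Unset Printing Implicit Defensive.

Local Open Scope classical_set_scope.
Local Open Scope ring_scope.
Local Open Scope complex_scope.

Local Notation Re := complex.Re.
Local Notation Im := complex.Im.

(** * Modulus and topology of the complex plane *)

Section Modulus.
Variable R : realType.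
Local Notation C := R[i].
Implicit Types (x y z w : C) (a b : R).

(** The asymptotic condition binds a competitor only near each [t0] and on a sector that may shrink
    with [t0], so for fixed [hbar] it says nothing as [z] goes to infinity. Uniqueness therefore
    cannot follow Watson's lemma: the equation itself must supply the growth bound, on slices of a
    domain made large enough, and the asymptotics serve once, at order one and at a single [t0], to
    exclude [Y] near -1. Two directions are needed because [Y'' = Y] has the solutions [e^z] and
    [e^-z]: each grows along one of [m + i], [-m + i], so boundedness along both leaves no freedom.
    The price is a factor [4 / m] per inversion. In the half-plane of slope [m] one has
    [|z| >= 16 / m]; there the remaining terms are at most [m^2 / 128] on the ball of radius
    [m / 32] and Lipschitz with constant [m / 8]. Times [4 / m], this gives a self-map and the
    contraction factor 1/2. Letting [m] tend to 0 is what reaches the full opening [Arc_pi]. The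
    constant [25 / 6912] turns [12 tau], the derivative of [6 q^2] at [q = tau], into the
    coefficient 1 of [Y'' = Y]. *)

Lemma normcE' z : `|z| = (normc z)%:C.
Proof. by []. Qed.

Lemma normcB z w : normc (z - w) = normc (w - z).
Proof. by rewrite -normcN opprB. Qed.

Lemma normc_ge0 z : 0 <= normc z.
Proof. by case: z => a b /=; rewrite sqrtr_ge0. Qed.

Lemma normc_eq0 z : (normc z == 0) = (z == 0).
Proof.
by apply/eqP/eqP => [/eq0_normc|->]; last exact: normc0.
Qed.

Lemma normc_gt0 z : (0 < normc z) = (z != 0).
Proof. by rewrite lt_def normc_ge0 andbT normc_eq0. Qed.

Lemma normcX z n : normc (z ^+ n) = normc z ^+ n.
Proof. by elim: n => [|n IH]; rewrite ?expr0 ?normc1 // !exprS normcM IH. Qed.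

Lemma normc_real a : normc (a%:C) = `|a|.
Proof. by rewrite /= expr0n /= addr0 sqrtr_sqr. Qed.

Lemma normc_nat n : normc (n%:R : C) = n%:R.
Proof. by rewrite -(rmorph_nat (real_complex R)) normc_real ger0_norm. Qed.

Lemma sqr_normcE z : normc z ^+ 2 = Re z ^+ 2 + Im z ^+ 2.
Proof. by case: z => a b /=; rewrite sqr_sqrtr // addr_ge0 ?sqr_ge0. Qed.

Lemma normc_Re z : `|Re z| <= normc z.
Proof.
rewrite -(ler_pXn2r (_ : (0 < 2)%N)) ?nnegrE ?normc_ge0 //.
by rewrite sqr_normcE real_normK ?num_real // lerDl sqr_ge0.
Qed.

Lemma normc_Im z : `|Im z| <= normc z.
Proof.
rewrite -(ler_pXn2r (_ : (0 < 2)%N)) ?nnegrE ?normc_ge0 //.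
by rewrite sqr_normcE real_normK ?num_real // lerDr sqr_ge0.
Qed.

Lemma normc_leD z : normc z <= `|Re z| + `|Im z|.
Proof.
rewrite -(ler_pXn2r (_ : (0 < 2)%N)) ?nnegrE ?normc_ge0 ?addr_ge0 //.
rewrite sqr_normcE sqrrD !real_normK ?num_real //.
have : 0 <= `|Re z| * `|Im z| by rewrite mulr_ge0.
lra.
Qed.

Lemma le_normcB z w : normc (z - w) <= normc z + normc w.
Proof. by rewrite -[normc w]normcN le_normcD. Qed.

Lemma lerB_normc z w : normc z - normc w <= normc (z - w).
Proof. by rewrite lerBlDr -{1}[z](subrK w) le_normcD. Qed.

Lemma conj_mul_normc z : z * z^*%C = (normc z ^+ 2)%:C.
Proof. by rewrite sqr_normcE; case: z => a b; simpc; congr Complex; ring. Qed.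

Lemma cReD z w : Re (z + w) = Re z + Re w.
Proof. by case: z w => [a b] [c d]. Qed.
Lemma cImD z w : Im (z + w) = Im z + Im w.
Proof. by case: z w => [a b] [c d]. Qed.
Lemma cReN z : Re (- z) = - Re z.
Proof. by case: z. Qed.
Lemma cImN z : Im (- z) = - Im z.
Proof. by case: z. Qed.
Lemma cReM z w : Re (z * w) = Re z * Re w - Im z * Im w.
Proof. by case: z w => [a b] [c d]. Qed.
Lemma cImM z w : Im (z * w) = Re z * Im w + Im z * Re w.
Proof. by case: z w => [a b] [c d]. Qed.

Lemma complex_ext z w : Re z = Re w -> Im z = Im w -> z = w.
Proof. by case: z w => [a b] [c d] /= -> ->. Qed.

End Modulus.
Hint Resolve normc_ge0 : core.

Section Continuity.
Variable R : realType.
Local Notation C := R[i].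

Lemma ball_normcE (z w : C) (e : R) : ball z e%:C w <-> normc (w - z) < e.
Proof. by rewrite -ball_normE /= normcE' ltcR normcB. Qed.

Lemma nbhs_normcP (z : C) (A : set C) :
  nbhs z A <-> exists2 d : R, 0 < d & forall w, normc (w - z) < d -> A w.
Proof.
split.
  case/nbhs_ballP => -[e b] /=; rewrite ltcE /= => /andP[/eqP b0 e0] eA.
  exists e => // w wz; apply: eA; rewrite b0; exact/ball_normcE.
case=> d d0 dA; apply/nbhs_ballP; exists d%:C => /=; first by rewrite ltcR.
by move=> w /ball_normcE; exact: dA.
Qed.

Lemma cvg_normcP (T : Type) (F : set_system T) (f : T -> C) (l : C) : Filter F ->
  (f @ F --> l) <-> forall e : R, 0 < e -> \forall x \near F, normc (f x - l) < e.
Proof.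
move=> FF; split.
  move=> fl e e0; apply: (fl [set w | normc (w - l) < e]).
  by apply/nbhs_normcP; exists e.
move=> H A /nbhs_normcP [d d0 dA]; rewrite /nbhs /=.
by apply: filterS (H d d0) => x; exact: dA.
Qed.

Lemma continuous_normcP (f : C -> C) (z : C) : {for z, continuous f} <->
  forall e : R, 0 < e -> exists2 d : R, 0 < d &
    forall w, normc (w - z) < d -> normc (f w - f z) < e.
Proof.
split.
  move=> H e e0; apply/nbhs_normcP.
  exact: (cvg_normcP f (f z) (nbhs_filter z)).1 H e e0.
move=> H; apply/(cvg_normcP f (f z) (nbhs_filter z)) => e e0.
by apply/nbhs_normcP; exact: H.
Qed.

Lemma continuous_normc_RP (f : R -> C) (x : R) : {for x, continuous f} <->
  forall e : R, 0 < e -> exists2 d : R, 0 < d &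
    forall y, `|y - x| < d -> normc (f y - f x) < e.
Proof.
split.
  move=> /(cvg_normcP f (f x) (nbhs_filter x)) + e e0.
  move=> /(_ e e0) /nbhs_ballP [d d0 H].
  by exists d => // y yx; apply: H; rewrite -ball_normE /= distrC.
move=> H; apply/(cvg_normcP f (f x) (nbhs_filter x)) => e e0.
have [d d0 dH] := H e e0.
by apply/nbhs_ballP; exists d => // y; rewrite -ball_normE /= distrC; exact: dH.
Qed.

Lemma continuous_Re (z : C) : {for z, continuous (@Re R)}.
Proof.
move=> A /nbhs_ballP [e /= e0 eA]; apply/nbhs_normcP; exists e => // w wz.
apply: eA; rewrite -ball_normE /=.
by rewrite distrC (le_lt_trans _ wz) // -cReN -cReD normc_Re.
Qed.

Lemma continuous_Im (z : C) : {for z, continuous (@Im R)}.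
Proof.
move=> A /nbhs_ballP [e /= e0 eA]; apply/nbhs_normcP; exists e => // w wz.
apply: eA; rewrite -ball_normE /=.
by rewrite distrC (le_lt_trans _ wz) // -cImN -cImD normc_Im.
Qed.

Lemma continuous_normc (z : C) : {for z, continuous (@normc R)}.
Proof.
move=> A /nbhs_ballP [e /= e0 eA]; apply/nbhs_normcP; exists e => // w wz.
apply: eA; rewrite -ball_normE /=.
rewrite distrC; apply: le_lt_trans wz; rewrite ler_norml lerB_normc andbT.
by rewrite lerNl opprB normcB lerB_normc.
Qed.

Lemma continuous_real_complex (x : R) : {for x, continuous (real_complex R : R -> C)}.
Proof.
apply/continuous_normc_RP => e e0; exists e => // y yx.
by rewrite -rmorphB normc_real.
Qed.

Lemma cvg_complex (T : Type) (F : set_system T) (f : T -> C) (l : C) : Filter F ->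
  (fun x => Re (f x)) @ F --> Re l -> (fun x => Im (f x)) @ F --> Im l ->
  f @ F --> l.
Proof.
move=> FF /cvgrPdist_lt Hr /cvgrPdist_lt Hi; apply/cvg_normcP => e e0.
have e2 : 0 < e / 2 by rewrite divr_gt0.
apply: filterS2 (Hr _ e2) (Hi _ e2) => x /= h1 h2.
apply: le_lt_trans (normc_leD _) _; rewrite [ltRHS](splitr e) ltrD //.
  by rewrite cReD cReN distrC.
by rewrite cImD cImN distrC.
Qed.

Section Limits.
Context {T : Type} {F : set_system T} {FF : Filter F}.
Implicit Types (f g : T -> C) (a b : C).

Lemma cvgDc f g a b : f @ F --> a -> g @ F --> b -> (fun x => f x + g x) @ F --> a + b.
Proof. exact: (@cvgD C C T F FF f g a b). Qed.

Lemma cvgBc f g a b : f @ F --> a -> g @ F --> b -> (fun x => f x - g x) @ F --> a - b.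
Proof. exact: (@cvgB C C T F FF f g a b). Qed.

Lemma cvgNc f a : f @ F --> a -> (fun x => - f x) @ F --> - a.
Proof. exact: (@cvgN C C T F FF f a). Qed.

Lemma cvgMc f g a b : f @ F --> a -> g @ F --> b -> (fun x => f x * g x) @ F --> a * b.
Proof. exact: (@cvgM C T F FF f g a b). Qed.

Lemma cvgVc f a : a != 0 -> f @ F --> a -> (fun x => (f x)^-1) @ F --> a^-1.
Proof. exact: (@cvgV C T F FF f a). Qed.

Lemma cvg_cstc a : (fun=> a : C) @ F --> a.
Proof. exact: cvg_cst. Qed.
End Limits.

Section ContinuousAt.
Context {K : topologicalType}.
Implicit Types (f g : K -> C) (s : K).

Lemma contD f g s : {for s, continuous f} -> {for s, continuous g} ->
  {for s, continuous (fun x => f x + g x)}.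
Proof. by move=> fc gc; exact: (@cvgDc K (nbhs s) (nbhs_filter s) f g (f s) (g s) fc gc). Qed.

Lemma contB f g s : {for s, continuous f} -> {for s, continuous g} ->
  {for s, continuous (fun x => f x - g x)}.
Proof. by move=> fc gc; exact: (@cvgBc K (nbhs s) (nbhs_filter s) f g (f s) (g s) fc gc). Qed.

Lemma contN f s : {for s, continuous f} -> {for s, continuous (fun x => - f x)}.
Proof. by move=> fc; exact: (@cvgNc K (nbhs s) (nbhs_filter s) f (f s) fc). Qed.

Lemma contM f g s : {for s, continuous f} -> {for s, continuous g} ->
  {for s, continuous (fun x => f x * g x)}.
Proof. by move=> fc gc; exact: (@cvgMc K (nbhs s) (nbhs_filter s) f g (f s) (g s) fc gc). Qed.

Lemma contV f s : f s != 0 -> {for s, continuous f} -> {for s, continuous (fun x => (f x)^-1)}.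
Proof. by move=> f0 fc; exact: (@cvgVc K (nbhs s) (nbhs_filter s) f (f s) f0 fc). Qed.

Lemma cont_cst (a : C) s : {for s, continuous (fun=> a : C)}.
Proof. exact: (@cvg_cstc K (nbhs s) (nbhs_filter s) a). Qed.

Lemma cont_comp (L M : topologicalType) (f : L -> M) (g : K -> L) s :
  {for g s, continuous f} -> {for s, continuous g} -> {for s, continuous (fun x => f (g x))}.
Proof.
by move=> fc gc; exact: (@cvg_comp K L M g f (nbhs s) (nbhs (g s)) (nbhs (f (g s))) gc fc).
Qed.

End ContinuousAt.

End Continuity.

(** * Complex differentiation *)

Section CaratheodoryDerivative.
Variables (R : realType) (K : topologicalType) (iota : K -> R[i]).
Local Notation C := R[i].
Implicit Types (f g : K -> C) (s : K) (l m : C).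

(* Caratheodory derivative along [iota]: complex derivatives for [iota = id],
   derivatives of curves for the embedding of the reals. *)
Definition dv f s l := exists phi : K -> C,
  [/\ {for s, continuous phi}, phi s = l &
      forall x, f x = f s + phi x * (iota x - iota s)].

Lemma dv_cst (c : C) s : dv (fun=> c) s 0.
Proof.
exists (fun=> 0); split; [exact: cont_cst|by []|].
by move=> x; rewrite mul0r addr0.
Qed.

Lemma dv_emb s : dv iota s 1.
Proof.
exists (fun=> 1); split; [exact: cont_cst|by []|].
by move=> x; rewrite mul1r subrKC.
Qed.

Lemma dvD f g s l m : dv f s l -> dv g s m -> dv (fun x => f x + g x) s (l + m).
Proof.
move=> [p [pc pl pE]] [r [rc rl rE]]; exists (fun x => p x + r x); split.
- exact: contD.
- by rewrite pl rl.
- by move=> x; rewrite [f x]pE [g x]rE; ring.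
Qed.

Lemma dvN f s l : dv f s l -> dv (fun x => - f x) s (- l).
Proof.
move=> [p [pc pl pE]]; exists (fun x => - p x); split.
- exact: contN.
- by rewrite pl.
- by move=> x; rewrite [f x]pE; ring.
Qed.

Lemma dvB f g s l m : dv f s l -> dv g s m -> dv (fun x => f x - g x) s (l - m).
Proof. by move=> fl /dvN gm; exact: dvD. Qed.

Hypothesis iota_cont : continuous iota.

Lemma dv_continuous f s l : dv f s l -> {for s, continuous f}.
Proof.
move=> [p [pc pl pE]].
have -> : f = (fun x => f s + p x * (iota x - iota s)).
  by apply/funext => x; exact: pE.
apply: contD; first exact: cont_cst.
apply: contM; first exact: pc.
by apply: contB; [exact: iota_cont|exact: cont_cst].
Qed.

Lemma dvM f g s l m : dv f s l -> dv g s m ->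
  dv (fun x => f x * g x) s (l * g s + f s * m).
Proof.
move=> [p [pc pl pE]] [r [rc rl rE]].
have gc : {for s, continuous g} by apply: dv_continuous; exists r.
exists (fun x => p x * g x + f s * r x); split.
- by apply: contD; apply: contM; [exact: pc|exact: gc|exact: cont_cst|exact: rc].
- by rewrite pl rl.
- by move=> x; rewrite [f x]pE [g x]rE; ring.
Qed.

Lemma dvZ (c : C) f s l : dv f s l -> dv (fun x => c * f x) s (c * l).
Proof.
by move=> fl; have := dvM (dv_cst c s) fl; rewrite mul0r add0r.
Qed.

Lemma dvV f s l : dv f s l -> f s != 0 ->
  dv (fun x => (f x)^-1) s (- l / f s ^+ 2).
Proof.
move=> fd f0; have fc := dv_continuous fd; case: fd => p [pc pl pE].
(* At zeros of [f] the inverse is 0 by convention, so the factor is the plain difference quotient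
   there. Near [s] this branch is never taken, and continuity only concerns the other one. *)
pose A x := if f x == 0 then (iota x - iota s)^-1 * ((f x)^-1 - (f s)^-1)
            else - p x / (f x * f s).
exists A; split.
- have d0 : 0 < normc (f s) by rewrite normc_gt0.
  have dH w : normc (w - f s) < normc (f s) -> w != 0.
    by move=> h; apply/negP => /eqP w0; move: h; rewrite w0 sub0r normcN ltxx.
  have As : A s = - p s / (f s * f s) by rewrite /A (negbTE f0).
  rewrite /prop_for /continuous_at As.
  have : {for s, continuous (fun x => - p x / (f x * f s))}.
    apply: contM; first exact: contN.
    apply: contV; first by rewrite mulf_neq0.
    by apply: contM; [exact: fc|exact: cont_cst].
  apply: cvg_trans; apply: near_eq_cvg.
  have : \forall x \near s, normc (f x - f s) < normc (f s).
    exact: (cvg_normcP f (f s) (nbhs_filter s)).1 fc _ d0.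
  by apply: filterS => x xd; rewrite /A (negbTE (dH _ xd)).
- by rewrite /A (negbTE f0) pl expr2.
- move=> x; rewrite /A; case: eqVneq => [fx0|fx0].
    have [i0|i0] := eqVneq (iota x - iota s) 0.
      by move: fx0; rewrite pE i0 mulr0 addr0 => /eqP; rewrite (negbTE f0).
    by rewrite fx0 invr0 sub0r mulrAC mulVf // mul1r subrr.
  have -> : - p x / (f x * f s) * (iota x - iota s) =
    - (p x * (iota x - iota s)) / (f x * f s) by field; rewrite f0 fx0.
  have -> : p x * (iota x - iota s) = f x - f s.
    by rewrite [f x]pE addrAC subrr add0r.
  by field; rewrite f0 fx0.
Qed.

Lemma dv_eq f s l m : l = m -> dv f s l -> dv f s m.
Proof. by move=> <-. Qed.

Hypothesis iota_inj : injective iota.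

(** The passage to the little-o form. Conversely the factor is the difference quotient, with value
    [l] where [iota x = iota s]; injectivity of [iota] makes the factorisation hold there too. *)
Lemma dvP f s l : dv f s l <-> forall e : R, 0 < e -> \forall x \near s,
  normc (f x - f s - l * (iota x - iota s)) <= e * normc (iota x - iota s).
Proof.
split.
  move=> [p [pc pl pE]] e e0.
  have := (cvg_normcP p (p s) (nbhs_filter s)).1 pc e e0.
  apply: filterS => x; rewrite pl => pe.
  have -> : f x - f s - l * (iota x - iota s) = (p x - l) * (iota x - iota s).
    by rewrite [f x]pE; ring.
  by rewrite normcM ler_wpM2r // ltW.
move=> H.
pose p x := if iota x - iota s == 0 then l else (f x - f s) / (iota x - iota s).
have ps : p s = l by rewrite /p subrr eqxx.
exists p; split; [|exact: ps|].
- rewrite /prop_for /continuous_at ps; apply/cvg_normcP => e e0.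
  have e2 : 0 < e / 2 by rewrite divr_gt0.
  apply: filterS (H _ e2) => x; rewrite /p; case: eqVneq => [i0 _|i0 xe].
    by rewrite subrr normc0.
  rewrite -(ltr_pM2r (_ : 0 < normc (iota x - iota s))) ?normc_gt0 // -normcM.
  rewrite mulrBl divfK //; apply: le_lt_trans xe _.
  by rewrite ltr_pM2r ?normc_gt0 // ltr_pdivrMr // mulr2n mulrDr mulr1 ltrDl.
- move=> x; rewrite /p; case: eqVneq => [i0|i0].
    by rewrite i0 mulr0 addr0; congr f; apply: iota_inj; apply/eqP; rewrite -subr_eq0 i0.
  by rewrite divfK // subrKC.
Qed.

(** The factorisation in [dv] is required for every [x], so its locality is visible only through the
    little-o form. *)
Lemma near_dv f g s l : (\forall x \near s, f x = g x) -> dv f s l -> dv g s l.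
Proof.
move=> fg /dvP H; apply/dvP => e e0; have := nbhs_singleton fg => fgs.
by apply: filterS2 fg (H e e0) => x <-; rewrite fgs.
Qed.

End CaratheodoryDerivative.

Definition hd (R : realType) := @dv R R[i] id.
Definition rd (R : realType) := @dv R R (real_complex R).

Section Derivatives.
Variable R : realType.
Local Notation C := R[i].

Lemma real_complex_continuous : continuous (real_complex R : R -> C).
Proof. by move=> x; exact: continuous_real_complex. Qed.

Lemma id_continuous : continuous (id : C -> C).
Proof. by move=> x. Qed.

Lemma hd_continuous (f : C -> C) z l : hd f z l -> {for z, continuous f}.
Proof. exact: (@dv_continuous R C id id_continuous). Qed.

Lemma rd_continuous (f : R -> C) z l : rd f z l -> {for z, continuous f}.
Proof. exact: (@dv_continuous R R _ real_complex_continuous). Qed.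

Lemma dv_comp (K : topologicalType) (iota : K -> C) (f : C -> C) (g : K -> C) s l m :
  continuous iota ->
  hd f (g s) l -> dv iota g s m -> dv iota (fun x => f (g x)) s (l * m).
Proof.
move=> ic fd gd; have gc := dv_continuous ic gd.
case: fd gd => p [pc pl pE] [r [rc rl rE]].
exists (fun x => p (g x) * r x); split.
- apply: contM; last exact: rc.
  by apply: cont_comp; [exact: pc|exact: gc].
- by rewrite pl rl.
- by move=> x; rewrite pE {2}[g x]rE /=; ring.
Qed.

Lemma hd_comp (f g : C -> C) s l m :
  hd f (g s) l -> hd g s m -> hd (fun x => f (g x)) s (l * m).
Proof. exact: (@dv_comp C id f g s l m id_continuous). Qed.

Lemma rd_comp (f : C -> C) (g : R -> C) s l m :
  hd f (g s) l -> rd g s m -> rd (fun x => f (g x)) s (l * m).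
Proof. exact: (@dv_comp R _ f g s l m real_complex_continuous). Qed.

Lemma hdP (f : C -> C) z l : hd f z l <-> forall e : R, 0 < e ->
  exists2 d : R, 0 < d & forall w, normc (w - z) < d ->
    normc (f w - f z - l * (w - z)) <= e * normc (w - z).
Proof.
split.
  by move=> /(dvP (fun _ _ => id)) H e e0; apply/nbhs_normcP; exact: H.
by move=> H; apply/(dvP (fun _ _ => id)) => e e0; apply/nbhs_normcP; exact: H.
Qed.

Lemma hd_unique (f : C -> C) z l m : hd f z l -> hd f z m -> l = m.
Proof.
move=> /hdP fl /hdP fm; apply/eqP; rewrite -subr_eq0 -normc_eq0.
apply/eqP/le_anti; rewrite normc_ge0 andbT; apply/ler_addgt0Pr => e e0.
rewrite add0r.
have e2 : 0 < e / 2 by rewrite divr_gt0.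
have [d d0 dH] := fl _ e2; have [d' d'0 dH'] := fm _ e2.
pose h : C := (Num.min d d' / 2)%:C.
have h0 : 0 < Num.min d d' / 2 by rewrite divr_gt0 // lt_min d0.
have nh : normc h = Num.min d d' / 2 by rewrite normc_real gtr0_norm.
have hd : normc (z + h - z) < d.
  by rewrite addrC addKr nh ltr_pdivrMr // gt_min; apply/orP; left; lra.
have hd' : normc (z + h - z) < d'.
  by rewrite addrC addKr nh ltr_pdivrMr // gt_min; apply/orP; right; lra.
have := dH _ hd; have := dH' _ hd'.
rewrite [z + h - z]addrC addKr nh => h1 h2.
rewrite -(ler_pM2r h0) -{1}nh -normcM.
have -> : (l - m) * h = (f (z + h) - f z - m * h) - (f (z + h) - f z - l * h).
  by ring.
apply: le_trans (le_normcB _ _) _; apply: le_trans (lerD h1 h2) _; lra.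
Qed.

Lemma near_hd (f g : C -> C) z l : (\forall x \near z, f x = g x) -> hd f z l -> hd g z l.
Proof. exact: (@near_dv R C id (fun _ _ => id) f g z l). Qed.

Lemma hdX (n : nat) (z : C) : hd (fun w => w ^+ n) z (n%:R * z ^+ n.-1).
Proof.
elim: n => [|n IH] /=; first by rewrite mul0r; exact: dv_cst.
have := dvM id_continuous (dv_emb id z) IH => /= H.
have -> : (fun w : C => w ^+ n.+1) = (fun w => w * w ^+ n).
  by apply/funext => w; rewrite exprS.
apply: dv_eq H; case: n {IH} => [|n]; first by rewrite mul0r mulr0 addr0.
by rewrite /= [in RHS]mulrS mulrCA -exprS mulrDl mul1r.
Qed.

Lemma rd_affine (a b : C) (s : R) : rd (fun x => a + x%:C * b) s b.
Proof.
have := dvD (dv_cst (real_complex R) a s)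
  (dvM real_complex_continuous (dv_emb (real_complex R) s) (dv_cst (real_complex R) b s)).
by apply: dv_eq; rewrite mulr0 addr0 mul1r add0r.
Qed.

Lemma is_derive_caratheodory (f : R -> R) (s a : R) : is_derive s 1 f a <->
  exists p : R -> R, [/\ {for s, continuous p}, p s = a &
     forall x, f x = f s + p x * (x - s)].
Proof.
split.
  move=> /is_derive1_caratheodory [p [pE pc ps]]; exists p; split; [exact: pc|exact: ps|move=> x].
  by rewrite -pE subrKC.
move=> [p [pc ps pE]]; apply/is_derive1_caratheodory; exists p; split; [move=> x|exact: pc|exact: ps].
by rewrite pE addrC addKr.
Qed.

Lemma rd_Re (f : R -> C) (s : R) (l : C) : rd f s l -> is_derive s 1 (fun x => Re (f x)) (Re l).
Proof.
move=> [p [pc pl pE]]; apply/is_derive_caratheodory.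
exists (fun x => Re (p x)); split; last 1 first.
- by move=> x; rewrite [f x]pE cReD cReM -rmorphB /= mulr0 subr0.
- by apply: (cont_comp (f := @Re R)); [exact: continuous_Re|exact: pc].
- by rewrite pl.
Qed.

Lemma rd_pair (g h : R -> R) (s a b : R) : is_derive s 1 g a -> is_derive s 1 h b ->
  rd (fun x => g x +i* h x) s (a +i* b).
Proof.
move=> /is_derive_caratheodory [p [pc pa pE]] /is_derive_caratheodory [r [rc rb rE]].
exists (fun x => p x +i* r x); split.
- exact: (@cvg_complex _ R (nbhs s) (fun x => p x +i* r x) (p s +i* r s) _ pc rc).
- by rewrite pa rb.
- move=> x; rewrite -rmorphB; apply: complex_ext.
    by rewrite cReD cReM /= mulr0 subr0 -pE.
  by rewrite cImD cImM /= mulr0 add0r -rE.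
Qed.

Lemma real_mvt (g g' : R -> R) (a b : R) : a <= b ->
  (forall x, x \in `[a, b] -> is_derive x 1 g (g' x)) ->
  exists2 c, c \in `[a, b] & g b - g a = g' c * (b - a).
Proof.
move=> ab gd.
have gc : {within [set` `[a, b]], continuous g}.
  apply: derivable_within_continuous => x xab; case: (gd x xab) => dx _.
  exact: dx.
have gd' x : x \in `]a, b[ -> is_derive x 1 g (g' x).
  by move=> xab; apply: gd; exact: subset_itv_oo_cc xab.
exact: (@MVT_segment R g g' a b ab gd' gc).
Qed.

(** The mean value inequality for complex curves: after rotation by the unit number [u] that makes
    [u * (f b - f a)] real and nonnegative, the real mean value theorem applies to
    [g - Re (u * f)]. *)
Lemma rd_norm_le (f f' : R -> C) (g g' : R -> R) (a b : R) : a <= b ->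
  (forall x, x \in `[a, b] -> rd f x (f' x)) ->
  (forall x, x \in `[a, b] -> is_derive x 1 g (g' x)) ->
  (forall x, x \in `[a, b] -> normc (f' x) <= g' x) ->
  normc (f b - f a) <= g b - g a.
Proof.
move=> ab fd gd fg.
have [->|D0] := eqVneq (f b - f a) 0.
  rewrite normc0 subr_ge0.
  have [c cab E] := real_mvt ab gd.
  rewrite -subr_ge0 E mulr_ge0 ?subr_ge0 //.
  by apply: le_trans (fg _ cab).
pose u := (f b - f a)^*%C / (normc (f b - f a))%:C.
have norm1 : normc u = 1.
  rewrite normcM normcV normc_real (ger0_norm (normc_ge0 _)).
  have -> : normc (f b - f a)^*%C = normc (f b - f a).
    by case: (f b - f a) => x y /=; rewrite sqrrN.
  by rewrite divff // normc_eq0.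
have uD : Re (u * (f b - f a)) = normc (f b - f a).
  rewrite /u mulrAC [_^*%C * _]mulrC conj_mul_normc -rmorphV ?unitfE ?normc_eq0 //.
  by rewrite -rmorphM /= expr2 mulfK // normc_eq0.
pose k x := g x - Re (u * f x).
pose k' x := g' x - Re (u * f' x).
have kd x : x \in `[a, b] -> is_derive x 1 k (k' x).
  move=> xab; apply: is_deriveB; first exact: gd.
  by apply: rd_Re; apply: (dvZ real_complex_continuous); exact: fd.
have [c cab E] := real_mvt ab kd.
have : 0 <= k b - k a.
  rewrite E; apply: mulr_ge0; last by rewrite subr_ge0.
  rewrite /k' subr_ge0; apply: le_trans (fg _ cab).
  apply: le_trans (ler_norm _) _; apply: le_trans (normc_Re _) _.
  by rewrite normcM norm1 mul1r.
rewrite /k -uD mulrBr cReD cReN; lra.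
Qed.

Lemma rd_lipschitz (f f' : R -> C) (M a b : R) : a <= b ->
  (forall x, x \in `[a, b] -> rd f x (f' x)) ->
  (forall x, x \in `[a, b] -> normc (f' x) <= M) ->
  normc (f b - f a) <= M * (b - a).
Proof.
move=> ab fd fM.
have := @rd_norm_le f f' (fun x => M * x) (fun=> M) a b ab fd _ fM.
rewrite mulrBr; apply => x _; apply/is_derive_caratheodory.
exists (fun=> M); split; [exact: cvg_cst|by []|move=> y; ring].
Qed.

Lemma antiderivative (f : R -> C) : continuous f ->
  exists F : R -> C, forall x : R, x \in `[0, 1] -> rd F x (f x).
Proof.
move=> fc.
have H (g : R -> R) : continuous g -> exists G : R -> R, forall x : R, x \in `[0, 1] ->
    is_derive x 1 G (g x).
  move=> gc.
  (* Integrating from -1 inside [[-1, 2]] makes both ends of [[0, 1]] interior points, so two-sided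
     derivatives exist there. *)
  exists (fun x => \int[lebesgue_measure]_(t in `[-1, x]) g t)%R.
  move=> x; rewrite in_itv /= => /andP[x0 x1].
  have ig : (@lebesgue_measure R).-integrable `[-1, 2] (EFin \o g).
    apply: continuous_compact_integrable; first exact: segment_compact.
    exact: continuous_subspaceT.
  have [] := @continuous_FTC1_closed R g (-1) x 2 _ ig _ (gc x); [lra|lra|].
  by move=> d1 d2; split; [exact: d1|rewrite -derive1E; exact: d2].
have [G Gd] := H (fun x => Re (f x)) (fun x => cont_comp (@continuous_Re R _) (fc x)).
have [I Id] := H (fun x => Im (f x)) (fun x => cont_comp (@continuous_Im R _) (fc x)).
exists (fun x => G x +i* I x) => x x01.
by apply: dv_eq (rd_pair (Gd x x01) (Id x x01)); case: (f x).
Qed.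

End Derivatives.

(** * Cauchy's theorem and its consequences *)

Section GeometricConvergence.
Variable R : realType.

(** The radius [r n] dominates the sum of all later steps, so the intervals around [u n] are nested
    and the supremum of their left ends lies in each; this gives an explicit rate along with the
    limit. *)
Lemma geometric_cauchy (u : nat -> R) (A : R) :
  (forall n, `|u n.+1 - u n| <= A / 2 ^+ n) ->
  exists l : R, forall n, `|u n - l| <= 2 * A / 2 ^+ n.
Proof.
move=> H.
pose r n : R := 2 * A / 2 ^+ n.
have rS n : r n = 2 * r n.+1 by rewrite /r exprS; field; rewrite expf_neq0 ?pnatr_eq0.
have HS n : `|u n.+1 - u n| <= r n.+1.
  by have := H n; rewrite /r exprS; congr (_ <= _); field; rewrite expf_neq0 ?pnatr_eq0.
have r0 n : 0 <= r n by rewrite rS mulr_ge0 // (le_trans _ (HS n)).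
pose lo n := u n - r n; pose hi n := u n + r n.
have loS n : lo n <= lo n.+1.
  by have := HS n; rewrite /lo (rS n) ler_norml => /andP[]; lra.
have hiS n : hi n.+1 <= hi n.
  by have := HS n; rewrite /hi (rS n) ler_norml => /andP[]; lra.
have loM n k : lo n <= lo (n + k)%N.
  by elim: k => [|k IH]; rewrite ?addn0 // addnS (le_trans IH).
have hiM n k : hi (n + k)%N <= hi n.
  by elim: k => [|k IH]; rewrite ?addn0 // addnS; apply: le_trans (hiS _) IH.
have lohi n m : lo n <= hi m.
  apply: le_trans (loM n m) _; apply: le_trans (_ : hi (n + m)%N <= _).
    by rewrite /lo /hi; have := r0 (n + m)%N; lra.
  by rewrite addnC hiM.
pose E := [set x | exists n, x = lo n].
have E0 : E !=set0 by exists (lo 0%N), 0%N.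
have Eub m : ubound E (hi m) by move=> x [n ->].
exists (sup E) => n; rewrite ler_norml.
have h1 : lo n <= sup E.
  by apply: ub_le_sup; [exists (hi 0%N)|exists n].
have h2 : sup E <= hi n by apply: ge_sup.
by rewrite /lo /hi /r in h1 h2; apply/andP; split; lra.
Qed.

Lemma geometric_small (A e : R) : 0 < e -> exists n, A / 2 ^+ n < e.
Proof.
move=> e0; have [A0|A0] := leP A 0.
  by exists 0%N; rewrite expr0 divr1 (le_lt_trans A0).
exists (Num.bound (A / e)); rewrite ltr_pdivrMr ?exprn_gt0 // -ltr_pdivrMl // mulrC.
have /archi_boundP h : 0 <= A / e by rewrite divr_ge0 // ltW.
apply: lt_le_trans h _.
by rewrite -natrX ler_nat ltnW // ltn_expl.
Qed.

Lemma geometric_le0 (a A : R) : (forall n, a <= A / 2 ^+ n) -> a <= 0.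
Proof.
move=> H; apply/ler_addgt0Pr => e e0; rewrite add0r.
by have [n ne] := geometric_small A e0; apply: le_trans (H n) (ltW ne).
Qed.

End GeometricConvergence.

(** * Integrals along segments *)

Section SegmentIntegral.
Variable R : realType.
Local Notation C := R[i].
Implicit Types (f g F : C -> C) (a b c z w : C) (s t : R).

Definition segpt a b s : C := a + s%:C * (b - a).

(** The integral is the increment of any primitive along the parametrised segment. Every rule of
    integration becomes one of differentiation, and uniqueness is the Lipschitz bound with constant
    0. *)
Definition is_segint f a b v := exists F : R -> C,
  (forall s, s \in `[0, 1] -> rd F s (f (segpt a b s) * (b - a))) /\ v = F 1 - F 0.

Definition segint f a b := xget 0 (is_segint f a b).

Definition contseg f a b := forall s, s \in `[0, 1] -> {for segpt a b s, continuous f}.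

Lemma is_segint_unique f a b v w : is_segint f a b v -> is_segint f a b w -> v = w.
Proof.
move=> [F [Fd ->]] [G [Gd ->]].
have := @rd_lipschitz R (fun s => F s - G s) (fun=> 0) 0 0 1 ler01.
rewrite mul0r => H; apply/eqP; rewrite -subr_eq0 -normc_eq0 -normr_le0.
rewrite (ger0_norm (normc_ge0 _)); apply: le_trans (H _ _).
- by rewrite le_eqVlt; apply/orP; left; apply/eqP; congr normc; ring.
- move=> s s01; apply: dv_eq (dvB (Fd _ s01) (Gd _ s01)); exact: subrr.
- by move=> s _; rewrite normc0.
Qed.

Lemma segintE f a b v : is_segint f a b v -> segint f a b = v.
Proof. by move=> H; exact: is_segint_unique (xgetI 0 H) H. Qed.

Lemma segintP f a b : contseg f a b -> is_segint f a b (segint f a b).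
Proof.
move=> fc.
(* [cl] clamps the line to [[0, 1]]: [f] is continuous only at the points of the segment, while
   [antiderivative] wants an integrand continuous everywhere. *)
pose cl s : R := (`|s| - `|s - 1| + 1) / 2.
have clc : continuous cl.
  move=> s; apply: cvgM; last exact: cvg_cst.
  apply: cvgD; last exact: cvg_cst.
  apply: cvgB; apply: cvg_norm; first exact: cvg_id.
  by apply: cvgB; [exact: cvg_id|exact: cvg_cst].
have cl01 s : cl s \in `[0, 1].
  rewrite in_itv /= /cl.
  have h1 := ler_normD (s - 1) 1; have h2 := ler_normD s (-1).
  by rewrite subrK normrN normr1 in h1 h2; apply/andP; split; lra.
have clE s : s \in `[0, 1] -> cl s = s.
  rewrite in_itv /= /cl => /andP[s0 s1].
  by rewrite (ger0_norm s0) distrC ger0_norm ?subr_ge0 //; field.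
have gc : continuous (fun s => f (segpt a b (cl s)) * (b - a)).
  move=> s; apply: (@contM R R (fun s => f (segpt a b (cl s))) (fun=> b - a) s).
    apply: (@cont_comp R C C f (fun s => segpt a b (cl s)) s); first exact: fc.
    apply: (@contD R R (fun=> a) (fun s => (cl s)%:C * (b - a))); first exact: cont_cst.
    apply: (@contM R R (fun s => (cl s)%:C) (fun=> b - a)); last exact: cont_cst.
    apply: (@cont_comp R R C (real_complex R) cl s); first exact: continuous_real_complex.
    exact: clc.
  exact: cont_cst.
have [F Fd] := antiderivative gc.
have H : is_segint f a b (F 1 - F 0).
  by exists F; split => // s s01; have := Fd s s01; rewrite clE.
by rewrite (segintE H).
Qed.

Lemma segint_rev f a b : contseg f a b -> segint f b a = - segint f a b.
Proof.
move=> fc; have [F [Fd ->]] := segintP fc.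
apply: segintE; exists (fun s => F (1 - s)); split; last by rewrite subrr subr0 opprB.
move=> s s01.
have s01' : 1 - s \in `[0, 1] by move: s01; rewrite !in_itv /= => /andP[? ?]; apply/andP; split; lra.
have [p [pc ps pE]] := Fd _ s01'.
exists (fun x => - p (1 - x)); split.
- apply: contN; apply: (cont_comp (f := p)); first exact: pc.
  by apply: cvgB; [exact: cvg_cst|exact: cvg_id].
- rewrite ps -mulrN opprB; congr (f _ * _).
  by rewrite /segpt rmorphB rmorph1; ring.
- by move=> x; rewrite pE !rmorphB !rmorph1; ring.
Qed.

Lemma segint_mid f a b : contseg f a b ->
  segint f a b = segint f a ((a + b) / 2) + segint f ((a + b) / 2) b.
Proof.
move=> fc; have [F [Fd ->]] := segintP fc.
(* Both halves at once: [k = 0] for the first and [k = 1 / 2] for the second, each obtained by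
   reparametrising the same primitive [F]. *)
have H (k : R) : k = 0 \/ k = 2^-1 -> forall c d, c = segpt a b k -> d = segpt a b (k + 2^-1) ->
    segint f c d = F (k + 2^-1) - F k.
  move=> k01 c d cE dE; apply: segintE; exists (fun s => F (k + 2^-1 * s)).
  split; last by rewrite mulr0 mulr1 addr0.
  move=> s s01.
  have s01' : k + 2^-1 * s \in `[0, 1].
    move: s01; rewrite !in_itv /= => /andP[? ?]; case: k01 => ->; apply/andP; split; lra.
  have [p [pc ps pE]] := Fd _ s01'.
  exists (fun x => 2^-1 * p (k + 2^-1 * x)); split.
  - apply: contM; first exact: cont_cst.
    apply: (cont_comp (f := p)); first exact: pc.
    apply: cvgD; first exact: cvg_cst.
    by apply: cvgM; [exact: cvg_cst|exact: cvg_id].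
  - have -> : segpt c d s = segpt a b (k + 2^-1 * s).
      rewrite cE dE /segpt !rmorphD rmorphM fmorphV rmorph_nat; field; rewrite ?pnatr_eq0 //.
    rewrite ps cE dE /segpt !rmorphD fmorphV rmorph_nat; field; rewrite ?pnatr_eq0 //.
  - by move=> x; rewrite pE !rmorphD !rmorphM fmorphV rmorph_nat; field; rewrite ?pnatr_eq0 //.
rewrite (H 0 (or_introl erefl)); first last.
- by rewrite /segpt add0r fmorphV rmorph_nat; field; rewrite ?pnatr_eq0 //.
- by rewrite /segpt; ring.
rewrite (H (2^-1) (or_intror erefl)); first last.
- by rewrite /segpt rmorphD fmorphV rmorph_nat; field; rewrite ?pnatr_eq0 //.
- by rewrite /segpt fmorphV rmorph_nat; field; rewrite ?pnatr_eq0 //.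
have -> : 2^-1 + 2^-1 = 1 :> R by field.
by rewrite add0r; ring.
Qed.

Lemma segint_ftc f F a b : (forall s, s \in `[0, 1] -> hd F (segpt a b s) (f (segpt a b s))) ->
  segint f a b = F b - F a.
Proof.
move=> Fd; apply: segintE; exists (fun s => F (segpt a b s)); split.
  by move=> s s01; apply: (rd_comp (Fd s s01)); exact: rd_affine.
by rewrite /segpt mul1r mul0r addr0 subrKC.
Qed.

Lemma segint_dist f g a b (M : R) : contseg f a b -> contseg g a b ->
  (forall s, s \in `[0, 1] -> normc (f (segpt a b s) - g (segpt a b s)) <= M) ->
  normc (segint f a b - segint g a b) <= M * normc (b - a).
Proof.
move=> /segintP [F [Fd ->]] /segintP [G [Gd ->]] H.
have := @rd_lipschitz R (fun s => F s - G s)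
  (fun s => f (segpt a b s) * (b - a) - g (segpt a b s) * (b - a))
  (M * normc (b - a)) 0 1 ler01.
rewrite subr0 mulr1 => L; apply: le_trans (L _ _).
- by rewrite le_eqVlt; apply/orP; left; apply/eqP; congr normc; ring.
- by move=> s s01; exact: dvB (Fd _ s01) (Gd _ s01).
- by move=> s s01; rewrite -mulrBl normcM ler_wpM2r ?normc_ge0 ?H.
Qed.

Lemma segint_le f a b (M : R) : contseg f a b ->
  (forall s, s \in `[0, 1] -> normc (f (segpt a b s)) <= M) ->
  normc (segint f a b) <= M * normc (b - a).
Proof.
move=> fc fM; have z0 : segint (fun=> 0) a b = 0.
  rewrite (@segint_ftc _ (fun=> 0)) ?subrr // => s _; exact: dv_cst.
have := @segint_dist f (fun=> 0) a b M fc; rewrite z0 subr0; apply.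
- by move=> s _; exact: cont_cst.
- by move=> s s01; rewrite subr0 fM.
Qed.

Lemma contseg_hd f a b : (forall s, s \in `[0, 1] -> exists l, hd f (segpt a b s) l) ->
  contseg f a b.
Proof. by move=> fd s /fd [l fl]; exact: hd_continuous fl. Qed.

Definition triint f a b c := segint f a b + segint f b c + segint f c a.

End SegmentIntegral.

(** * Goursat's theorem for triangles *)

Section Goursat.
Variable R : realType.
Local Notation C := R[i].
Variables (f : C -> C) (P u v : C).

Let pt (x y : R) : C := P + x%:C * u + y%:C * v.
Let simp (x y : R) := [/\ 0 <= x, 0 <= y & x + y <= 1].
Hypothesis fd : forall x y, simp x y -> exists l, hd f (pt x y) l.

Let segpt_pt x1 y1 x2 y2 (s : R) :
  segpt (pt x1 y1) (pt x2 y2) s = pt (x1 + s * (x2 - x1)) (y1 + s * (y2 - y1)).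
Proof. by rewrite /segpt /pt !rmorphD !rmorphM !rmorphB; ring. Qed.

Let simp_seg x1 y1 x2 y2 (s : R) : simp x1 y1 -> simp x2 y2 -> s \in `[0, 1] ->
  simp (x1 + s * (x2 - x1)) (y1 + s * (y2 - y1)).
Proof.
move=> [a1 a2 a3] [b1 b2 b3]; rewrite in_itv /= => /andP[s0 s1].
have t0 : 0 <= 1 - s by rewrite subr_ge0.
have := mulr_ge0 t0 a1; have := mulr_ge0 t0 a2; have := mulr_ge0 s0 b1.
have := mulr_ge0 s0 b2; have a3' : 0 <= 1 - (x1 + y1) by rewrite subr_ge0.
have b3' : 0 <= 1 - (x2 + y2) by rewrite subr_ge0.
have := mulr_ge0 t0 a3'; have := mulr_ge0 s0 b3'.
by split; lra.
Qed.

Let cs x1 y1 x2 y2 : simp x1 y1 -> simp x2 y2 -> contseg f (pt x1 y1) (pt x2 y2).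
Proof.
by move=> h1 h2; apply: contseg_hd => s s01; rewrite segpt_pt; apply: fd; exact: simp_seg.
Qed.

Let J x1 y1 x2 y2 := segint f (pt x1 y1) (pt x2 y2).

Let Jmid x1 y1 x2 y2 mx my : simp x1 y1 -> simp x2 y2 -> mx + mx = x1 + x2 ->
  my + my = y1 + y2 -> J x1 y1 x2 y2 = J x1 y1 mx my + J mx my x2 y2.
Proof.
move=> h1 h2 ex ey; rewrite /J segint_mid; last exact: cs.
have -> : (pt x1 y1 + pt x2 y2) / 2 = pt mx my; last by [].
have -> : mx = (x1 + x2) / 2 by rewrite -ex; field.
have -> : my = (y1 + y2) / 2 by rewrite -ey; field.
by rewrite /pt !rmorphM !rmorphD fmorphV rmorph_nat; field; rewrite ?pnatr_eq0.
Qed.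

Let Jrev x1 y1 x2 y2 : simp x1 y1 -> simp x2 y2 -> J x2 y2 x1 y1 = - J x1 y1 x2 y2.
Proof. by move=> h1 h2; rewrite /J segint_rev //; exact: cs. Qed.

(** [(x, y, s)] stands for the triangle with corner [(x, y)] and both legs equal to [s] in affine
    coordinates. Allowing negative [s] gives the inverted middle piece the same form as the other
    three. *)
Let inside (t : R * R * R) := let: (x, y, s) := t in
  [/\ simp x y, simp (x + s) y & simp x (y + s)].
Let tt (t : R * R * R) := let: (x, y, s) := t in
  J x y (x + s) y + J (x + s) y x (y + s) + J x (y + s) x y.

(** Of the four pieces of half size, one carries at least a quarter of the integral. The hypothesis
    sits under the existential so that [choice] yields a total function to iterate. *)
Let step t : exists t', inside t ->
  [/\ inside t', `|t'.1.1 - t.1.1| <= `|t.2| / 2, `|t'.1.2 - t.1.2| <= `|t.2| / 2,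
      `|t'.2| = `|t.2| / 2 & normc (tt t) <= 4 * normc (tt t')].
Proof.
have [ins|ni] := pselect (inside t); last by exists t => /ni.
case: t ins => -[x y] s [] [i1 i2 i3] [i4 i5 i6] [i7 i8 i9].
pose h := s / 2; have sE : s = h + h by rewrite /h; field.
have xs : x + h + h = x + s by rewrite sE; ring.
have ys : y + h + h = y + s by rewrite sE; ring.
have h2 : `|h| = `|s| / 2 by rewrite normrM (ger0_norm (_ : 0 <= 2^-1)).
have s00 : simp x y by split.
have s10 : simp (x + s) y by split.
have s01 : simp x (y + s) by split.
have m10 : simp (x + h) y by split; lra.
have m01 : simp x (y + h) by split; lra.
have m11 : simp (x + h) (y + h) by split; lra.
have E : tt (x, y, s) = tt (x, y, h) + tt (x + h, y, h) + tt (x, y + h, h)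
    + tt (x + h, y + h, - h).
  rewrite /tt xs ys !addrK.
  rewrite (Jmid (mx := x + h) (my := y) s00 s10); [|lra|lra].
  rewrite (Jmid (mx := x + h) (my := y + h) s10 s01); [|lra|lra].
  rewrite (Jmid (mx := x) (my := y + h) s01 s00); [|lra|lra].
  rewrite (Jrev m10 m01) (Jrev m10 m11) (Jrev m01 m11); ring.
have n2 : 0 <= 2^-1 :> R by [].
have h0 : `|0 : R| <= `|s| / 2 by rewrite normr0 mulr_ge0.
have hh : `|h| <= `|s| / 2 by rewrite h2.
have a1 : `|x + h - x| <= `|s| / 2 by rewrite (_ : x + h - x = h) //; ring.
have a2 : `|y + h - y| <= `|s| / 2 by rewrite (_ : y + h - y = h) //; ring.
have z1 : `|x - x| <= `|s| / 2 by rewrite subrr.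
have z2 : `|y - y| <= `|s| / 2 by rewrite subrr.
have [b1|n1] := leP (normc (tt (x, y, s))) (4 * normc (tt (x, y, h))).
  by exists (x, y, h) => _; split; [split|exact: z1|exact: z2|exact: h2|exact: b1].
have [b2|n2'] := leP (normc (tt (x, y, s))) (4 * normc (tt (x + h, y, h))).
  exists (x + h, y, h) => _; split; [|exact: a1|exact: z2|exact: h2|exact: b2].
  by rewrite /inside xs; split.
have [b3|n3] := leP (normc (tt (x, y, s))) (4 * normc (tt (x, y + h, h))).
  exists (x, y + h, h) => _; split; [|exact: z1|exact: a2|exact: h2|exact: b3].
  by rewrite /inside ys; split.
exists (x + h, y + h, - h) => _.
split; [|exact: a1|exact: a2|by rewrite normrN; exact: h2|].
  by rewrite /inside !addrK; split.
have Q (a b c d : C) : normc (a + b + c + d) <= normc a + normc b + normc c + normc d.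
  have := le_normcD (a + b + c) d; have := le_normcD (a + b) c; have := le_normcD a b.
  lra.
rewrite E; rewrite E in n1 n2' n3.
have := Q (tt (x, y, h)) (tt (x + h, y, h)) (tt (x, y + h, h)) (tt (x + h, y + h, - h)).
lra.
Qed.

Lemma goursat_triangle : triint f P (P + u) (P + v) = 0.
Proof.
have [F FP] := choice step.
pose t n := iter n F (0, 0, 1).
have s0 : simp 0 0 by split; lra.
have s1 : simp 1 0 by split; lra.
have s2 : simp 0 1 by split; lra.
have tin n : inside (t n).
  elim: n => [|n IH]; first by rewrite /= !add0r; split.
  by have [] := FP _ IH.
have ts n : `|(t n).2| = 1 / 2 ^+ n.
  elim: n => [|n IH]; first by rewrite /= normr1 expr0 divr1.
  by have [_ _ _ + _] := FP _ (tin n); rewrite -/(t n.+1) => ->; rewrite IH exprS; field; rewrite expf_neq0 ?pnatr_eq0.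
have tn n : normc (tt (t 0%N)) <= 4 ^+ n * normc (tt (t n)).
  elim: n => [|n IH]; first by rewrite expr0 mul1r.
  have [_ _ _ _ H] := FP _ (tin n).
  apply: le_trans IH _; rewrite exprSr -mulrA ler_wpM2l ?exprn_ge0 //.
have [|X XP] := @geometric_cauchy R (fun n => (t n).1.1) 2^-1.
  by move=> n; have [_ H _ _ _] := FP _ (tin n); apply: le_trans H _; rewrite ts mul1r mulrC.
have [|Y YP] := @geometric_cauchy R (fun n => (t n).1.2) 2^-1.
  by move=> n; have [_ _ H _ _] := FP _ (tin n); apply: le_trans H _; rewrite ts mul1r mulrC.
have {}XP n : `|(t n).1.1 - X| <= 1 / 2 ^+ n.
  by have := XP n; rewrite divff ?pnatr_eq0.
have {}YP n : `|(t n).1.2 - Y| <= 1 / 2 ^+ n.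
  by have := YP n; rewrite divff ?pnatr_eq0.
have tsimp n : simp (t n).1.1 (t n).1.2 by case: (t n) (tin n) => [[x y] s] [].
have XY : simp X Y.
  have p2 n : 0 < 1 / 2 ^+ n :> R by rewrite divr_gt0 ?exprn_gt0.
  split; rewrite -subr_le0; apply: (@geometric_le0 _ _ 2) => n.
  - have [i1 i2 i3] := tsimp n; have := XP n; rewrite ler_norml => /andP[? ?].
    by have := p2 n; lra.
  - have [i1 i2 i3] := tsimp n; have := YP n; rewrite ler_norml => /andP[? ?].
    by have := p2 n; lra.
  - have [i1 i2 i3] := tsimp n; have := YP n; rewrite ler_norml => /andP[? ?].
    have := XP n; rewrite ler_norml => /andP[? ?].
    by have := p2 n; lra.
have [l fl] := fd XY.
have T0E : tt (t 0%N) = triint f P (P + u) (P + v).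
  rewrite /tt /= /triint /J !add0r.
  have -> : pt 0 0 = P by rewrite /pt !rmorph0; ring.
  have -> : pt 1 0 = P + u by rewrite /pt rmorph1 rmorph0; ring.
  by have -> : pt 0 1 = P + v by rewrite /pt rmorph1 rmorph0; ring.
apply/eqP; rewrite -normc_eq0 -T0E; apply/eqP/le_anti; rewrite normc_ge0 andbT.
pose L := normc u + normc v.
have L0 : 0 <= L by rewrite addr_ge0 ?normc_ge0.
have main (e : R) : 0 < e -> normc (tt (t 0%N)) <= e * (4 * L ^+ 2).
  move=> e0; have [d d0 dH] := (hdP _ _ _).1 fl e e0.
  have [n nd] := geometric_small (2 * L) d0.
  apply: le_trans (tn n) _.
  pose q : R := 1 / 2 ^+ n.
  have q0 : 0 <= q by rewrite divr_ge0 ?exprn_ge0.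
  have q4 : 4 ^+ n * (q * q) = 1.
    rewrite /q (_ : 4 = 2 * 2 :> R); last by rewrite -natrM.
    by rewrite exprMn; field; rewrite expf_neq0 ?pnatr_eq0.
  have nd' : 2 * L * q < d by rewrite /q mulrA mulr1.
  case E : (t n) (tin n) (XP n) (YP n) (ts n) => [[x y] s] [] /= i1 i2 i3 xX yY sq.
  rewrite -/q in xX yY sq.
  pose p := pt X Y.
  (* The affine approximation [g] at the limit point has the primitive [G], hence contributes
     nothing around the triangle. What remains is at most [e] times distance times perimeter, of
     order [4 ^- n], which balances the factor [4 ^+ n] lost in the subdivision. *)
  pose g w := f p + l * (w - p).
  pose G w := f p * w + l * (w - p) ^+ 2 / 2.
  have Gd w : hd G w (g w).
    have D1 := dvZ (@id_continuous R) (f p) (dv_emb id w).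
    have D2 := dvB (dv_emb id w) (dv_cst id p w).
    have D3 := dvM (@id_continuous R) (dvM (@id_continuous R) (dv_cst id l w)
      (dvM (@id_continuous R) D2 D2)) (dv_cst id 2^-1 w).
    apply: dv_eq (dvD D1 D3); rewrite /g; field; rewrite ?pnatr_eq0 //.
  have gc w : {for w, continuous g}.
    have D := dvD (dv_cst id (f p) w) (dvZ (@id_continuous R) l
      (dvB (dv_emb id w) (dv_cst id p w))).
    exact: hd_continuous D.
  have dist x' y' : `|x' - x| <= q -> `|y' - y| <= q -> normc (pt x' y' - p) <= 2 * L * q.
    move=> hx hy.
    have -> : pt x' y' - p = (x' - X)%:C * u + (y' - Y)%:C * v.
      by rewrite /p /pt !rmorphB; ring.
    apply: le_trans (le_normcD _ _) _; rewrite !normcM !normc_real.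
    have hx' : `|x' - X| <= 2 * q.
      by rewrite (_ : x' - X = (x' - x) + (x - X)); [apply: le_trans (ler_normD _ _) _; lra|ring].
    have hy' : `|y' - Y| <= 2 * q.
      by rewrite (_ : y' - Y = (y' - y) + (y - Y)); [apply: le_trans (ler_normD _ _) _; lra|ring].
    apply: le_trans (lerD (ler_wpM2r (normc_ge0 u) hx') (ler_wpM2r (normc_ge0 v) hy')) _.
    by rewrite le_eqVlt; apply/orP; left; apply/eqP; rewrite /L; ring.
  have edge x1 y1 x2 y2 : simp x1 y1 -> simp x2 y2 ->
      `|x1 - x| <= q -> `|y1 - y| <= q -> `|x2 - x| <= q -> `|y2 - y| <= q ->
      normc (J x1 y1 x2 y2 - segint g (pt x1 y1) (pt x2 y2)) <=
      e * (2 * L * q) * normc (pt x2 y2 - pt x1 y1).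
    move=> k1 k2 a1 a2 a3 a4; apply: segint_dist; first exact: cs.
      by move=> r _; exact: gc.
    move=> r r01; rewrite segpt_pt.
    move: r01; rewrite in_itv /= => /andP[r0 r1].
    have cvx a b c : `|a - c| <= q -> `|b - c| <= q -> `|a + r * (b - a) - c| <= q.
      rewrite !ler_norml => /andP[? ?] /andP[? ?].
      by apply/andP; split; nra.
    have dd := dist _ _ (cvx _ _ _ a1 a3) (cvx _ _ _ a2 a4).
    rewrite /g opprD addrA; apply: le_trans (dH _ (le_lt_trans dd nd')) _.
    by rewrite ler_wpM2l // ltW.
  have z0 : `|x - x| <= q by rewrite subrr normr0.
  have z0' : `|y - y| <= q by rewrite subrr normr0.
  have zs : `|x + s - x| <= q by rewrite [x + s]addrC addrK sq.
  have zs' : `|y + s - y| <= q by rewrite [y + s]addrC addrK sq.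
  have e1 := edge _ _ _ _ i1 i2 z0 z0' zs z0'.
  have e2 := edge _ _ _ _ i2 i3 zs z0' z0 zs'.
  have e3 := edge _ _ _ _ i3 i1 z0 zs' z0 z0'.
  have n1 : normc (pt (x + s) y - pt x y) = q * normc u.
    have -> : pt (x + s) y - pt x y = s%:C * u by rewrite /pt rmorphD; ring.
    by rewrite normcM normc_real sq.
  have n2 : normc (pt x (y + s) - pt (x + s) y) <= q * L.
    have -> : pt x (y + s) - pt (x + s) y = s%:C * (v - u) by rewrite /pt !rmorphD; ring.
    rewrite normcM normc_real sq; apply: ler_wpM2l => //.
    by rewrite /L [normc u + _]addrC; exact: le_normcB.
  have n3 : normc (pt x y - pt x (y + s)) = q * normc v.
    have -> : pt x y - pt x (y + s) = s%:C * - v by rewrite /pt !rmorphD; ring.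
    by rewrite normcM normc_real sq normcN.
  have ftc a b : segint g a b = G b - G a by apply: segint_ftc => r _; exact: Gd.
  have -> : J x y (x + s) y + J (x + s) y x (y + s) + J x (y + s) x y =
    (J x y (x + s) y - segint g (pt x y) (pt (x + s) y)) +
    (J (x + s) y x (y + s) - segint g (pt (x + s) y) (pt x (y + s))) +
    (J x (y + s) x y - segint g (pt x (y + s)) (pt x y)) by rewrite !ftc; ring.
  have B := le_trans (le_normcD _ _) (lerD (le_trans (le_normcD _ _) (lerD e1 e2)) e3).
  rewrite n1 n3 in B.
  have c0 : 0 <= e * (2 * L * q) by rewrite !mulr_ge0 // ltW.
  have B2 := le_trans B (lerD (lerD (lexx _) (ler_wpM2l c0 n2)) (lexx _)).
  have p4 : 0 <= 4 ^+ n :> R by rewrite exprn_ge0.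
  apply: le_trans (ler_wpM2l p4 B2) _.
  have aux (N k a b : R) : N * (e * (2 * (a + b) * k) * (k * a) +
      e * (2 * (a + b) * k) * (k * (a + b)) + e * (2 * (a + b) * k) * (k * b)) =
      e * (4 * (a + b) ^+ 2) * (N * (k * k)) by ring.
  by rewrite /L aux q4 mulr1.
apply/ler_addgt0Pr => e e0; rewrite add0r.
have k0 : 0 < 4 * L ^+ 2 + 1 by rewrite ltr_pwDr // mulr_ge0 // exprn_ge0.
apply: le_trans (main (e / (4 * L ^+ 2 + 1)) (divr_gt0 e0 k0)) _.
by rewrite mulrAC ler_pdivrMr // ler_pM2l // lerDl.
Qed.

End Goursat.

(** * Primitives on convex sets, with one exceptional point *)

Section ConvexPrimitive.
Variable R : realType.
Local Notation C := R[i].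

Lemma onem_complex (s : R) : (1 - s)%:C = 1 - s%:C :> C.
Proof. by rewrite rmorphB rmorph1. Qed.

Lemma Re_segpt (a b : C) s : Re (segpt a b s) = (1 - s) * Re a + s * Re b.
Proof. by rewrite /segpt cReD cReM cReD cReN /=; ring. Qed.

Lemma Im_segpt (a b : C) s : Im (segpt a b s) = (1 - s) * Im a + s * Im b.
Proof. by rewrite /segpt cImD cImM cImD cImN /=; ring. Qed.

Lemma segptM (a b c : C) s : segpt a b s * c = segpt (a * c) (b * c) s.
Proof. by rewrite /segpt; ring. Qed.

Lemma normc_segpt (a b : C) s : s \in `[0, 1] -> normc (segpt a b s) <= normc a + normc b.
Proof.
rewrite in_itv /= => /andP[s0 s1].
have -> : segpt a b s = (1 - s)%:C * a + s%:C * b by rewrite /segpt onem_complex; ring.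
apply: le_trans (le_normcD _ _) _; rewrite !normcM !normc_real.
rewrite (ger0_norm s0) ger0_norm ?subr_ge0 //; apply: lerD; rewrite ler_piMl ?normc_ge0 //.
by rewrite gerBl.
Qed.

Lemma lt_convex (l u v s : R) : s \in `[0, 1] -> l < u -> l < v -> l < (1 - s) * u + s * v.
Proof.
rewrite in_itv /= => /andP[s0 s1] lu lv.
have [->|sn] := eqVneq s 1; first by rewrite subrr mul0r add0r mul1r.
have sp : 0 < 1 - s by rewrite subr_gt0 lt_def eq_sym sn s1.
by have := ler_wpM2l s0 (ltW lv); rewrite -(ltr_pM2l sp) in lu; lra.
Qed.

Definition convexc (W : set C) := forall a b (s : R), W a -> W b -> s \in `[0, 1] ->
  W (segpt a b s).

Lemma convexc_triangle (W : set C) a b c (x y : R) : convexc W -> W a -> W b -> W c ->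
  0 <= x -> 0 <= y -> x + y <= 1 -> W (a + x%:C * (b - a) + y%:C * (c - a)).
Proof.
move=> Wc Wa Wb Wc' x0 y0 xy.
have [e|e] := eqVneq (x + y) 0.
  have -> : x = 0 by lra.
  have -> : y = 0 by lra.
  by rewrite rmorph0 !mul0r !addr0.
have sp : 0 < x + y by rewrite lt_def e addr_ge0.
have h1 : y / (x + y) \in `[0, 1].
  rewrite in_itv /=; apply/andP; split; first by rewrite divr_ge0 // ltW.
  by rewrite ler_pdivrMr // mul1r lerDr.
have h2 : x + y \in `[0, 1] by rewrite in_itv /= xy ltW.
have := Wc _ _ _ Wa (Wc _ _ _ Wb Wc' h1) h2.
congr W; rewrite /segpt rmorphD rmorphM fmorphV rmorphD.
have e' : x%:C + y%:C != 0 by rewrite -rmorphD; apply: contra e => /eqP [->].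
by field.
Qed.

Variables (W : set C) (f : C -> C) (p : C).
Hypotheses (Wo : open W) (Wc : convexc W) (Wp : W p).
Hypothesis fp : {for p, continuous f}.
Hypothesis fd : forall z, W z -> z != p -> exists l, hd f z l.

Let fc z : W z -> {for z, continuous f}.
Proof.
move=> Wz; have [->|zp] := eqVneq z p; first exact: fp.
by have [l fl] := fd Wz zp; exact: hd_continuous fl.
Qed.

Let fcs a b : W a -> W b -> contseg f a b.
Proof. by move=> Wa Wb s s01; apply: fc; exact: Wc. Qed.

(** The two triangles differ by a quadrilateral cut into two triangles inside [W'], the part of [W]
    in an open half-plane that has [p] on its boundary line. [W'] is convex and avoids [p], so
    Goursat's theorem applies; closeness of [c] to [b] is what puts [c] in the half-plane. *)
Let half_aux (b c : C) (r : R) : 0 < r -> r <= 1 -> W b -> W c -> b != p ->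
  normc (c - b) <= normc (b - p) / 4 ->
  triint f p (segpt p b r) (segpt p c r) = triint f p (segpt p b (r / 2)) (segpt p c (r / 2)).
Proof.
move=> r0 r1 Wb Wc' bp cb.
pose W' := [set z | W z /\ 0 < Re ((z - p) * (b - p)^*%C)].
have Re_real (k : R) z : Re (k%:C * z) = k * Re z by rewrite cReM /= mul0r subr0.
have W'c : convexc W'.
  move=> u v s [Wu hu] [Wv hv] s01; split; first exact: Wc.
  have -> : (segpt u v s - p) * (b - p)^*%C =
     (1 - s)%:C * ((u - p) * (b - p)^*%C) + s%:C * ((v - p) * (b - p)^*%C).
    by rewrite /segpt onem_complex; ring.
  rewrite cReD !Re_real; move: s01; rewrite in_itv /= => /andP[s0 s1].
  have [->|sn] := eqVneq s 0; first by rewrite subr0 mul1r mul0r addr0.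
  have sp : 0 < s by rewrite lt_def sn s0.
  by rewrite ltr_wpDl ?mulr_gt0 // mulr_ge0 ?subr_ge0 // ltW.
have bb : Re ((b - p) * (b - p)^*%C) = normc (b - p) ^+ 2 by rewrite conj_mul_normc.
have nbp : 0 < normc (b - p) by rewrite normc_gt0 subr_eq0.
have b0 : 0 < Re ((b - p) * (b - p)^*%C) by rewrite bb exprn_gt0.
have c0 : 0 < Re ((c - p) * (b - p)^*%C).
  have -> : (c - p) * (b - p)^*%C = (b - p) * (b - p)^*%C + (c - b) * (b - p)^*%C by ring.
  rewrite cReD bb.
  have h1 := normc_Re ((c - b) * (b - p)^*%C).
  rewrite normcM in h1.
  have nJ : normc ((b - p)^*%C) = normc (b - p).
    by case: (b - p) => x y /=; rewrite sqrrN.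
  rewrite nJ in h1.
  have h2 := ler_wpM2r (ltW nbp) cb.
  move: h1; rewrite ler_norml => /andP[h1 _].
  have : 0 < normc (b - p) * normc (b - p) by rewrite mulr_gt0.
  rewrite expr2; lra.
have inW' z (k : R) : W z -> 0 < Re ((z - p) * (b - p)^*%C) -> 0 < k -> k <= 1 ->
    W' (segpt p z k).
  move=> Wz z0 k0 k1; split.
    by apply: Wc => //; rewrite in_itv /= ltW.
  have -> : (segpt p z k - p) * (b - p)^*%C = k%:C * ((z - p) * (b - p)^*%C).
    by rewrite /segpt; ring.
  by rewrite Re_real mulr_gt0.
have r2 : 0 < r / 2 by rewrite divr_gt0.
have r21 : r / 2 <= 1 by rewrite ler_pdivrMr // mul1r; lra.
set B := segpt p b r; set B2 := segpt p b (r / 2).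
set D := segpt p c r; set D2 := segpt p c (r / 2).
have WB : W' B by exact: inW'.
have WB2 : W' B2 by exact: inW'.
have WD : W' D by exact: inW'.
have WD2 : W' D2 by exact: inW'.
have gt a1 a2 a3 : W' a1 -> W' a2 -> W' a3 -> triint f a1 a2 a3 = 0.
  move=> h1 h2 h3.
  have := @goursat_triangle R f a1 (a2 - a1) (a3 - a1).
  rewrite ![a1 + _]addrC !subrK; apply => x y [x0 y0 xy].
  have [Wz z0] := convexc_triangle W'c h1 h2 h3 x0 y0 xy.
  apply: fd => //; apply/negP => /eqP zp.
  by move: z0; rewrite zp subrr mul0r ltxx.
have WW z : W' z -> W z by case.
have t1 := gt _ _ _ WB2 WB WD; have t2 := gt _ _ _ WB2 WD WD2.
rewrite /triint in t1 t2; rewrite /triint.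
rewrite (segint_mid (fcs Wp (WW _ WB))) (segint_mid (fcs (WW _ WD) Wp)).
have -> : (p + B) / 2 = B2.
  by rewrite /B /B2 /segpt rmorphM fmorphV rmorph_nat; field; rewrite ?pnatr_eq0 //.
have -> : (D + p) / 2 = D2.
  by rewrite /D /D2 /segpt rmorphM fmorphV rmorph_nat; field; rewrite ?pnatr_eq0 //.
have q1 := segint_rev (fcs (WW _ WB2) (WW _ WD)).
have q2 := segint_rev (fcs (WW _ WB2) (WW _ WD2)).
rewrite q1 in t1; rewrite q2 in t2.
move/eqP: t1; rewrite subr_eq0 => /eqP t1; move/eqP: t2; rewrite subr_eq0 => /eqP t2.
have -> : segint f p B2 + segint f B2 B + segint f B D + (segint f D D2 + segint f D2 p) =
  segint f p B2 + (segint f B2 B + segint f B D + segint f D D2) + segint f D2 p by ring.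
by rewrite t1 t2.
Qed.

(** Halving repeatedly shrinks the triangle to [p] without changing the integral, and [f] is bounded
    near [p] by continuity, so the integral is arbitrarily small. *)
Let tri_vertex b c : W b -> W c -> b != p -> normc (c - b) <= normc (b - p) / 4 ->
  triint f p b c = 0.
Proof.
move=> Wb Wc' bp cb.
have T n : triint f p b c = triint f p (segpt p b (1 / 2 ^+ n)) (segpt p c (1 / 2 ^+ n)).
  elim: n => [|n IH].
    by rewrite expr0 divr1 /segpt rmorph1 !mul1r ![p + _]addrC !subrK.
  have r0 : 0 < 1 / 2 ^+ n :> R by rewrite divr_gt0 ?exprn_gt0.
  have r1 : 1 / 2 ^+ n <= 1 :> R.
    by rewrite ler_pdivrMr ?exprn_gt0 // mul1r exprn_ege1 // ler1n.
  rewrite IH (half_aux r0 r1 Wb Wc' bp cb).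
  have -> : 1 / 2 ^+ n / 2 = 1 / 2 ^+ n.+1 :> R by rewrite exprSr; field; rewrite expf_neq0 ?pnatr_eq0.
  by [].
pose L := normc (b - p) + normc (c - p).
have L0 : 0 <= L by rewrite addr_ge0 ?normc_ge0.
have [d d0 dH] := (continuous_normcP f p).1 fp 1 ltr01.
have [N Nd] := geometric_small L d0.
pose M := normc (f p) + 1.
have M0 : 0 <= M by rewrite addr_ge0 ?normc_ge0.
apply/eqP; rewrite -normc_eq0; apply/eqP/le_anti; rewrite normc_ge0 andbT.
apply: (@geometric_le0 _ _ (M * (2 * L))) => n.
rewrite (T (N + n)%N); set r : R := 1 / 2 ^+ (N + n).
have r0 : 0 <= r by rewrite divr_ge0 ?exprn_ge0.
have rN : r <= 1 / 2 ^+ N.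
  rewrite /r !div1r lef_pV2 ?posrE ?exprn_gt0 // ler_weXn2l ?leq_addr // ler1n //.
have rn : r <= 1 / 2 ^+ n.
  rewrite /r !div1r lef_pV2 ?posrE ?exprn_gt0 // ler_weXn2l ?leq_addl // ler1n //.
have r1 : r \in `[0, 1].
  rewrite in_itv /= r0 (le_trans rn) // ler_pdivrMr ?exprn_gt0 // mul1r exprn_ege1 // ler1n //.
have rL : r * L < d.
  apply: le_lt_trans Nd; rewrite mulrC; apply: le_trans (ler_wpM2l L0 rN) _.
  by rewrite mulrA mulr1.
have bd z : normc (z - p) <= r * L -> normc (f z) <= M.
  move=> zr; have := dH z (le_lt_trans zr rL).
  have -> : f z = (f z - f p) + f p by ring.
  have := le_normcD (f z - f p) (f p); rewrite subrK /M; lra.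
have nb : normc (b - p) <= L by rewrite lerDl normc_ge0.
have nc : normc (c - p) <= L by rewrite lerDr normc_ge0.
have edge u v : normc (u - p) <= L -> normc (v - p) <= L -> W u -> W v ->
    normc (segint f (segpt p u r) (segpt p v r)) <= M * (r * normc (v - u)).
  move=> uL vL Wu Wv.
  have -> : r * normc (v - u) = normc (segpt p v r - segpt p u r).
    have -> : segpt p v r - segpt p u r = r%:C * (v - u) by rewrite /segpt; ring.
    by rewrite normcM normc_real ger0_norm.
  apply: segint_le; first by apply: fcs; exact: Wc.
  move=> s; rewrite in_itv /= => /andP[s0 s1]; apply: bd.
  have -> : segpt (segpt p u r) (segpt p v r) s - p =
    r%:C * ((1 - s)%:C * (u - p) + s%:C * (v - p)).
    by rewrite /segpt onem_complex; ring.
  rewrite normcM normc_real ger0_norm // ler_wpM2l //.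
  apply: le_trans (le_normcD _ _) _; rewrite !normcM !normc_real !ger0_norm ?subr_ge0 //.
  have s1' : 0 <= 1 - s by rewrite subr_ge0.
  have := ler_wpM2l s1' uL; have := ler_wpM2l s0 vL; lra.
have pE : p = segpt p p r by rewrite /segpt subrr mulr0 addr0.
have pp : normc (p - p) <= L by rewrite subrr normc0.
have := edge _ _ pp nb Wp Wb; have := edge _ _ nb nc Wb Wc'; have := edge _ _ nc pp Wc' Wp.
rewrite -pE /triint => e3 e2 e1.
have B := le_trans (le_normcD _ _) (lerD (le_trans (le_normcD _ _) (lerD e1 e2)) e3).
apply: le_trans B _.
have nbc : normc (c - b) <= L.
  have -> : c - b = (c - p) - (b - p) by ring.
  by rewrite /L [normc (b - p) + _]addrC; exact: le_normcB.
have nrev : normc (p - c) = normc (c - p) by rewrite normcB.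
rewrite nrev.
have S : normc (b - p) + normc (c - b) + normc (c - p) <= 2 * L by rewrite /L in nbc *; lra.
have -> : M * (r * normc (b - p)) + M * (r * normc (c - b)) + M * (r * normc (c - p)) =
  M * (r * (normc (b - p) + normc (c - b) + normc (c - p))) by ring.
have -> : M * (2 * L) / 2 ^+ n = M * ((2 * L) * (1 / 2 ^+ n)) by rewrite div1r; ring.
apply: ler_wpM2l => //; apply: le_trans (ler_wpM2l r0 S) _.
by rewrite mulrC; apply: ler_wpM2l => //; rewrite mulr_ge0.
Qed.

(** Integrating from the exceptional point itself ensures that every triangle needed has [p] as a
    vertex. Tolerating [p] is what allows difference quotients with a removable singularity, as
    Cauchy's formula requires. *)
Lemma convex_primitive : exists F : C -> C, forall z, W z -> hd F z (f z).
Proof.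
exists (fun z => segint f p z) => z Wz; apply/hdP => e e0.
have [d1 d10 d1W] := (nbhs_normcP z W).1 (open_nbhs_nbhs (conj Wo Wz)).
have [d2 d20 d2H] := (continuous_normcP f z).1 (fc Wz) e e0.
have loc w : normc (w - z) < d1 -> normc (w - z) < d2 ->
    normc (segint f z w - f z * (w - z)) <= e * normc (w - z).
  move=> w1 w2.
  have cE : segint (fun=> f z) z w = f z * (w - z).
    rewrite (@segint_ftc _ _ (fun w => f z * w)); first by ring.
    move=> s _; have := dvZ (@id_continuous R) (f z) (dv_emb id (segpt z w s)).
    by apply: dv_eq; rewrite mulr1.
  rewrite -cE; apply: segint_dist.
  - by apply: fcs => //; exact: d1W.
  - by move=> s _; exact: cont_cst.
  - move=> s; rewrite in_itv /= => /andP[s0 s1]; apply/ltW/d2H.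
    have -> : segpt z w s - z = s%:C * (w - z) by rewrite /segpt; ring.
    rewrite normcM normc_real ger0_norm //; apply: le_lt_trans w2.
    by rewrite ler_piMl ?normc_ge0.
have [zp|zp] := eqVneq z p.
  have pp0 : segint f p p = 0.
    apply/eqP; rewrite -normc_eq0; apply/eqP/le_anti; rewrite normc_ge0 andbT.
    have := @segint_le R f p p (normc (f p)) (fcs Wp Wp).
    rewrite subrr normc0 mulr0; apply => s _.
    by rewrite /segpt subrr mulr0 addr0.
  exists (Num.min d1 d2) => [|w]; rewrite lt_min ?d10 // => /andP[w1 w2].
  by have := loc w w1 w2; rewrite zp pp0 subr0.
have d3 : 0 < normc (z - p) / 4 by rewrite divr_gt0 // normc_gt0 subr_eq0.
exists (Num.min (Num.min d1 d2) (normc (z - p) / 4)) => [|w].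
  by rewrite !lt_min d10 d20 d3.
rewrite !lt_min => /andP[/andP[w1 w2] w3].
have Ww := d1W _ w1.
have := tri_vertex Wz Ww zp (ltW w3); rewrite /triint (segint_rev (fcs Wp Ww)).
move/eqP; rewrite subr_eq0 => /eqP <-.
by rewrite [segint f p z + _]addrC addrK; exact: loc.
Qed.

End ConvexPrimitive.

Section CurveIntegral.
Variable R : realType.
Local Notation C := R[i].
Implicit Types (g h : R -> C).

(** The curve parameter is recovered by [Re], so integrals over the unit interval are a case of
    [segint]. *)
Definition cint g : C := segint (fun z => g (Re z)) 0 1.

Lemma cintE g (G : R -> C) : (forall s, s \in `[0, 1] -> rd G s (g s)) ->
  cint g = G 1 - G 0.
Proof.
move=> Gd; apply: segintE; exists G; split => // s s01.
have -> : segpt 0 1 s = s%:C :> C by rewrite /segpt subr0 mulr1 add0r.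
by rewrite subr0 mulr1; exact: Gd.
Qed.

Lemma cintP g : continuous g ->
  exists G : R -> C, (forall s, s \in `[0, 1] -> rd G s (g s)) /\ cint g = G 1 - G 0.
Proof.
by move=> /antiderivative [G Gd]; exists G; split; [exact: Gd|exact: cintE].
Qed.

Lemma cint_le g (M : R) : continuous g ->
  (forall s, s \in `[0, 1] -> normc (g s) <= M) -> normc (cint g) <= M.
Proof.
move=> /cintP [G [Gd ->]] gM.
by have := @rd_lipschitz R G g M 0 1 ler01 Gd gM; rewrite subr0 mulr1.
Qed.

Lemma cintB g h : continuous g -> continuous h ->
  cint (fun s => g s - h s) = cint g - cint h.
Proof.
move=> /cintP [G [Gd ->]] /cintP [H [Hd ->]].
rewrite (@cintE _ (fun s => G s - H s)); first by ring.
by move=> s s01; exact: dvB (Gd s s01) (Hd s s01).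
Qed.

Lemma cintZ (a : C) g : continuous g -> cint (fun s => a * g s) = a * cint g.
Proof.
move=> /cintP [G [Gd ->]].
rewrite (@cintE _ (fun s => a * G s)); first by ring.
move=> s s01; exact: (dvZ (@real_complex_continuous R) a (Gd s s01)).
Qed.

Lemma continuous_bounded_normc g : continuous g ->
  exists2 M : R, 0 < M & forall s, s \in `[0, 1] -> normc (g s) <= M.
Proof.
move=> gc.
have nc : {within `[0, 1], continuous (fun s => normc (g s))}.
  apply: continuous_subspaceT => s.
  by apply: (@cont_comp R C R (@normc R) g s); [exact: continuous_normc|exact: gc].
have [s0 s01 smax] := EVT_max (@ler01 R) nc.
exists (normc (g s0) + 1); first by rewrite ltr_wpDl ?normc_ge0.
by move=> s s01'; apply: le_trans (smax s s01') _; rewrite lerDl.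
Qed.

End CurveIntegral.

(** * Differentiation of Cauchy-type integrals *)

Section CauchyKernel.
Variable R : realType.
Local Notation C := R[i].
Variables (k gam : R -> C).
Hypotheses (kc : continuous k) (gc : continuous gam).

Let kern (n : nat) (w : C) (s : R) : C := k s / (gam s - w) ^+ n.

Lemma continuous_kernel n w : (forall s, gam s != w) -> continuous (kern n w).
Proof.
move=> gw s; apply: (@contM R R k (fun s => ((gam s - w) ^+ n)^-1) s); first exact: kc.
apply: contV; first by rewrite expf_neq0 // subr_eq0.
apply: (@cont_comp R C C (fun z => z ^+ n) (fun s => gam s - w)).
  exact: hd_continuous (hdX n _).
by apply: contB; [exact: gc|exact: cont_cst].
Qed.

(** Differentiation under the integral sign, reduced to one algebraic estimate: a quadratic Taylor
    remainder for the map from [h] to [(a - h) ^- n], uniform over [normc a >= d]. *)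
Let kernel_hd n (p : C) (d B : R) : 0 < d -> 0 <= B ->
  (forall s, d <= normc (gam s - p)) ->
  (forall a h : C, d <= normc a -> normc h < d / 2 ->
     normc ((a - h) ^- n - a ^- n - n%:R * h / a ^+ n.+1) <= B * normc h ^+ 2) ->
  hd (fun w => cint (kern n w)) p (n%:R * cint (kern n.+1 p)).
Proof.
move=> d0 B0 gd H; apply/hdP => e e0.
have [M M0 kM] := continuous_bounded_normc kc.
have MB0 : 0 <= M * B by rewrite mulr_ge0 // ltW.
exists (Num.min (d / 2) (e / (M * B + 1))) => [|w].
  by rewrite lt_min !divr_gt0 // ltr_wpDl.
rewrite lt_min => /andP[wd we].
have gp s : gam s != p.
  apply/negP => /eqP E; have := gd s; rewrite E subrr normc0.
  by rewrite leNgt d0.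
have gw s : gam s != w.
  apply/negP => /eqP E; have := gd s; rewrite E leNgt (lt_trans wd) //.
  by rewrite ltr_pdivrMr // mulr_natr mulr2n ltrDl.
have c1 := @continuous_kernel n _ gw; have c2 := @continuous_kernel n _ gp.
have c3 := @continuous_kernel n.+1 _ gp.
have c4 : continuous (fun s => kern n w s - kern n p s).
  by move=> s; apply: (@contB R R (kern n w) (kern n p) s); [exact: c1|exact: c2].
have c5 : continuous (fun s => n%:R * (w - p) * kern n.+1 p s).
  move=> s; apply: (@contM R R (fun=> n%:R * (w - p)) (kern n.+1 p) s).
    exact: cont_cst.
  exact: c3.
have -> : cint (kern n w) - cint (kern n p) - n%:R * cint (kern n.+1 p) * (w - p) =
  cint (fun s => kern n w s - kern n p s - n%:R * (w - p) * kern n.+1 p s).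
  by rewrite (cintB c4 c5) (cintB c1 c2) (cintZ _ c3); ring.
have L : normc (cint (fun s => kern n w s - kern n p s - n%:R * (w - p) * kern n.+1 p s))
    <= M * (B * normc (w - p) ^+ 2).
  apply: cint_le.
    move=> s; apply: (@contB R R (fun s => kern n w s - kern n p s) _ s).
      exact: c4.
    exact: c5.
  move=> s s01.
  have -> : kern n w s - kern n p s - n%:R * (w - p) * kern n.+1 p s =
    k s * ((gam s - p - (w - p)) ^- n - (gam s - p) ^- n
       - n%:R * (w - p) / (gam s - p) ^+ n.+1).
    have -> : gam s - p - (w - p) = gam s - w by ring.
    by rewrite /kern; ring.
  rewrite normcM; apply: ler_pM; [exact: normc_ge0|exact: normc_ge0|exact: kM|].
  by apply: H; [exact: gd|exact: wd].
apply: le_trans L _; rewrite expr2 !mulrA ler_wpM2r ?normc_ge0 //.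
have h0 : 0 < M * B + 1 by rewrite ltr_wpDl.
move: we; rewrite ltr_pdivlMr // => we.
apply: le_trans (ltW we); rewrite mulrC; apply: ler_wpM2l; first exact: normc_ge0.
by rewrite lerDl.
Qed.

Let lower (a h : C) (d : R) : 0 < d -> d <= normc a -> normc h < d / 2 ->
  [/\ a != 0, a - h != 0 & d / 2 <= normc (a - h)].
Proof.
move=> d0 da hd.
have ah : d / 2 <= normc (a - h) by have := lerB_normc a h; lra.
by rewrite -normc_gt0 -(normc_gt0 (a - h)); split => //; [exact: lt_le_trans d0 da|lra].
Qed.

Lemma hd_kernel1 (p : C) (d : R) : 0 < d -> (forall s, d <= normc (gam s - p)) ->
  hd (fun w => cint (kern 1 w)) p (cint (kern 2 p)).
Proof.
move=> d0 gd.
have := @kernel_hd 1 p d (2 / d ^+ 3) d0; rewrite mul1r; apply => //.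
  by rewrite divr_ge0 // exprn_ge0 // ltW.
move=> a h da hd; have [a0 ah0 ah] := lower d0 da hd.
have -> : (a - h) ^- 1 - a ^- 1 - 1%:R * h / a ^+ 2 = h ^+ 2 * (a ^- 2 * (a - h)^-1).
  by field; rewrite a0 ah0.
rewrite normcM normcX mulrC; apply: ler_wpM2r; first by rewrite exprn_ge0 ?normc_ge0.
rewrite normcM !normcV normcX.
have -> : 2 / d ^+ 3 = (d ^+ 2)^-1 * (d / 2)^-1 by field; rewrite gt_eqF.
have d20 : 0 < d / 2 by rewrite divr_gt0.
have na : 0 < normc a by rewrite normc_gt0.
have nah : 0 < normc (a - h) by rewrite normc_gt0.
apply: ler_pM; rewrite ?invr_ge0 ?exprn_ge0 ?normc_ge0 //.
  by rewrite lef_pV2 ?posrE ?exprn_gt0 // lerXn2r ?nnegrE ?normc_ge0 // ltW.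
by rewrite lef_pV2 ?posrE.
Qed.

Lemma hd_kernel2 (p : C) (d : R) : 0 < d -> (forall s, d <= normc (gam s - p)) ->
  hd (fun w => cint (kern 2 w)) p (2 * cint (kern 3 p)).
Proof.
move=> d0 gd.
apply: (@kernel_hd 2 p d (16 / d ^+ 4) d0 _ gd).
  by rewrite divr_ge0 // exprn_ge0 // ltW.
move=> a h da hd; have [a0 ah0 ah] := lower d0 da hd.
have -> : (a - h) ^- 2 - a ^- 2 - 2%:R * h / a ^+ 3 =
    h ^+ 2 * ((3 * a - 2 * h) / a * (a ^- 2 * (a - h) ^- 2)).
  by field; rewrite a0 ah0.
rewrite normcM normcX mulrC; apply: ler_wpM2r; first by rewrite exprn_ge0 ?normc_ge0.
have d20 : 0 < d / 2 by rewrite divr_gt0.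
have na : 0 < normc a by rewrite normc_gt0.
have nah : 0 < normc (a - h) by rewrite normc_gt0.
rewrite !normcM !normcV !normcX.
(* The 4 bounds [(3 * a - 2 * h) / a], since [normc h <= normc a / 2]; the remaining 4 comes from
   [normc (a - h) >= d / 2], squared. *)
have -> : 16 / d ^+ 4 = 4 * ((d ^+ 2)^-1 * ((d / 2) ^+ 2)^-1) by field; rewrite gt_eqF.
apply: ler_pM; rewrite ?mulr_ge0 ?invr_ge0 ?exprn_ge0 ?normc_ge0 //.
  rewrite ler_pdivrMr //; apply: le_trans (le_normcB _ _) _.
  by rewrite !normcM !normc_nat; lra.
apply: ler_pM; rewrite ?invr_ge0 ?exprn_ge0 ?normc_ge0 //.
  by rewrite lef_pV2 ?posrE ?exprn_gt0 // lerXn2r ?nnegrE ?normc_ge0 // ltW.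
by rewrite lef_pV2 ?posrE ?exprn_gt0 // lerXn2r ?nnegrE ?normc_ge0 // ltW.
Qed.

End CauchyKernel.

(** * Cauchy's integral formula on a circle *)

Section CauchyFormula.
Variable R : realType.
Local Notation C := R[i].

Lemma normc_cis (x : R) : normc (cis x) = 1.
Proof. by rewrite /cis /= cos2Dsin2 sqrtr1. Qed.

Let tpi : C := 0 +i* (2 * pi).

Let tpi0 : tpi != 0.
Proof. by rewrite eq_complex /= negb_and orbC mulf_neq0 // gt_eqF // pi_gt0. Qed.

Lemma is_derive_linear (a x : R) : is_derive x 1 (fun y : R => a * y) a.
Proof.
apply/is_derive_caratheodory.
by exists (fun=> a); split; [exact: cvg_cst|by []|move=> y; ring].
Qed.

Lemma rd_cis (a x : R) : rd (fun s => cis (a * s)) x ((0 +i* a) * cis (a * x)).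
Proof.
have D1 := @is_derive1_comp R cos (fun y => a * y) x _ _ (is_derive_cos _) (is_derive_linear a x).
have D2 := @is_derive1_comp R sin (fun y => a * y) x _ _ (is_derive_sin _) (is_derive_linear a x).
apply: dv_eq (rd_pair D1 D2); apply: complex_ext.
  by rewrite cReM /=; ring.
by rewrite cImM /=; ring.
Qed.

Definition circle (c : C) (rho s : R) : C := c + rho%:C * cis (2 * pi * s).

Lemma rd_circle c rho s : rd (circle c rho) s (tpi * (circle c rho s - c)).
Proof.
have D := dvD (dv_cst (real_complex R) c s)
  (dvZ (@real_complex_continuous R) rho%:C (rd_cis (2 * pi) s)).
by apply: dv_eq D; rewrite /circle /tpi; ring.
Qed.

Lemma continuous_circle c rho : continuous (circle c rho).
Proof. by move=> s; exact: rd_continuous (rd_circle c rho s). Qed.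

Lemma circle_dist c rho s : 0 <= rho -> normc (circle c rho s - c) = rho.
Proof.
move=> r0; have -> : circle c rho s - c = rho%:C * cis (2 * pi * s) by rewrite /circle; ring.
by rewrite normcM normc_cis mulr1 normc_real ger0_norm.
Qed.

Lemma circle_closed c rho : circle c rho 1 = circle c rho 0.
Proof.
have e : 2 * pi * 1 = pi *+ 2 :> R by rewrite mulr2n; ring.
by rewrite /circle /cis e mulr0 cos0 sin0 cos2pi sin2pi.
Qed.

Lemma circle_far c rho s p : 0 <= rho -> rho - normc (p - c) <= normc (circle c rho s - p).
Proof.
move=> r0; rewrite -{1}(circle_dist c s r0).
have -> : circle c rho s - p = (circle c rho s - c) - (p - c) by ring.
exact: lerB_normc.
Qed.

Lemma convexc_ball (c : C) (r : R) : convexc [set z | normc (z - c) < r].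
Proof.
move=> a b s /= ar br; rewrite in_itv /= => /andP[s0 s1].
have -> : segpt a b s - c = (1 - s)%:C * (a - c) + s%:C * (b - c).
  by rewrite /segpt onem_complex; ring.
apply: le_lt_trans (le_normcD _ _) _; rewrite !normcM !normc_real !ger0_norm ?subr_ge0 //.
have [->|sn] := eqVneq s 1; first by rewrite subrr mul0r add0r mul1r.
have sp : 0 < 1 - s by rewrite subr_gt0 lt_def eq_sym sn s1.
have := ler_wpM2l s0 (ltW br); rewrite -(ltr_pM2l sp) in ar; lra.
Qed.

Lemma open_ballc (c : C) (r : R) : open [set z | normc (z - c) < r].
Proof.
rewrite openE => z /= zr; apply/nbhs_normcP.
exists (r - normc (z - c)); first by rewrite subr_gt0.
move=> w wz /=; have -> : w - c = (w - z) + (z - c) by ring.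
by apply: le_lt_trans (le_normcD _ _) _; rewrite -ltrBrDr.
Qed.

Variables (f : C -> C) (c : C) (r : R).
Hypothesis r0 : 0 < r.
Hypothesis fd : forall z, normc (z - c) < r -> exists l, hd f z l.

Let rho := r / 2.
Let rho0 : 0 < rho. Proof. by rewrite divr_gt0. Qed.
Let rhor : rho < r. Proof. by rewrite ltr_pdivrMr // mulr_natr mulr2n ltrDl. Qed.
Let gam := circle c rho.
Let gamr s : normc (gam s - c) < r.
Proof. by rewrite circle_dist // ltW. Qed.
Let gamc : continuous gam. Proof. exact: continuous_circle. Qed.
(** Since [gam' = tpi * (gam - c)], the factor [2 pi i] of the classical formula cancels, and the
    integral is a mean over the parameter. *)
Let k s : C := f (gam s) * (gam s - c).

Let kc : continuous k.
Proof.
move=> s; apply: (@contM R R (fun s => f (gam s)) (fun s => gam s - c) s).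
  apply: (@cont_comp R C C f gam s); last exact: gamc.
  by have [l fl] := fd (gamr s); exact: hd_continuous fl.
by apply: contB; [exact: gamc|exact: cont_cst].
Qed.

Let gamp p : normc (p - c) < rho -> forall s, rho - normc (p - c) <= normc (gam s - p).
Proof. by move=> _ s; apply: circle_far; exact: ltW. Qed.

Let gamNp p : normc (p - c) < rho -> forall s, gam s != p.
Proof.
move=> pr s; rewrite -subr_eq0 -normc_gt0; apply: lt_le_trans (gamp pr s).
by rewrite subr_gt0.
Qed.

Let wind (p : C) := cint (fun s => (gam s - c) / (gam s - p) ^+ 1).

Let gcc : continuous (fun s => gam s - c).
Proof.
move=> s; apply: (@contB R R gam (fun=> c) s); [exact: gamc|exact: cont_cst].
Qed.

(** The winding number is constant in [p]: its derivative integrates [(gam - c) / (gam - p) ^+ 2],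
    which has the primitive [- tpi^-1 / (gam - p)] on a closed curve. At the centre the integrand is
    1. *)
Let windE p : normc (p - c) < rho -> wind p = 1.
Proof.
move=> pr.
have W0 w : normc (w - c) < rho -> hd wind w 0.
  move=> wr; have dp : 0 < rho - normc (w - c) by rewrite subr_gt0.
  have := @hd_kernel1 R _ gam gcc gamc w _ dp (gamp wr).
  apply: dv_eq.
  rewrite (@cintE _ _ (fun s => - (tpi^-1 * (gam s - w)^-1))); last first.
    move=> s _; have gw := gamNp wr s.
    have D1 := dvB (rd_circle c rho s) (dv_cst (real_complex R) w s).
    have D2 := dvV (@real_complex_continuous R) D1 (_ : gam s - w != 0).
    apply: dv_eq (dvN (dvZ (@real_complex_continuous R) tpi^-1 (D2 _))).
      rewrite -/(gam s) subr0; have := tpi0; rewrite -subr_eq0 in gw.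
      by move: tpi (gam s - w) gw (gam s - c) => u v v0 w' u0; field; rewrite u0 v0.
    by rewrite subr_eq0.
  by rewrite /gam circle_closed subrr.
have wc : wind c = 1.
  rewrite /wind (@cintE _ _ (fun s => s%:C)); first by rewrite rmorph1 rmorph0 subr0.
  move=> s _; have cc : normc (c - c) < rho by rewrite subrr normc0.
  have := gamNp cc s; rewrite -subr_eq0 => gn.
  by rewrite expr1 divff //; exact: dv_emb.
rewrite -wc; apply/eqP; rewrite -subr_eq0 -normc_eq0; apply/eqP/le_anti.
rewrite normc_ge0 andbT.
have cc : normc (c - c) < rho by rewrite subrr normc0.
have L := @rd_lipschitz R (fun s => wind (segpt c p s)) (fun s => 0 * (p - c)) 0 0 1 ler01.
have s1 : segpt c p 1 = p by rewrite /segpt rmorph1 mul1r subrKC.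
have s0 : segpt c p 0 = c by rewrite /segpt rmorph0 mul0r addr0.
rewrite !mul0r s1 s0 in L; apply: L.
  move=> s s01; rewrite -(mul0r (p - c)); apply: rd_comp; last exact: rd_affine.
  by apply: W0; exact: (@convexc_ball c rho c p s cc pr s01).
by move=> s _; rewrite normc0.
Qed.

Let formula p : normc (p - c) < rho -> f p = cint (fun s => k s / (gam s - p) ^+ 1).
Proof.
move=> pr; have pr' := lt_trans pr rhor.
have [l fl] := fd pr'.
have [ph [phc phl phE]] := fl.
(* The difference quotient extended by [l] equals the Caratheodory factor, so it is continuous at
   [p] and has a primitive on the disc; its integral over the circle vanishes and splits into the
   formula and the winding number. *)
pose g z := if z == p then l else (f z - f p) / (z - p).
have gE : g = ph.
  apply/funext => z; rewrite /g; case: eqVneq => [->|zp]; first by rewrite phl.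
  by rewrite phE addrAC subrr add0r mulfK // subr_eq0.
have [|z zr zp|G Gd] := @convex_primitive R _ g p (@open_ballc c r) (@convexc_ball c r) pr'.
- by rewrite gE.
- have [m fm] := fd zr.
  have D := dvM (@id_continuous R) (dvB fm (dv_cst id (f p) z))
     (dvV (@id_continuous R) (dvB (dv_emb id z) (dv_cst id p z)) (_ : z - p != 0)).
  exists ((m - 0) * (z - p)^-1 + (f z - f p) * (- (1 - 0) / (z - p) ^+ 2)).
  apply: near_hd (D _); last by rewrite subr_eq0.
  apply/nbhs_normcP; exists (normc (z - p)); first by rewrite normc_gt0 subr_eq0.
  move=> w wz; rewrite /g; case: eqVneq => // wp.
  by move: wz; rewrite wp normcB ltxx.
have I0 : cint (fun s => tpi^-1 * (g (gam s) * (tpi * (gam s - c)))) = 0.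
  rewrite (@cintE _ _ (fun s => tpi^-1 * G (gam s))).
    by rewrite /gam circle_closed subrr.
  move=> s _; apply: (dvZ (@real_complex_continuous R)).
  by apply: rd_comp; [exact: Gd (gamr s)|exact: rd_circle].
have gn s : gam s - p != 0 by rewrite subr_eq0; exact: gamNp.
have E1 : (fun s => tpi^-1 * (g (gam s) * (tpi * (gam s - c)))) =
  (fun s => k s / (gam s - p) ^+ 1 - f p * ((gam s - c) / (gam s - p) ^+ 1)).
  apply/funext => s; rewrite /g (negbTE (gamNp pr s)) /k; field.
  by rewrite tpi0 gn.
have c1 := @continuous_kernel R k gam kc gamc 1 p (gamNp pr).
have c2 := @continuous_kernel R (fun s => gam s - c) gam gcc gamc 1 p (gamNp pr).
have c3 : continuous (fun s => f p * ((gam s - c) / (gam s - p) ^+ 1)).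
  move=> s; apply: (@contM R R (fun=> f p) _ s); [exact: cont_cst|exact: c2].
move: I0; rewrite E1 (cintB c1 c3) (cintZ _ c2) -/(wind p) windE // mulr1.
by move/eqP; rewrite subr_eq0 => /eqP.
Qed.

Let f1 p := cint (fun s => k s / (gam s - p) ^+ 2).
Let f2 p := 2 * cint (fun s => k s / (gam s - p) ^+ 3).

Let near_in p : normc (p - c) < rho -> \forall w \near p, normc (w - c) < rho.
Proof. by move=> pr; apply: (open_nbhs_nbhs (conj (@open_ballc c rho) pr)). Qed.

(** The estimates accept any bound [M] on the circle of half the radius, not just one for the whole
    disc; [identity_disc] relies on this when it applies them to [f w / (w - c) ^+ n]. *)
Theorem cauchy_derivatives : exists f1 f2 : C -> C,
  [/\ forall z, normc (z - c) < r / 2 -> hd f z (f1 z) /\ hd f1 z (f2 z),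
    exists M, forall s, s \in `[0, 1] -> normc (f (circle c (r / 2) s)) <= M &
    forall M, (forall s, s \in `[0, 1] -> normc (f (circle c (r / 2) s)) <= M) ->
      [/\ normc (f1 c) <= M / (r / 2), normc (f2 c) <= 2 * M / (r / 2) ^+ 2 &
        forall p, normc (p - c) < r / 2 ->
          normc (f p) <= M * (r / 2) / (r / 2 - normc (p - c))]].
Proof.
exists f1, f2; rewrite -/rho -/gam; split.
- move=> z zr; have dp : 0 < rho - normc (z - c) by rewrite subr_gt0.
  split; last exact: (@hd_kernel2 R k gam kc gamc z _ dp (gamp zr)).
  apply: near_hd (@hd_kernel1 R k gam kc gamc z _ dp (gamp zr)).
  by apply: filterS (near_in zr) => w wr; rewrite -formula.
- have fc : continuous (fun s => f (gam s)).
    move=> s; apply: (@cont_comp R C C f gam s); last exact: gamc.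
    by have [l fl] := fd (gamr s); exact: hd_continuous fl.
  have [M M0 HM] := continuous_bounded_normc fc.
  by exists M.
- move=> M fM.
  have M0 : 0 <= M by apply: le_trans (normc_ge0 _) (fM 0 _); rewrite in_itv /= lexx ler01.
  have cc : normc (c - c) < rho by rewrite subrr normc0.
  have kM p n : normc (p - c) < rho ->
      normc (cint (fun s => k s / (gam s - p) ^+ n)) <= M * rho / (rho - normc (p - c)) ^+ n.
    move=> pr; have dp : 0 < rho - normc (p - c) by rewrite subr_gt0.
    apply: cint_le; first exact: (@continuous_kernel R k gam kc gamc n p (gamNp pr)).
    move=> s s01; rewrite normcM normcV normcX /k normcM (circle_dist c s (ltW rho0)).
    have gp : 0 < normc (gam s - p) by rewrite normc_gt0 subr_eq0; exact: gamNp.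
    apply: ler_pM.
    - by rewrite mulr_ge0 ?normc_ge0 // ltW.
    - by rewrite invr_ge0 exprn_ge0 ?normc_ge0.
    - by apply: ler_wpM2r; [exact: ltW|exact: fM].
    - rewrite lef_pV2 ?posrE ?exprn_gt0 //.
      apply: lerXn2r; [exact: ltW|exact: normc_ge0|exact: gamp].
  split.
  - have := kM c 2 cc; rewrite subrr normc0 subr0.
    have E (u : R) : u != 0 -> M * u / u ^+ 2 = M / u by move=> u0; field.
    by rewrite (E rho) // gt_eqF.
  - have := kM c 3 cc; rewrite subrr normc0 subr0 /f2 normcM normc_nat => h.
    have E (u : R) : u != 0 -> 2 * (M * u / u ^+ 3) = 2 * M / u ^+ 2 by move=> u0; field.
    by rewrite -(E rho) ?gt_eqF //; apply: ler_wpM2l h.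
  - by move=> p pr; rewrite formula //; have := kM p 1 pr; rewrite expr1.
Qed.

End CauchyFormula.

(** * Cauchy estimates and the identity theorem on a disc *)

Section Holomorphic.
Variable R : realType.
Local Notation C := R[i].
Implicit Types (f g : C -> C) (W : set C).

Definition holo W f := forall z, W z -> exists l, hd f z l.

Definition Dh f z : C := xget 0 [set l | hd f z l].

Lemma hd_Dh f z l : hd f z l -> Dh f z = l.
Proof. by move=> fl; exact: (hd_unique (xgetI 0 fl) fl). Qed.

Lemma holo_hd W f z : holo W f -> W z -> hd f z (Dh f z).
Proof. by move=> fd /fd [l fl]; rewrite (hd_Dh fl). Qed.

Lemma open_ball_sub W z : open W -> W z ->
  exists2 d : R, 0 < d & forall w, normc (w - z) < d -> W w.
Proof. by move=> Wo Wz; apply/nbhs_normcP; exact: open_nbhs_nbhs. Qed.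

Lemma holo_Dh W f : open W -> holo W f -> holo W (Dh f).
Proof.
move=> Wo fd z Wz; have [r r0 rW] := open_ball_sub Wo Wz.
have [f1 [f2 [H _ _]]] := cauchy_derivatives r0 (fun w wr => fd w (rW w wr)).
have r20 : 0 < r / 2 by rewrite divr_gt0.
exists (f2 z); have zz : normc (z - z) < r / 2 by rewrite subrr normc0.
apply: near_hd (H z zz).2; apply/nbhs_normcP; exists (r / 2) => // w wr.
by rewrite (hd_Dh (H w wr).1).
Qed.

Lemma cauchy_estimate f c (r M : R) : 0 < r -> holo [set z | normc (z - c) < r] f ->
  (forall z, normc (z - c) < r -> normc (f z) <= M) ->
  normc (Dh f c) <= 2 * M / r /\ normc (Dh (Dh f) c) <= 8 * M / r ^+ 2.
Proof.
move=> r0 fd fM; have [f1 [f2 [H _ E]]] := cauchy_derivatives r0 fd.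
have r20 : 0 < r / 2 by rewrite divr_gt0.
have zz : normc (c - c) < r / 2 by rewrite subrr normc0.
have [|e1 e2 _] := E M.
  move=> s _; apply: fM; rewrite circle_dist ?ltW //.
  by rewrite ltr_pdivrMr // mulr_natr mulr2n ltrDl.
rewrite (hd_Dh (H c zz).1).
have -> : Dh (Dh f) c = f2 c.
  apply: hd_Dh; apply: near_hd (H c zz).2; apply/nbhs_normcP; exists (r / 2) => // w wr.
  by rewrite (hd_Dh (H w wr).1).
have -> : 2 * M / r = M / (r / 2) by field; rewrite gt_eqF.
by have -> : 8 * M / r ^+ 2 = 2 * M / (r / 2) ^+ 2 by field; rewrite gt_eqF.
Qed.

(** Without power series: as [f] vanishes near [c], the quotient by [(w - c) ^+ n] is holomorphic
    for every [n]. Bounding it by its values on the circle of radius [r / 2] gives [normc (f z) <= K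
    * (normc (z - c) / (r / 2)) ^+ n], with ratio at most 1/2. *)
Lemma identity_disc f c (r d : R) : 0 < r -> 0 < d ->
  holo [set z | normc (z - c) < r] f ->
  (forall z, normc (z - c) < d -> f z = 0) ->
  forall z, normc (z - c) < r / 4 -> f z = 0.
Proof.
move=> r0 d0 fd fz z zr.
have [zc|zc] := eqVneq z c; first by apply: fz; rewrite zc subrr normc0.
have r20 : 0 < r / 2 by rewrite divr_gt0.
have [f1 [f2 [_ [M HM] _]]] := cauchy_derivatives r0 fd.
have z2 : normc (z - c) < r / 2 by apply: lt_trans zr _; lra.
have zp : 0 < r / 2 - normc (z - c) by rewrite subr_gt0.
pose K := M * (r / 2) / (r / 2 - normc (z - c)).
have M0 : 0 <= M by apply: le_trans (normc_ge0 _) (HM 0 _); rewrite in_itv /= lexx ler01.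
have K0 : 0 <= K by rewrite divr_ge0 ?mulr_ge0 // ltW.
apply/eqP; rewrite -normc_eq0; apply/eqP/le_anti; rewrite normc_ge0 andbT.
apply: (@geometric_le0 _ _ K) => n.
pose g w := f w / (w - c) ^+ n.
have gd : holo [set z | normc (z - c) < r] g.
  move=> w wr; have [wc|wc] := eqVneq w c.
    exists 0; apply: near_hd (dv_cst id 0 w); apply/nbhs_normcP; exists d => // v.
    by rewrite wc => vd; rewrite /g fz // mul0r.
  have [l fl] := fd w wr.
  have D0 : hd (fun w : C => w - c) w (1 - 0) by exact: dvB (dv_emb id w) (dv_cst id c w).
  have D1 := @hd_comp R (fun w => w ^+ n) (fun w => w - c) w _ _ (hdX n (w - c)) D0.
  have D2 := dvV (@id_continuous R) D1 (_ : (w - c) ^+ n != 0).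
  eexists; apply: (dvM (@id_continuous R) fl (D2 _)).
  by rewrite expf_neq0 // subr_eq0.
have [g1 [g2 [_ _ E]]] := cauchy_derivatives r0 gd.
have [|_ _ /(_ z z2)] := E (M / (r / 2) ^+ n).
  move=> s s01; rewrite /g normcM normcV normcX (circle_dist c s (ltW r20)).
  by apply: ler_wpM2r; [rewrite invr_ge0 exprn_ge0 // ltW|exact: HM].
have nz : 0 < normc (z - c) by rewrite normc_gt0 subr_eq0.
rewrite /g normcM normcV normcX ler_pdivrMr ?exprn_gt0 // => h.
apply: le_trans h _.
have -> : M / (r / 2) ^+ n * (r / 2) / (r / 2 - normc (z - c)) * normc (z - c) ^+ n =
  K * (normc (z - c) / (r / 2)) ^+ n.
  have G (a b e k m : R) : a / b * e / k * m = a * e / k * (m / b) by ring.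
  by rewrite /K [(normc _ / _) ^+ n]expr_div_n G.
have q1 : 0 <= normc (z - c) / (r / 2) by rewrite divr_ge0 ?normc_ge0 // ltW.
have q2 : normc (z - c) / (r / 2) <= 2^-1 by rewrite ler_pdivrMr //; lra.
by apply: ler_wpM2l => //; rewrite -exprVn; apply: lerXn2r; rewrite // nnegrE invr_ge0.
Qed.

End Holomorphic.

(** * Comparison of notions of derivative, and the identity theorem in two variables *)

Section Bridge.
Variable R : realType.
Local Notation C := R[i].

Lemma is_derive_hd (f : C -> C) (z l : C) : is_derive z 1 f l -> hd f z l.
Proof.
move=> [/cvg_ex [m fm] fl].
have ml : m = l.
  by rewrite -fl; apply/esym/cvg_lim => //; exact: norm_hausdorff.
rewrite ml in fm; apply/hdP => e e0.
have /nbhs_normcP [d d0 dH] : nbhs (0 : C)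
    [set x | x != 0 -> normc (x^-1 *: (f (x *: (1 : C) + z) - f z) - l) < e].
  exact: (cvg_normcP _ _ _).1 fm e e0.
exists d => // w wd; have [->|wz] := eqVneq w z.
  by rewrite !subrr mulr0 subr0 normc0 mulr0.
have wz0 : w - z != 0 by rewrite subr_eq0.
have /= := dH (w - z) _ wz0; rewrite subr0 => /(_ wd).
rewrite /GRing.scale /= mulr1 subrK => h.
have -> : f w - f z - l * (w - z) = ((w - z)^-1 * (f w - f z) - l) * (w - z) by field.
by rewrite normcM ler_wpM2r ?normc_ge0 // ltW.
Qed.

Lemma hd_is_derive (f : C -> C) (z l : C) : hd f z l -> is_derive z 1 f l.
Proof.
move=> [p [pc pl pE]].
have L : (fun h : C => h^-1 *: (f (h *: (1 : C) + z) - f z)) @ (0 : C)^' --> l.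
  apply/cvg_normcP => e e0.
  have [d d0 dH] := (continuous_normcP p z).1 pc e e0.
  suff : nbhs (0 : C)
    [set x | x != 0 -> normc (x^-1 *: (f (x *: (1 : C) + z) - f z) - l) < e] by exact.
  apply/nbhs_normcP; exists d => // h; rewrite subr0 => hd h0.
  have -> : h^-1 *: (f (h *: (1 : C) + z) - f z) = p (h + z).
    rewrite /GRing.scale /= mulr1 pE [f z + _]addrC !addrK mulrCA mulVf ?mulr1 //.
  by rewrite -pl; apply: dH; rewrite addrK.
split; first by apply/cvg_ex; exists l.
by apply/cvg_lim => //; exact: norm_hausdorff.
Qed.

Lemma derive1_hd (f : C -> C) (z l : C) : hd f z l -> derive1 f z = l.
Proof. by move=> /hd_is_derive [_ <-]; rewrite derive1E. Qed.

Lemma derive1n2_hd (f f1 : C -> C) (z l : C) : (\forall w \near z, hd f w (f1 w)) ->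
  hd f1 z l -> derive1n 2 f z = l.
Proof.
move=> fn f1l; rewrite derive1nS derive1n1; apply: derive1_hd; apply: near_hd f1l.
by apply: filterS fn => w /derive1_hd.
Qed.

Lemma differentiable_hd (f : C -> C) (z : C) : differentiable f z -> exists l, hd f z l.
Proof.
move=> /derivable1_diffP fd; exists ('D_1 f z); apply: is_derive_hd.
by split.
Qed.

Lemma hd_differentiable (f : C -> C) (z l : C) : hd f z l -> differentiable f z.
Proof. by move=> /hd_is_derive [fd _]; apply/derivable1_diffP. Qed.

Lemma differentiable_line (F : C * C -> C) (a b u v z : C) :
  differentiable F (a + z * u, b + z * v) ->
  exists l, hd (fun w => F (a + w * u, b + w * v)) z l.
Proof.
move=> Fd; apply: differentiable_hd.
have da (x y : C) : differentiable (fun w : C => x + w * y) z.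
  exact: hd_differentiable (dvD (dv_cst id x z)
    (dvM (@id_continuous R) (dv_emb id z) (dv_cst id y z))).
have dp : differentiable (fun w : C => (a + w * u, b + w * v)) z.
  by apply: differentiable_pair; exact: da.
exact: (differentiable_comp dp Fd).
Qed.

Lemma nbhs_pairP (x y : C) (A : set (C * C)) : nbhs (x, y) A <->
  exists2 d : R, 0 < d & forall u v, normc (u - x) < d -> normc (v - y) < d -> A (u, v).
Proof.
split.
  case=> -[A1 A2] /= [/nbhs_normcP [d1 d10 H1] /nbhs_normcP [d2 d20 H2]] AA.
  exists (Num.min d1 d2) => [|u v]; rewrite !lt_min ?d10 //.
  by move=> /andP[u1 _] /andP[_ v2]; apply: AA; split; [exact: H1|exact: H2].
case=> d d0 H; exists ([set u | normc (u - x) < d], [set v | normc (v - y) < d]).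
  by split; apply/nbhs_normcP; exists d.
by move=> [u v] [/= ud vd]; exact: H.
Qed.

(** The set of points near which [F] vanishes is open and relatively closed. Closedness is proved
    one variable at a time: a point of the set and any nearby point span a complex line, to which
    [identity_disc] applies. *)
Lemma identity_connected (D : set (C * C)) (F : C * C -> C) p0 :
  open D -> connected D -> (forall p, D p -> differentiable F p) -> D p0 ->
  (\forall p \near p0, F p = 0) -> forall p, D p -> F p = 0.
Proof.
move=> Do Dc Fd Dp0 F0.
pose E := [set p | D p /\ \forall q \near p, F q = 0].
have EE : E = D.
  apply: Dc; first by exists p0.
  - exists (interior [set q | F q = 0]); first exact: open_interior.
    by apply/seteqP; split => p [].
  - exists (closure E); first exact: closed_closure.
    apply/seteqP; split => [p Ep|[x y] [Dp clp]].
      by split; [case: Ep|exact: subset_closure].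
    split; first exact: Dp.
    have /nbhs_pairP [d d0 dD] : nbhs (x, y) D by apply: open_nbhs_nbhs.
    (* The line is followed for parameters up to 5, with direction components below [2 * h]; it
       stays within [h + 5 * 2 * h < d] of [(x, y)]. *)
    pose h := d / 16; have h0 : 0 < h by rewrite divr_gt0.
    have Bh : nbhs (x, y) [set q : C * C | normc (q.1 - x) < h /\ normc (q.2 - y) < h].
      by apply/nbhs_pairP; exists h.
    have [[a b] [[_ /nbhs_pairP [k k0 kF]] [/= ax bx]]] := clp _ Bh.
    apply/nbhs_pairP; exists h => // u v ux vy.
    have ua : normc (u - a) < 2 * h.
      have -> : u - a = (u - x) - (a - x) by ring.
      by apply: le_lt_trans (le_normcB _ _) _; lra.
    have vb : normc (v - b) < 2 * h.
      have -> : v - b = (v - y) - (b - y) by ring.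
      by apply: le_lt_trans (le_normcB _ _) _; lra.
    (* [w = 0] is the point where [F] vanishes nearby and [w = 1] the target. Radius 5 is chosen
       because [identity_disc] only reaches a quarter of it, and [5 / 4 > 1]. *)
    pose g w := F (a + w * (u - a), b + w * (v - b)).
    have gd : holo [set w | normc (w - 0) < 5] g.
      move=> w /=; rewrite subr0 => w5; apply: differentiable_line; apply: Fd.
      have bound e c : normc (e - c) < h -> forall t, normc t < 2 * h -> normc (e + w * t - c) < d.
        move=> ec t th; have -> : e + w * t - c = (e - c) + w * t by ring.
        apply: le_lt_trans (le_normcD _ _) _; rewrite normcM.
        have := ler_pM (normc_ge0 w) (normc_ge0 t) (ltW w5) (ltW th).
        by rewrite /h in ec h0 *; lra.
      by apply: dD; exact: bound.
    have k20 : 0 < k / (2 * h) by rewrite divr_gt0 // mulr_gt0.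
    have g0 w : normc (w - 0) < k / (2 * h) -> g w = 0.
      rewrite subr0 => wk; apply: kF; rewrite addrC addrA [- _ + _]addrC subrr add0r normcM.
        have := ler_wpM2l (normc_ge0 w) (ltW ua); move: wk; rewrite ltr_pdivlMr ?mulr_gt0 //; lra.
      have := ler_wpM2l (normc_ge0 w) (ltW vb); move: wk; rewrite ltr_pdivlMr ?mulr_gt0 //; lra.
    have := @identity_disc R g 0 5 (k / (2 * h)) (ltr0n _ 5) k20 gd g0 1.
    rewrite subr0 normc1 /g !mul1r ![_ + (_ - _)]addrC !subrK; apply.
    by rewrite ltr_pdivlMr // mul1r ltr_nat.
by move=> p; rewrite -EE => -[_ /nbhs_singleton].
Qed.

End Bridge.

(** * Exponential, logarithm and powers *)

Section ComplexExponential.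
Variable R : realType.
Local Notation C := R[i].
Implicit Types (z w : C) (a b : R).

Definition cexp z : C := (expR (Re z))%:C * cis (Im z).

Lemma cexpD z w : cexp (z + w) = cexp z * cexp w.
Proof.
rewrite /cexp cReD cImD expRD rmorphM /cis cosD sinD.
set p := (expR _)%:C; set q := (expR _)%:C.
have -> : (cos (Im z) * cos (Im w) - sin (Im z) * sin (Im w)) +i*
  (sin (Im z) * cos (Im w) + cos (Im z) * sin (Im w)) =
  (cos (Im z) +i* sin (Im z)) * (cos (Im w) +i* sin (Im w)).
  by apply: complex_ext; rewrite ?cReM ?cImM /=; ring.
by ring.
Qed.

Lemma cexp0 : cexp 0 = 1.
Proof. by rewrite /cexp /= expR0 /cis cos0 sin0 mul1r. Qed.

Lemma normc_cexp z : normc (cexp z) = expR (Re z).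
Proof. by rewrite normcM normc_cis mulr1 normc_real ger0_norm // expR_ge0. Qed.

Lemma cexp_neq0 z : cexp z != 0.
Proof. by rewrite -normc_gt0 normc_cexp expR_gt0. Qed.

Lemma cexpMn z n : cexp (n%:R * z) = cexp z ^+ n.
Proof.
elim: n => [|n IH]; first by rewrite mul0r cexp0 expr0.
by rewrite mulrS mulrDl mul1r cexpD IH exprS.
Qed.

(** Complex differentiability is assembled from real factorisations of [exp], [cos] and [sin] at 0:
    [cexp h - 1 - h] is exactly [(u h - 1) * Re h + (v h - i) * Im h] with [u], [v] continuous and
    [u 0 = 1], [v 0 = i]. *)
Let hd_cexp0 : hd cexp 0 1.
Proof.
have /is_derive_caratheodory [a [ac a1 aE]] := is_derive_expR (0 : R).
have /is_derive_caratheodory [b [bc b1 bE]] := is_derive_cos (0 : R).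
have /is_derive_caratheodory [c [cc c1 cE]] := is_derive_sin (0 : R).
have cr (g : R -> R) : {for 0, continuous g} -> {for (0 : C), continuous (fun h : C => (g (Re h))%:C)}.
  move=> gc; apply: (@cont_comp C R C (real_complex R) (fun h => g (Re h)) 0).
    exact: continuous_real_complex.
  by apply: (@cont_comp C R R g (@Re R) 0); [exact: gc|exact: continuous_Re].
have ci (g : R -> R) : {for 0, continuous g} -> {for (0 : C), continuous (fun h : C => (g (Im h))%:C)}.
  move=> gc; apply: (@cont_comp C R C (real_complex R) (fun h => g (Im h)) 0).
    exact: continuous_real_complex.
  by apply: (@cont_comp C R R g (@Im R) 0); [exact: gc|exact: continuous_Im].
pose u (h : C) : C := (a (Re h))%:C.
pose v (h : C) : C := (expR (Re h))%:C * ((b (Im h))%:C + (c (Im h))%:C * 'i%C).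
have uc : {for 0, continuous u} by exact: cr.
have vc : {for 0, continuous v}.
  apply: contM; first by apply: (cr expR); exact: continuous_expR.
  apply: contD; first exact: (ci b).
  by apply: contM; [exact: (ci c)|exact: cont_cst].
have u0 : u 0 = 1 by rewrite /u a1 expR0.
have v0 : v 0 = 'i%C.
  rewrite /v b1 c1 sin0 cos0 oppr0.
  have -> : (expR (Re (0 : C)))%:C = 1 :> C by rewrite expR0.
  by rewrite mul1r rmorph0 rmorph1 mul1r add0r.
apply/hdP => e e0; have e2 : 0 < e / 2 by rewrite divr_gt0.
have [d d0 dH] := (continuous_normcP u 0).1 uc _ e2.
have [d' d'0 dH'] := (continuous_normcP v 0).1 vc _ e2.
exists (Num.min d d') => [|h]; rewrite !lt_min ?d0 // => /andP[hd1 hd2].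
have h1 := dH h hd1; have h2 := dH' h hd2; rewrite u0 in h1; rewrite v0 in h2.
rewrite cexp0 subr0 mul1r.
have -> : cexp h - 1 - h = (u h - 1) * (Re h)%:C + (v h - 'i%C) * (Im h)%:C.
  rewrite /cexp /cis.
  have -> : cos (Im h) +i* sin (Im h) = 1 + ((b (Im h))%:C + (c (Im h))%:C * 'i%C) * (Im h)%:C.
    apply: complex_ext.
      by rewrite bE subr0 cos0 cReD cReM /=; ring.
    by rewrite cE subr0 sin0 cImD cImM /=; ring.
  have E : (expR (Re h))%:C = 1 + u h * (Re h)%:C.
    by rewrite /u [expR (Re h)]aE subr0 expR0 rmorphD rmorphM rmorph1.
  rewrite /v E [X in _ - 1 - X](complexE h).
  by move: (u h) (Re h)%:C (Im h)%:C ((b _)%:C + _) => u' x y W; ring.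
apply: le_trans (le_normcD _ _) _; rewrite !normcM !normc_real.
have r1 := ler_pM (normc_ge0 _) (normr_ge0 _) (ltW h1) (normc_Re h).
have r2 := ler_pM (normc_ge0 _) (normr_ge0 _) (ltW h2) (normc_Im h).
by lra.
Qed.

Lemma hd_cexp z : hd cexp z (cexp z).
Proof.
have -> : cexp = (fun w => cexp z * cexp (w - z)).
  by apply/funext => w; rewrite -cexpD subrKC.
apply: dv_eq (dvZ (@id_continuous R) (cexp z) (_ : hd (fun w => cexp (w - z)) z 1)).
  by rewrite mulr1 subrr cexp0 mulr1.
have D : hd (fun w : C => w - z) z 1.
  by have := dvB (dv_emb id z) (dv_cst id z z); apply: dv_eq; rewrite subr0.
have := @hd_comp R cexp (fun w => w - z) z 1 1; rewrite subrr mulr1.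
by move=> /(_ hd_cexp0 D).
Qed.

(** The branch with argument in []0, pi[]. It is a logarithm on the upper half-plane, where [acos]
    gives the argument; the variables [x] and [Z] both live there. *)
Definition clog z : C := ln (normc z) +i* acos (Re z / normc z).

Definition uhp : set C := [set z | 0 < Im z].

Lemma uhp_neq0 z : uhp z -> z != 0.
Proof. by move=> zu; apply/negP => /eqP E; move: zu; rewrite /uhp /= E /= ltxx. Qed.

Let uhp_ratio z : uhp z -> -1 < Re z / normc z < 1.
Proof.
move=> zu; have z0 : 0 < normc z by rewrite normc_gt0 uhp_neq0.
have : `|Re z| < normc z.
  rewrite -(ltr_pXn2r (_ : (0 < 2)%N)) ?nnegrE ?normc_ge0 //.
  by rewrite sqr_normcE real_normK ?num_real // ltrDl exprn_gt0.
by rewrite ltr_norml ltr_pdivlMr // ltr_pdivrMr // mulN1r mul1r.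
Qed.

Lemma clogK z : uhp z -> cexp (clog z) = z.
Proof.
move=> zu; have z0 : 0 < normc z by rewrite normc_gt0 uhp_neq0.
have /andP[r1 r2] := uhp_ratio zu.
rewrite /cexp /= lnK ?posrE // /cis acosK ?in_itv /= ?(ltW r1) ?(ltW r2) //.
rewrite sin_acos ?(ltW r1) ?(ltW r2) //.
have -> : 1 - (Re z / normc z) ^+ 2 = (Im z / normc z) ^+ 2.
  have : normc z != 0 by rewrite gt_eqF.
  rewrite !expr_div_n sqr_normcE => n0; have n2 : Re z ^+ 2 + Im z ^+ 2 != 0.
    by rewrite -sqr_normcE expf_neq0.
  by field.
rewrite sqrtr_sqr ger0_norm; last by rewrite divr_ge0 ?normc_ge0 // ltW.
by apply: complex_ext; rewrite ?cReM ?cImM /=; field; rewrite gt_eqF.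
Qed.

Lemma clog_arg z : uhp z -> 0 < Im (clog z) < pi.
Proof.
move=> zu; have /andP[r1 r2] := uhp_ratio zu.
by rewrite /= acos_gt0 ?acos_ltpi // ?r1 ?r2 ?(ltW r1) ?(ltW r2).
Qed.

Lemma cexpK w : 0 < Im w < pi -> clog (cexp w) = w.
Proof.
move=> /andP[w0 wp]; rewrite /clog normc_cexp expRK.
have -> : Re (cexp w) / expR (Re w) = cos (Im w).
  by rewrite /cexp cReM /= mul0r subr0 mulrC mulKf // gt_eqF // expR_gt0.
by rewrite cosK ?in_itv /= ?(ltW w0) ?(ltW wp) //; case: w {w0 wp}.
Qed.

Lemma uhp_cexp w : 0 < Im w < pi -> uhp (cexp w).
Proof.
move=> wp; rewrite /uhp /mkset.
have -> : Im (cexp w) = expR (Re w) * sin (Im w) by rewrite /cexp cImM /=; ring.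
by rewrite mulr_gt0 ?expR_gt0 // sin_gt0_pi // in_itv /=.
Qed.

Lemma open_uhp : open uhp.
Proof.
rewrite openE => z zu; apply/nbhs_normcP; exists (Im z) => // w wz; rewrite /uhp /=.
have := le_lt_trans (normc_Im (w - z)) wz.
by rewrite cImD cImN ltr_norml => /andP[]; lra.
Qed.

Let clog_continuous z : uhp z -> {for z, continuous clog}.
Proof.
move=> zu; have z0 : 0 < normc z by rewrite normc_gt0 uhp_neq0.
apply: (@cvg_complex _ C (nbhs z) clog (clog z)) => /=.
  apply: (@cont_comp C R R (@ln R) (@normc R) z); last exact: continuous_normc.
  exact: continuous_ln.
have nc : {for z, continuous (fun w : C => Re w / normc w)}.
  have n1 : {for z, continuous (fun w : C => (normc w)^-1)}.
    have nz : normc z != 0 by rewrite gt_eqF.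
    exact: (@cvgV R C (nbhs z) _ (@normc R) (normc z) nz (@continuous_normc R z)).
  exact: (@cvgM R C (nbhs z) _ (@Re R) (fun w => (normc w)^-1) _ _
    (@continuous_Re R z) n1).
apply: (@cont_comp C R R (@acos R) (fun w => Re w / normc w) z); last exact: nc.
exact: continuous_acos (uhp_ratio zu).
Qed.

(** The derivative of an inverse function: the factor of [cexp] at [clog z] gives
    [w - z = p (clog w) * (clog w - clog z)], with [p (clog z) = z] nonzero. *)
Lemma hd_clog z : uhp z -> hd clog z z^-1.
Proof.
move=> zu; have z0 := uhp_neq0 zu.
have [p [pc pl pE]] := hd_cexp (clog z); rewrite clogK // in pl pE.
pose g w := clog z + (p (clog w))^-1 * (w - z).
have pcl : {for z, continuous (fun w => p (clog w))}.
  by apply: cont_comp; [exact: pc|exact: clog_continuous].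
have gd : hd g z z^-1.
  exists (fun w => (p (clog w))^-1); split; [|by rewrite pl|].
    by apply: contV; [rewrite pl|exact: pcl].
  by move=> w; rewrite /g subrr mulr0 addr0.
apply: near_hd gd; have np : 0 < normc (p (clog z)) by rewrite pl normc_gt0.
have N1 := (cvg_normcP _ _ (nbhs_filter z)).1 pcl _ np.
have N2 : \forall w \near z, uhp w by apply: (open_nbhs_nbhs (conj open_uhp zu)).
apply: filterS2 N1 N2 => w w1 wu; rewrite /g.
have pw : p (clog w) != 0.
  by apply/negP => /eqP E; move: w1; rewrite E sub0r normcN ltxx.
have -> : w - z = p (clog w) * (clog w - clog z).
  have := pE (clog w); rewrite clogK //= => e.
  by apply/eqP; rewrite subr_eq addrC; apply/eqP.
by rewrite mulKf // subrKC.
Qed.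

Definition cpow a z := cexp (a%:C * clog z).

Lemma cpow_neq0 a z : cpow a z != 0.
Proof. exact: cexp_neq0. Qed.

Lemma hd_cpow a z : uhp z -> hd (cpow a) z (a%:C * cpow a z / z).
Proof.
move=> zu; have D := dvZ (@id_continuous R) a%:C (hd_clog zu).
have := @hd_comp R cexp (fun w => a%:C * clog w) z _ _ (hd_cexp _) D.
by apply: dv_eq; rewrite /cpow; ring.
Qed.

Lemma cpow1 z : uhp z -> cpow 1 z = z.
Proof. by move=> zu; rewrite /cpow rmorph1 mul1r clogK. Qed.

Lemma cpowX a z n : cpow a z ^+ n = cpow (n%:R * a) z.
Proof. by rewrite /cpow -cexpMn rmorphM rmorph_nat mulrA. Qed.

Lemma cpow_log a z : 0 < a * Im (clog z) < pi -> clog (cpow a z) = a%:C * clog z.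
Proof. by move=> h; rewrite /cpow cexpK // cImM /= mul0r addr0. Qed.

Lemma cpow_uhp a z : 0 < a * Im (clog z) < pi -> uhp (cpow a z).
Proof. by move=> h; apply: uhp_cexp; rewrite cImM /= mul0r addr0. Qed.

Lemma cpow_pow a b z : 0 < a * Im (clog z) < pi -> cpow b (cpow a z) = cpow (b * a) z.
Proof. by move=> h; rewrite /cpow cpow_log // rmorphM mulrA. Qed.

Lemma polar_cexp (r theta : R) : 0 < r -> r%:C * cis theta = cexp (ln r +i* theta).
Proof. by move=> r0; rewrite /cexp /= lnK. Qed.

End ComplexExponential.

(** * Boutroux' equation on half-planes *)

Lemma sqr1_norm (R : realType) (e : R) : e ^+ 2 = 1 -> `|e| = 1.
Proof.
by move=> e2; apply/eqP; rewrite -(eqrXn2 (_ : (0 < 2)%N)) // expr1n real_normK ?num_real // e2.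
Qed.

Section UniformLimits.
Variable R : realType.
Local Notation C := R[i].

Lemma geometric_cauchy_complex (u : nat -> C) (A : R) :
  (forall n, normc (u n.+1 - u n) <= A / 2 ^+ n) ->
  exists l : C, forall n, normc (u n - l) <= 4 * A / 2 ^+ n.
Proof.
move=> H.
have [|a aH] := @geometric_cauchy R (fun n => Re (u n)) A.
  by move=> n; apply: le_trans (H n); rewrite -cReN -cReD; exact: normc_Re.
have [|b bH] := @geometric_cauchy R (fun n => Im (u n)) A.
  by move=> n; apply: le_trans (H n); rewrite -cImN -cImD; exact: normc_Im.
exists (a +i* b) => n; apply: le_trans (normc_leD _) _.
rewrite cReD cReN cImD cImN /=; apply: le_trans (lerD (aH n) (bH n)) _.
by rewrite le_eqVlt; apply/orP; left; apply/eqP; ring.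
Qed.

Lemma hd_lipschitz (F F' : C -> C) (z w : C) (M : R) :
  (forall s, s \in `[0, 1] -> hd F (segpt z w s) (F' (segpt z w s))) ->
  (forall s, s \in `[0, 1] -> normc (F' (segpt z w s)) <= M) ->
  normc (F w - F z) <= M * normc (w - z).
Proof.
move=> Fd FM.
have := @rd_lipschitz R (fun s => F (segpt z w s))
  (fun s => F' (segpt z w s) * (w - z)) (M * normc (w - z)) 0 1 ler01.
have s1 : segpt z w 1 = w by rewrite /segpt rmorph1 mul1r subrKC.
have s0 : segpt z w 0 = z by rewrite /segpt rmorph0 mul0r addr0.
rewrite s1 s0 subr0 mulr1; apply.
  by move=> s s01; apply: rd_comp; [exact: Fd|exact: rd_affine].
by move=> s s01; rewrite normcM; apply: ler_wpM2r; [exact: normc_ge0|exact: FM].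
Qed.

(** The mean value inequality bounds increments of [F k - F n] through [G k - G n]; letting [k] grow
    bounds those of [f - F n], so [F n] for one large [n] can stand in for [f]. *)
Lemma uniform_limit_hd (W : set C) (F G : nat -> C -> C) (f g : C -> C) (K : R) :
  open W -> (forall n z, W z -> hd (F n) z (G n z)) ->
  (forall n z, W z -> normc (F n z - f z) <= K / 2 ^+ n) ->
  (forall n z, W z -> normc (G n z - g z) <= K / 2 ^+ n) ->
  forall z, W z -> hd f z (g z).
Proof.
move=> Wo FG Ff Gg z Wz; apply/hdP => e e0.
have e4 : 0 < e / 4 by rewrite divr_gt0.
have [n nK] := geometric_small K e4.
have [d d0 dW] := open_ball_sub Wo Wz.
have [d' d'0 dF] := (hdP _ _ _).1 (FG n z Wz) _ e4.
exists (Num.min d d') => [|w]; rewrite !lt_min ?d0 // => /andP[wd wd'].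
have Ww := dW w wd.
have seg s : s \in `[0, 1] -> W (segpt z w s).
  move=> s01; apply: dW.
  have zz : normc (z - z) < d by rewrite subrr normc0.
  exact: (@convexc_ball R z d z w s zz wd s01).
have tail : normc ((f w - F n w) - (f z - F n z)) <= 2 * (K / 2 ^+ n * normc (w - z)).
  rewrite -subr_le0; apply: (@geometric_le0 _ _ (2 * K + K * normc (w - z))) => k.
  have L : normc ((F k w - F n w) - (F k z - F n z)) <= (K / 2 ^+ k + K / 2 ^+ n) * normc (w - z).
    apply: (@hd_lipschitz (fun v => F k v - F n v) (fun v => G k v - G n v)).
      by move=> s s01; apply: dvB; apply: FG; exact: seg.
    move=> s s01; have Ws := seg s s01.
    have -> : G k (segpt z w s) - G n (segpt z w s) =
      (G k (segpt z w s) - g (segpt z w s)) - (G n (segpt z w s) - g (segpt z w s)) by ring.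
    by apply: le_trans (le_normcB _ _) _; apply: lerD; exact: Gg.
  have E : (f w - F n w) - (f z - F n z) = ((F k w - F n w) - (F k z - F n z)) -
     (F k w - f w) + (F k z - f z) by ring.
  rewrite E; have := le_normcD (((F k w - F n w) - (F k z - F n z)) - (F k w - f w)) (F k z - f z).
  have := le_normcB ((F k w - F n w) - (F k z - F n z)) (F k w - f w).
  have := Ff k w Ww; have := Ff k z Wz => h1 h2 h3 h4.
  have -> : (2 * K + K * normc (w - z)) / 2 ^+ k =
    K / 2 ^+ k + K / 2 ^+ k + K / 2 ^+ k * normc (w - z) by ring.
  have : 0 <= K / 2 ^+ n * normc (w - z).
    by rewrite mulr_ge0 ?normc_ge0 // (le_trans (normc_ge0 _) (Gg n z Wz)).
  rewrite mulrDl in L.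
  by move: (K / 2 ^+ k) (K / 2 ^+ n) h1 h2 L => x y; lra.
have E : f w - f z - g z * (w - z) = ((f w - F n w) - (f z - F n z)) +
   (F n w - F n z - G n z * (w - z)) + (G n z - g z) * (w - z) by ring.
rewrite E; apply: le_trans (le_normcD _ _) _.
have := le_normcD ((f w - F n w) - (f z - F n z)) (F n w - F n z - G n z * (w - z)).
have := dF w wd'; rewrite normcM.
have := ler_wpM2r (normc_ge0 (w - z)) (Gg n z Wz).
have := ler_wpM2r (normc_ge0 (w - z)) (ltW nK).
lra.
Qed.

End UniformLimits.

(** * The first-order equation along rays *)

Section LinearEquation.
Variable R : realType.
Local Notation C := R[i].
Variable m : R.
Hypotheses (m0 : 0 < m) (m1 : m <= 1).

Lemma rd_cexp (a : C) (s : R) : rd (fun x => cexp (x%:C * a)) s (a * cexp (s%:C * a)).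
Proof.
have D : rd (fun x : R => x%:C * a) s a.
  by have := rd_affine 0 a s; apply: near_dv; [move=> x y []|exact: filterE (fun x => add0r _)].
by have := rd_comp (hd_cexp _) D; apply: dv_eq; rewrite mulrC.
Qed.

(** Variation of constants from infinity: [cexp (- s c) * P s] has a derivative of size at most
    [A * expR (- (m / 2) * s)], whose integral is [2 * A / m], and by the last hypothesis it is
    small at some time. *)
Lemma ray_bound (P k : R -> C) (c : C) (A : R) : Re c = m ->
  (forall s, 0 <= s -> rd P s (c * P s + k s)) ->
  (forall s, 0 <= s -> normc (k s) <= A * expR (m / 2 * s)) ->
  (forall e, 0 < e -> exists2 T, 0 <= T & normc (cexp (- (T%:C * c)) * P T) <= e) ->
  normc (P 0) <= 2 * A / m.
Proof.
move=> cm Pd kA Pe.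
have A0 : 0 <= A.
  by have := kA 0 (lexx 0); rewrite mulr0 expR0 mulr1; apply: le_trans; exact: normc_ge0.
apply/ler_addgt0Pr => e e0; have [T T0 Te] := Pe e e0.
have := @rd_norm_le R (fun s => cexp (s%:C * - c) * P s)
  (fun s => cexp (s%:C * - c) * k s) (fun s => - (2 * A / m) * expR (- (m / 2) * s))
  (fun s => A * expR (- (m / 2) * s)) 0 T T0.
have mn : m != 0 by rewrite gt_eqF.
rewrite rmorph0 mul0r cexp0 mul1r mulr0 expR0 => H.
have {H} : normc (cexp (T%:C * - c) * P T - P 0) <=
    - (2 * A / m) * expR (- (m / 2) * T) - - (2 * A / m) * 1.
  apply: H => s; rewrite in_itv /= => /andP[s0 _].
  - have := dvM (@real_complex_continuous R) (rd_cexp (- c) s) (Pd s s0).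
    by apply: dv_eq; ring.
  - have D := @is_derive1_comp R expR (fun y => - (m / 2) * y) s _ _
      (is_derive_expR _) (is_derive_linear (- (m / 2)) s).
    have /is_derive_caratheodory [p [pc pl pE]] := D.
    apply/is_derive_caratheodory; exists (fun x => - (2 * A / m) * p x); split.
    + by apply: cvgM; [exact: cvg_cst|exact: pc].
    + by rewrite pl; field.
    + by move=> x; have /= -> := pE x; ring.
  - rewrite normcM normc_cexp.
    have -> : Re (s%:C * - c) = - (m * s) by rewrite cReM cReN cm /=; ring.
    apply: le_trans (ler_wpM2l (ltW (expR_gt0 _)) (kA s s0)) _.
    rewrite mulrCA -expRD le_eqVlt; apply/orP; left; apply/eqP; congr (_ * expR _).
    by field.
have -> : T%:C * - c = - (T%:C * c) by ring.
have h1 := lerB_normc (P 0) (cexp (- (T%:C * c)) * P T).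
rewrite [normc (P 0 - _)]normcB in h1.
have h2 : 0 <= 2 * A / m * expR (- (m / 2) * T).
  by rewrite mulr_ge0 ?expR_ge0 // divr_ge0 ?mulr_ge0 // ltW.
rewrite mulNr mulr1 opprK => h3.
move: h1; rewrite lerBlDr => h1; apply: le_trans h1 _.
apply: lerD Te; apply: le_trans h3 _.
by rewrite gerDr oppr_le0.
Qed.

(** In this direction the solution [cexp (sg * z)] of [p' = sg * p] grows at rate [m], hence is
    incompatible with boundedness. The imaginary part 1 makes the ray parameter equal to the height
    gained. *)
Definition raydir (sg : R) : C := (sg * m) +i* 1.

Lemma normc_raydir sg : sg ^+ 2 = 1 -> normc (raydir sg) <= 2.
Proof.
move=> sg2; have sg1 := sqr1_norm sg2.
apply: le_trans (normc_leD _) _; rewrite /= normrM sg1 mul1r normr1 (ger0_norm (ltW m0)).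
by have := m1; lra.
Qed.

Lemma ray_estimate (sg : R) (p h : C -> C) (z : C) (A B : R) : sg ^+ 2 = 1 ->
  (forall s, 0 <= s -> hd p (z + s%:C * raydir sg)
     (sg%:C * p (z + s%:C * raydir sg) + h (z + s%:C * raydir sg))) ->
  (forall s, 0 <= s -> normc (p (z + s%:C * raydir sg)) <= B) ->
  (forall s, 0 <= s -> normc (h (z + s%:C * raydir sg)) <= A * expR (m / 2 * s)) ->
  normc (p z) <= 4 * A / m.
Proof.
move=> sg2 pd pB hA; pose d := raydir sg.
have sgC : sg%:C * sg%:C = 1 :> C by rewrite -rmorphM -expr2 sg2 rmorph1.
have := @ray_bound (fun s => p (z + s%:C * d)) (fun s => d * h (z + s%:C * d))
  (sg%:C * d) (2 * A).
rewrite rmorph0 mul0r addr0 mulrA -natrM; apply.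
- by rewrite cReM /= mul0r subr0 mulrA -expr2 sg2 mul1r.
- move=> s s0; have := rd_comp (pd s s0) (rd_affine z d s).
  by apply: dv_eq; rewrite -/d; ring.
- move=> s s0; rewrite normcM -mulrA; apply: ler_pM; rewrite ?normc_ge0 //.
    exact: normc_raydir.
  exact: hA.
- move=> e e0.
  have B0 : 0 <= B by apply: le_trans (normc_ge0 _) (pB 0 (lexx 0)).
  have [n nB] := geometric_small B e0.
  (* At this time the factor has modulus [expR (- n)], at most [2 ^- n], which beats the bound
     [B]. *)
  exists (n%:R / m); first by rewrite divr_ge0 // ltW.
  have T0 : 0 <= n%:R / m by rewrite divr_ge0 // ltW.
  rewrite normcM normc_cexp; apply: le_trans (ltW nB).
  rewrite mulrC; apply: ler_pM; rewrite ?normc_ge0 ?expR_ge0 //; first exact: pB.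
  have -> : Re (- ((n%:R / m)%:C * (sg%:C * d))) = - n%:R.
    rewrite cReN cReM cReM /= !mul0r !subr0.
    have -> : sg * (sg * m) = m by rewrite mulrA -expr2 sg2 mul1r.
    by rewrite divfK // gt_eqF.
  rewrite expRN lef_pV2 ?posrE ?expR_gt0 ?exprn_gt0 //.
  rewrite -[n%:R]mulr1 mulrC expRM_natr lerXn2r ?nnegrE ?expR_ge0 //.
  by have := expR_ge1Dx (1 : R); rewrite -[1 + 1]/(2%:R).
Qed.

End LinearEquation.

(** * The equation [r'' = r + h] on forward-invariant regions *)

Section SecondOrder.
Variable R : realType.
Local Notation C := R[i].
Variable m : R.
Hypotheses (m0 : 0 < m) (m1 : m <= 1).
Local Notation dir := (raydir m).

Definition forward (W : set C) := forall z sg (s : R), W z -> sg ^+ 2 = 1 -> 0 <= s ->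
  W (z + s%:C * dir sg).

Lemma expRN_geometric n : expR (- n%:R) <= (2 ^+ n)^-1 :> R.
Proof.
rewrite expRN lef_pV2 ?posrE ?expR_gt0 ?exprn_gt0 //.
rewrite -[n%:R]mulr1 mulrC expRM_natr lerXn2r ?nnegrE ?expR_ge0 //.
by have := expR_ge1Dx (1 : R); rewrite -[1 + 1]/(2%:R).
Qed.

Lemma Re_dir (sg : R) (s : R) : Re (s%:C * dir sg) = s * (sg * m).
Proof. by rewrite cReM /=; ring. Qed.

Lemma Im_dir (sg : R) (s : R) : Im (s%:C * dir sg) = s.
Proof. by rewrite cImM /=; ring. Qed.

Section LinearSolve.
Variables (W : set C) (sg : R) (h : C -> C) (H : R) (z0 : C).
Hypotheses (Wo : open W) (Wc : convexc W) (Wf : forward W) (Wz0 : W z0).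
Hypotheses (sg2 : sg ^+ 2 = 1) (hh : holo W h) (hH : forall z, W z -> normc (h z) <= H).

Let d := dir sg.
(** Sampling times: moving by [d / m] divides the modulus of [cexp (- sg * z)] by [e], so
    convergence along the samples is geometric. *)
Let T (n : nat) : R := n%:R / m.
Let T0 n : 0 <= T n. Proof. by rewrite divr_ge0 // ltW. Qed.
Let H0 : 0 <= H. Proof. by apply: le_trans (normc_ge0 _) (hH Wz0). Qed.

Let sg1 : `|sg| = 1. Proof. exact: sqr1_norm. Qed.

Let k z := cexp (- sg%:C * z) * h z.

Let normk z : W z -> normc (k z) <= expR (- (sg * Re z)) * H.
Proof.
move=> Wz; rewrite normcM normc_cexp.
have -> : Re (- sg%:C * z) = - (sg * Re z) by rewrite cReM /=; ring.
by apply: ler_wpM2l; [exact: expR_ge0|exact: hH].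
Qed.

Let hd_cexpM (a z : C) : hd (fun w => cexp (a * w)) z (a * cexp (a * z)).
Proof.
have D : hd (fun w : C => a * w) z a.
  by have := dvZ (@id_continuous R) a (dv_emb id z); apply: dv_eq; rewrite mulr1.
by have := @hd_comp R (@cexp R) (fun w => a * w) z _ _ (hd_cexp _) D; apply: dv_eq; rewrite mulrC.
Qed.

Let kd : forall z, W z -> z != z0 -> exists l, hd k z l.
Proof.
move=> z Wz _; have [l hl] := hh Wz.
by eexists; apply: (dvM (@id_continuous R) (hd_cexpM _ _) hl).
Qed.

Let kc : {for z0, continuous k}.
Proof.
have [l hl] := hh Wz0.
exact: hd_continuous (dvM (@id_continuous R) (hd_cexpM _ _) hl).
Qed.

Lemma linear_solve : exists p : C -> C, forall z, W z ->
  hd p z (sg%:C * p z + h z) /\ normc (p z) <= 4 * H / m.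
Proof.
have [F Fd] := @convex_primitive R W k z0 Wo Wc Wz0 kc kd.
(* A LEMMA-free view of the limit. *)
have step z z' n : W z -> W z' ->
    normc (F (z' + (T n)%:C * d) - F (z + (T n)%:C * d)) <=
    expR (normc z + normc (z' - z)) * H * normc (z' - z) / 2 ^+ n.
  move=> Wz Wz'.
  have E s : segpt (z + (T n)%:C * d) (z' + (T n)%:C * d) s = segpt z z' s + (T n)%:C * d.
    by rewrite /segpt; ring.
  have Ws s : s \in `[0, 1] -> W (segpt (z + (T n)%:C * d) (z' + (T n)%:C * d) s).
    by move=> s01; rewrite E; apply: Wf => //; exact: Wc.
  have := @hd_lipschitz R F k (z + (T n)%:C * d) (z' + (T n)%:C * d)
    (expR (normc z + normc (z' - z)) * H / 2 ^+ n).
  have -> : z' + (T n)%:C * d - (z + (T n)%:C * d) = z' - z by ring.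
  have -> : expR (normc z + normc (z' - z)) * H * normc (z' - z) / 2 ^+ n =
    expR (normc z + normc (z' - z)) * H / 2 ^+ n * normc (z' - z) by ring.
  apply; first by move=> s s01; apply: Fd; exact: Ws.
  move=> s s01; apply: le_trans (normk (Ws s s01)) _.
  rewrite mulrAC; apply: ler_wpM2r => //.
  have -> : sg * Re (segpt (z + (T n)%:C * d) (z' + (T n)%:C * d) s) =
      sg * Re (segpt z z' s) + n%:R.
    rewrite E cReD Re_dir /T mulrDr; congr (_ + _).
    have -> : sg * (n%:R / m * (sg * m)) = sg ^+ 2 * n%:R by field; rewrite gt_eqF.
    by rewrite sg2 mul1r.
  rewrite opprD expRD; apply: ler_pM; rewrite ?expR_ge0 //; last exact: expRN_geometric.
  rewrite ler_expR; apply: le_trans (ler_norm _) _; rewrite normrN normrM sg1 mul1r.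
  apply: le_trans (normc_Re _) _; apply: le_trans (le_normcD _ _) _.
  apply: lerD => //; rewrite normcM normc_real.
  move: s01; rewrite in_itv /= => /andP[s0 s1].
  by rewrite ger0_norm // ler_piMl ?normc_ge0.
have [L HL] : exists L, forall n, normc (F (z0 + (T n)%:C * d) - L) <=
    4 * (expR (normc z0 + normc ((1 / m)%:C * d)) * H * normc ((1 / m)%:C * d)) / 2 ^+ n.
  apply: geometric_cauchy_complex => n.
  have W1 : W (z0 + (1 / m)%:C * d) by apply: Wf => //; rewrite divr_ge0 // ltW.
  have := step z0 (z0 + (1 / m)%:C * d) n Wz0 W1.
  have -> : z0 + (1 / m)%:C * d + (T n)%:C * d = z0 + (T n.+1)%:C * d.
    by rewrite /T [n.+1%:R]mulrS mulrDl rmorphD; ring.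
  by have -> : z0 + (1 / m)%:C * d - z0 = (1 / m)%:C * d by ring.
exists (fun z => cexp (sg%:C * z) * (F z - L)) => z Wz.
have pd w : W w -> hd (fun z => cexp (sg%:C * z) * (F z - L)) w
    (sg%:C * (cexp (sg%:C * w) * (F w - L)) + h w).
  move=> Ww; have D := dvM (@id_continuous R) (hd_cexpM sg%:C w)
    (dvB (Fd w Ww) (dv_cst id L w)).
  have E0 : cexp (sg%:C * w) * cexp (- sg%:C * w) = 1.
    by rewrite -cexpD mulNr subrr cexp0.
  apply: dv_eq D; rewrite subr0 /k.
  by rewrite [cexp _ * (cexp _ * _)]mulrA E0 mul1r mulrA.
split; first exact: pd.
have sgC : sg%:C * sg%:C = 1 :> C by rewrite -rmorphM -expr2 sg2 rmorph1.
have := @ray_bound R m m0 (fun s => cexp (sg%:C * (z + s%:C * d)) * (F (z + s%:C * d) - L))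
  (fun s => d * h (z + s%:C * d)) (sg%:C * d) (2 * H).
rewrite rmorph0 mul0r addr0 mulrA -natrM; apply.
- by rewrite /d cReM /= mul0r subr0 mulrA -expr2 sg2 mul1r.
- move=> s s0; have Ws : W (z + s%:C * d) by exact: Wf.
  have := rd_comp (pd _ Ws) (rd_affine z d s).
  by apply: dv_eq; ring.
- move=> s s0; rewrite normcM.
  have e1 : 1 <= expR (m / 2 * s) by apply: le_trans (expR_ge1Dx _); rewrite lerDl mulr_ge0 // divr_ge0 // ltW.
  have h1 : normc d * normc (h (z + s%:C * d)) <= 2 * H.
    by apply: ler_pM; rewrite ?normc_ge0 //; [exact: normc_raydir|apply: hH; exact: Wf].
  by apply: le_trans h1 _; rewrite ler_peMr // mulr_ge0.
- move=> e e0.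
  pose K := normc (cexp (sg%:C * z)) * (expR (normc z0 + normc (z - z0)) * H * normc (z - z0) +
     4 * (expR (normc z0 + normc ((1 / m)%:C * d)) * H * normc ((1 / m)%:C * d))).
  have [n nK] := geometric_small K e0; exists (T n) => //.
  have -> : cexp (- ((T n)%:C * (sg%:C * d))) *
     (cexp (sg%:C * (z + (T n)%:C * d)) * (F (z + (T n)%:C * d) - L)) =
     cexp (sg%:C * z) * (F (z + (T n)%:C * d) - L).
    by rewrite mulrA -cexpD; congr (cexp _ * _); ring.
  rewrite normcM; apply: le_trans (ltW nK).
  rewrite /K -[normc (cexp _) * _ / _]mulrA.
  apply: ler_wpM2l; first exact: normc_ge0.
  have -> : F (z + (T n)%:C * d) - L = (F (z + (T n)%:C * d) - F (z0 + (T n)%:C * d)) +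
    (F (z0 + (T n)%:C * d) - L) by ring.
  by apply: le_trans (le_normcD _ _) _; rewrite mulrDl; apply: lerD; [exact: step|exact: HL].
Qed.

End LinearSolve.

Let sq1 : (1 : R) ^+ 2 = 1. Proof. by rewrite expr1n. Qed.
Let sqN1 : (-1 : R) ^+ 2 = 1. Proof. by rewrite sqrrN expr1n. Qed.

Lemma half_bound (a b : C) (A : R) : normc (a + b) <= A -> normc (a - b) <= A ->
  normc a <= A /\ normc b <= A.
Proof.
move=> h1 h2; have n2 : normc (2^-1 : C) = 2^-1 by rewrite normcV normc_nat.
split.
  have -> : a = 2^-1 * ((a + b) + (a - b)) by field; rewrite ?pnatr_eq0.
  by rewrite normcM n2; have := le_normcD (a + b) (a - b); lra.
have -> : b = 2^-1 * ((a + b) - (a - b)) by field; rewrite ?pnatr_eq0.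
by rewrite normcM n2; have := le_normcB (a + b) (a - b); lra.
Qed.

(** With [g = r'], the combinations [g + r] and [g - r] satisfy the first-order equations of signs 1
    and -1. This is why [W] must be invariant under both directions. *)
Lemma second_order_solve (W : set C) (h : C -> C) (H : R) (z0 : C) :
  open W -> convexc W -> forward W -> W z0 -> holo W h ->
  (forall z, W z -> normc (h z) <= H) ->
  exists r g : C -> C, forall z, W z ->
    [/\ hd r z (g z), hd g z (r z + h z), normc (r z) <= 4 * H / m & normc (g z) <= 4 * H / m].
Proof.
move=> Wo Wc Wf Wz0 hh hH.
have [p P1] := linear_solve Wo Wc Wf Wz0 sq1 hh hH.
have [q P2] := linear_solve Wo Wc Wf Wz0 sqN1 hh hH.
exists (fun z => 2^-1 * (p z - q z)), (fun z => 2^-1 * (p z + q z)) => z Wz.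
have [pd pb] := P1 z Wz; have [qd qb] := P2 z Wz.
have n2 : normc (2^-1 : C) = 2^-1 by rewrite normcV normc_nat.
split.
- by apply: dv_eq (dvZ (@id_continuous R) 2^-1 (dvB pd qd)); rewrite rmorphN rmorph1; ring.
- apply: dv_eq (dvZ (@id_continuous R) 2^-1 (dvD pd qd)); rewrite rmorphN rmorph1.
  by field; rewrite ?pnatr_eq0.
- by rewrite normcM n2; have := le_normcB (p z) (q z); lra.
- by rewrite normcM n2; have := le_normcD (p z) (q z); lra.
Qed.

Definition cone (z0 : C) : set C := [set z | `|Re (z - z0)| <= m * Im (z - z0)].

Lemma cone_refl z : cone z z.
Proof. by rewrite /cone /= subrr normr0 mulr0. Qed.

Lemma cone_forward z0 : forward (cone z0).
Proof.
move=> z sg s; rewrite /cone /= => zc sg2 s0.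
have -> : z + s%:C * dir sg - z0 = (z - z0) + s%:C * dir sg by ring.
rewrite cReD Re_dir cImD Im_dir mulrDr; apply: le_trans (ler_normD _ _) _.
apply: lerD => //; rewrite !normrM (ger0_norm s0) (ger0_norm (ltW m0)).
by rewrite (sqr1_norm sg2) mul1r mulrC.
Qed.

Lemma cone_Im z0 z : cone z0 z -> 0 <= Im (z - z0).
Proof.
by rewrite /cone /= => h; have := le_trans (normr_ge0 _) h; rewrite pmulr_rge0.
Qed.

(** The cone is spanned by the directions of signs 1 and -1; [a] and [b] are the nonnegative
    coordinates of [z - z0] in that basis. *)
Lemma forward_cone (W : set C) z0 z : forward W -> W z0 -> cone z0 z -> W z.
Proof.
move=> Wf Wz0 zc; have i0 := cone_Im zc.
pose a := (Im (z - z0) + Re (z - z0) / m) / 2; pose b := (Im (z - z0) - Re (z - z0) / m) / 2.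
have mn : m != 0 by rewrite gt_eqF.
have [r1 r2] : - Im (z - z0) <= Re (z - z0) / m /\ Re (z - z0) / m <= Im (z - z0).
  move: zc; rewrite /cone /= ler_norml => /andP[h1 h2].
  by split; [rewrite ler_pdivlMr //|rewrite ler_pdivrMr //]; lra.
have -> : z = z0 + a%:C * dir 1 + b%:C * dir (-1).
  apply: complex_ext.
    rewrite !cReD !Re_dir /a /b cReD cReN; field.
    exact: mn.
  rewrite !cImD !Im_dir /a /b cImD cImN; field.
  exact: mn.
have W1 : W (z0 + a%:C * dir 1) by apply: (Wf) => //; rewrite divr_ge0 //; lra.
by apply: (Wf) => //; rewrite divr_ge0 //; lra.
Qed.

Lemma cone_normc z0 z : cone z0 z -> normc (z - z0) <= 2 * Im (z - z0).
Proof.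
move=> zc; have i0 := cone_Im zc; apply: le_trans (normc_leD _) _.
rewrite (ger0_norm i0); have := ler_wpM2r i0 m1; rewrite mul1r => h.
by have := zc; rewrite /cone /=; lra.
Qed.

(** The bound [B] serves only to exclude exponentially growing solutions and is absent from the
    conclusion. The forcing may grow like half the rate [m], which leaves room for the weight used
    below. *)
Lemma second_order_bound (r g h : C -> C) (z : C) (A B : R) :
  (forall w, cone z w -> hd r w (g w) /\ hd g w (r w + h w)) ->
  (forall w, cone z w -> normc (r w) <= B /\ normc (g w) <= B) ->
  (forall w, cone z w -> normc (h w) <= A * expR (m / 2 * Im (w - z))) ->
  normc (r z) <= 4 * A / m /\ normc (g z) <= 4 * A / m.
Proof.
move=> rg rgB hA.
have inc sg s : sg ^+ 2 = 1 -> 0 <= s -> cone z (z + s%:C * dir sg).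
  by move=> h1 h2; apply: cone_forward => //; exact: cone_refl.
have hA' sg s : sg ^+ 2 = 1 -> 0 <= s ->
    normc (h (z + s%:C * dir sg)) <= A * expR (m / 2 * s).
  move=> h1 h2; have := hA _ (inc sg s h1 h2).
  have -> : Im (z + s%:C * dir sg - z) = s by rewrite [_ - z]addrC addKr Im_dir.
  exact.
have e1 : normc (g z + r z) <= 4 * A / m.
  apply: (@ray_estimate R m m0 m1 1 (fun w => g w + r w) h z A (B + B) sq1).
  - move=> s s0; have [D1 D2] := rg _ (inc 1 s sq1 s0).
    by apply: dv_eq (dvD D2 D1); rewrite rmorph1; ring.
  - move=> s s0; have [b1 b2] := rgB _ (inc 1 s sq1 s0).
    by apply: le_trans (le_normcD _ _) _; exact: lerD.
  - by move=> s s0; exact: hA'.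
have e2 : normc (g z - r z) <= 4 * A / m.
  apply: (@ray_estimate R m m0 m1 (-1) (fun w => g w - r w) h z A (B + B) sqN1).
  - move=> s s0; have [D1 D2] := rg _ (inc (-1) s sqN1 s0).
    by apply: dv_eq (dvB D2 D1); rewrite rmorphN rmorph1; ring.
  - move=> s s0; have [b1 b2] := rgB _ (inc (-1) s sqN1 s0).
    by apply: le_trans (le_normcB _ _) _; exact: lerD.
  - by move=> s s0; exact: hA'.
by have [h1 h2] := half_bound e1 e2.
Qed.

(* Weighting by [expR (m / 2 * Im (z - z0))] turns the bound into a contraction
   along the whole cone, so that only the value at the apex matters. *)
Lemma contraction_bound (r g h : C -> C) (z0 : C) (H B : R) : 0 <= H ->
  (forall z, cone z0 z -> hd r z (g z) /\ hd g z (r z + h z)) ->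
  (forall z, cone z0 z -> normc (r z) <= B /\ normc (g z) <= B) ->
  (forall z S, cone z0 z -> normc (r z) <= S -> normc (g z) <= S ->
     normc (h z) <= m / 8 * S + H * expR (m / 2 * Im (z - z0))) ->
  normc (r z0) <= 8 * H / m /\ normc (g z0) <= 8 * H / m.
Proof.
move=> H0 rg rgB hS.
have B0 : 0 <= B by apply: le_trans (normc_ge0 _) (rgB z0 (cone_refl z0)).1.
have mn : m != 0 by rewrite gt_eqF.
have Hm : 0 <= 8 * H / m by rewrite divr_ge0 ?mulr_ge0 // ltW.
(* One pass through [second_order_bound] sends a weighted constant [X] to [X / 2 + 4 * H / m], whose
   fixed point is [8 * H / m]. *)
have iter n : forall z, cone z0 z ->
    normc (r z) <= (B / 2 ^+ n + 8 * H / m) * expR (m / 2 * Im (z - z0)) /\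
    normc (g z) <= (B / 2 ^+ n + 8 * H / m) * expR (m / 2 * Im (z - z0)).
  elim: n => [|n IH] z zc.
    have e1 : 1 <= expR (m / 2 * Im (z - z0)).
      apply: le_trans (expR_ge1Dx _); rewrite lerDl mulr_ge0 ?(cone_Im zc) //.
      by rewrite divr_ge0 // ltW.
    have h1 : B <= (B / 2 ^+ 0 + 8 * H / m) * expR (m / 2 * Im (z - z0)).
      rewrite expr0 divr1; apply: le_trans (_ : B + 8 * H / m <= _); first by rewrite lerDl.
      by rewrite ler_peMr // addr_ge0.
    by have [b1 b2] := rgB z zc; split; exact: le_trans h1.
  have := @second_order_bound r g h z
    ((m / 8 * (B / 2 ^+ n + 8 * H / m) + H) * expR (m / 2 * Im (z - z0))) B.
  have -> : 4 * ((m / 8 * (B / 2 ^+ n + 8 * H / m) + H) * expR (m / 2 * Im (z - z0))) / m =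
    (B / 2 ^+ n.+1 + 8 * H / m) * expR (m / 2 * Im (z - z0)).
    have n2 : 2 ^+ n != 0 :> R by rewrite expf_neq0 ?pnatr_eq0.
    by rewrite exprS; field; rewrite mn n2.
  have sub w : cone z w -> cone z0 w.
    rewrite /cone /= => wz; have -> : w - z0 = (w - z) + (z - z0) by ring.
    by rewrite cReD cImD mulrDr; apply: le_trans (ler_normD _ _) _; apply: lerD.
  apply.
  - by move=> w /sub; exact: rg.
  - by move=> w /sub; exact: rgB.
  - move=> w wz; have [b1 b2] := IH w (sub w wz).
    apply: le_trans (hS w _ (sub w wz) b1 b2) _.
    have -> : Im (w - z0) = Im (z - z0) + Im (w - z) by rewrite -cImD; congr Im; ring.
    rewrite mulrDr expRD le_eqVlt; apply/orP; left; apply/eqP; ring.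
have [i1 i2] : (forall n, normc (r z0) <= B / 2 ^+ n + 8 * H / m) /\
    (forall n, normc (g z0) <= B / 2 ^+ n + 8 * H / m).
  by split=> n; have := iter n z0 (cone_refl z0); rewrite subrr mulr0 expR0 mulr1 => -[].
by split; rewrite -subr_le0; apply: (@geometric_le0 _ _ B) => n; rewrite lerBlDr.
Qed.

End SecondOrder.

(** * The nonlinear equation in a small ball *)

Section Boutroux.
Variable R : realType.
Local Notation C := R[i].
Implicit Types (a b z : C) (m : R).

(* With [Y = 1 + f], the equation [f'' = f + bN z f f'] is Boutroux' form
   [Y'' + Y' / z = (Y^2 - 1) / 2 + (4 / 25) Y / z^2] of Painleve I. *)
Definition bN z a b : C := a ^+ 2 / 2 - b / z + 4 / 25 * (1 + a) / z ^+ 2.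

Definition boutroux (W : set C) (f g : C -> C) := forall z, W z ->
  hd f z (g z) /\ hd g z (f z + bN z (f z) (g z)).

Let n2 : normc (2^-1 : C) = 2^-1. Proof. by rewrite normcV normc_nat. Qed.
Let n425 : normc (4 / 25 : C) = 4 / 25. Proof. by rewrite normcM normcV !normc_nat. Qed.

Lemma invz_bound m z : 0 < m -> 16 / m <= normc z ->
  [/\ z != 0, normc z^-1 <= m / 16 & normc (z ^+ 2)^-1 <= m ^+ 2 / 256].
Proof.
move=> m0 zm; have z0 : 0 < normc z by apply: lt_le_trans zm; rewrite divr_gt0.
have h : normc z^-1 <= m / 16.
  by rewrite normcV -[m / 16]invrK invf_div lef_pV2 ?posrE // divr_gt0.
split; [by rewrite -normc_gt0|exact: h|].
rewrite normcV normcX -exprVn -normcV.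
have -> : m ^+ 2 / 256 = (m / 16) ^+ 2 by field.
by rewrite lerXn2r ?nnegrE ?normc_ge0 // divr_ge0 // ltW.
Qed.

(** The target [m ^+ 2 / 128] is what the gain [4 / m] of [second_order_solve] turns back into the
    radius [m / 32]. *)
Lemma bN_le m z a b : 0 < m -> m <= 1 -> 16 / m <= normc z -> normc a <= m / 32 ->
  normc b <= m / 32 -> normc (bN z a b) <= m ^+ 2 / 128.
Proof.
move=> m0 m1 zm am bm; have [z0 z1 z2] := invz_bound m0 zm.
have h1 : normc (a ^+ 2 / 2) <= (m / 32) * (m / 32) / 2.
  rewrite normcM n2 normcX expr2; apply: ler_wpM2r => //.
  by apply: ler_pM; rewrite ?normc_ge0.
have h2 : normc (b / z) <= m / 32 * (m / 16).
  by rewrite normcM; apply: ler_pM; rewrite ?normc_ge0.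
have h3 : normc (4 / 25 * (1 + a) / z ^+ 2) <= 4 / 25 * 2 * (m ^+ 2 / 256).
  rewrite normcM normcM n425; apply: ler_pM => //; rewrite ?mulr_ge0 ?normc_ge0 //.
  by apply: ler_wpM2l => //; apply: le_trans (le_normcD _ _) _; rewrite normc1; lra.
have := le_normcD (a ^+ 2 / 2 - b / z) (4 / 25 * (1 + a) / z ^+ 2).
have := le_normcB (a ^+ 2 / 2) (b / z).
have := mulr_gt0 m0 m0; rewrite /bN expr2 in h3 *; lra.
Qed.

(** The constant [m / 8] becomes 1/2 after the gain [4 / m]. No bound on [b] or [b'] is assumed,
    because [bN] is affine in its last argument. *)
Lemma bN_lip m z a b a' b' (S : R) : 0 < m -> m <= 1 -> 16 / m <= normc z ->
  normc a <= m / 32 -> normc a' <= m / 32 ->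
  normc (a - a') <= S -> normc (b - b') <= S ->
  normc (bN z a b - bN z a' b') <= m / 8 * S.
Proof.
move=> m0 m1 zm am am' aS bS; have [z0 z1 z2] := invz_bound m0 zm.
have S0 : 0 <= S by apply: le_trans aS; exact: normc_ge0.
have -> : bN z a b - bN z a' b' = (a + a') / 2 * (a - a') - z^-1 * (b - b') +
    4 / 25 * (z ^+ 2)^-1 * (a - a') by rewrite /bN; ring.
have h1 : normc ((a + a') / 2 * (a - a')) <= (m / 32) * S.
  rewrite normcM; apply: ler_pM; rewrite ?normc_ge0 // normcM n2.
  by have := le_normcD a a'; lra.
have h2 : normc (z^-1 * (b - b')) <= m / 16 * S.
  by rewrite normcM; apply: ler_pM; rewrite ?normc_ge0.
have h3 : normc (4 / 25 * (z ^+ 2)^-1 * (a - a')) <= 4 / 25 * (m ^+ 2 / 256) * S.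
  rewrite normcM; apply: ler_pM; rewrite ?normc_ge0 // normcM n425.
  by apply: ler_wpM2l.
have h4 : m ^+ 2 * S <= m * S.
  by apply: ler_wpM2r => //; rewrite expr2 ler_piMl // ltW.
have := le_normcD ((a + a') / 2 * (a - a') - z^-1 * (b - b')) (4 / 25 * (z ^+ 2)^-1 * (a - a')).
have := le_normcB ((a + a') / 2 * (a - a')) (z^-1 * (b - b')).
have := mulr_ge0 (ltW m0) S0; lra.
Qed.

Lemma hd_bN (f g : C -> C) z l k : z != 0 -> hd f z l -> hd g z k ->
  exists n, hd (fun w => bN w (f w) (g w)) z n.
Proof.
move=> z0 fl gk; have ic := @id_continuous R.
have D1 := @hd_comp R (fun w => w ^+ 2) f z _ _ (hdX 2 (f z)) fl.
have D2 := dvM ic D1 (dv_cst id 2^-1 z).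
have DV := dvV ic (dv_emb id z) z0.
have D3 := dvM ic gk DV.
have DX : hd (fun w : C => (w ^+ 2)^-1) z (- (2%:R * z ^+ 1) / (z ^+ 2) ^+ 2).
  by apply: (dvV ic (hdX 2 z)); rewrite expf_neq0.
have D4 := dvM ic (dvZ ic (4 / 25) (dvD (dv_cst id 1 z) fl)) DX.
by eexists; exact: (dvD (dvB D2 D3) D4).
Qed.

Section Existence.
Variables (m : R) (W : set C) (z0 : C).
Hypotheses (m0 : 0 < m) (m1 : m <= 1) (Wo : open W) (Wc : convexc W) (Wf : forward m W).
Hypotheses (Wz0 : W z0) (Wm : forall z, W z -> 16 / m <= normc z).

Let good (x : (C -> C) * (C -> C)) :=
  [/\ holo W x.1, holo W x.2 & forall z, W z -> normc (x.1 z) <= m / 32 /\ normc (x.2 z) <= m / 32].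

Let next (x y : (C -> C) * (C -> C)) := forall z, W z ->
  hd y.1 z (y.2 z) /\ hd y.2 z (y.1 z + bN z (x.1 z) (x.2 z)).

Let step x : exists y, good x -> good y /\ next x y.
Proof.
have [[h1 h2 h3]|ng] := pselect (good x); last by exists x => /ng.
have hN : holo W (fun z => bN z (x.1 z) (x.2 z)).
  move=> z Wz; have [l fl] := h1 z Wz; have [k gk] := h2 z Wz.
  by have [zn _ _] := invz_bound m0 (Wm Wz); exact: hd_bN zn fl gk.
have bd z : W z -> normc (bN z (x.1 z) (x.2 z)) <= m ^+ 2 / 128.
  by move=> Wz; have [b1 b2] := h3 z Wz; apply: bN_le => //; exact: Wm.
have [f [g H]] := second_order_solve m0 m1 Wo Wc Wf Wz0 hN bd.
have E : 4 * (m ^+ 2 / 128) / m = m / 32 by field; rewrite gt_eqF.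
exists (f, g) => _; split; last by move=> z Wz; have [] := H z Wz.
split => [z Wz|z Wz|z Wz]; have [d1 d2 b1 b2] := H z Wz.
- by eexists; exact: d1.
- by eexists; exact: d2.
- by rewrite E in b1 b2.
Qed.

(** Picard iteration from 0: [bN_le] keeps the iterates in the ball of radius [m / 32] and [bN_lip]
    halves successive differences. Values and derivatives converge at the same rate, so
    [uniform_limit_hd] passes the equation to the limit. *)
Lemma boutroux_exists : exists f g : C -> C, boutroux W f g /\
  forall z, W z -> normc (f z) <= m / 32 /\ normc (g z) <= m / 32.
Proof.
have [F FP] := choice step.
pose x n := iter n F (fun=> 0, fun=> 0).
have xg n : good (x n).
  elim: n => [|n IH]; last by have [] := FP _ IH.
  split=> [z _|z _|z _]; [by exists 0; exact: dv_cst|by exists 0; exact: dv_cst|].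
  by rewrite -[(x 0%N).1 _]/(0 : C) -[(x 0%N).2 _]/(0 : C) normc0 divr_ge0 // ltW.
have xn n : next (x n) (x n.+1) by have [] := FP _ (xg n).
have d32 : 0 <= m / 32 by rewrite divr_ge0 // ltW.
have dif n : forall z, W z -> normc ((x n.+1).1 z - (x n).1 z) <= m / 16 / 2 ^+ n /\
    normc ((x n.+1).2 z - (x n).2 z) <= m / 16 / 2 ^+ n.
  elim: n => [|n IH] z Wz.
    have [_ _ h1] := xg 1%N; have [a1 a2] := h1 z Wz.
    by rewrite /= !subr0 expr0 divr1; split; [apply: le_trans a1 _|apply: le_trans a2 _]; lra.
  have E : 4 * (m / 8 * (m / 16 / 2 ^+ n)) / m = m / 16 / 2 ^+ n.+1.
    by rewrite exprS; field; rewrite expf_neq0 ?pnatr_eq0 // gt_eqF.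
  have := @second_order_bound R m m0 m1 (fun z => (x n.+2).1 z - (x n.+1).1 z)
    (fun z => (x n.+2).2 z - (x n.+1).2 z)
    (fun z => bN z ((x n.+1).1 z) ((x n.+1).2 z) - bN z ((x n).1 z) ((x n).2 z)) z
    (m / 8 * (m / 16 / 2 ^+ n)) (m / 16).
  rewrite E; apply.
  - move=> w wz; have Ww : W w by exact: forward_cone wz.
    have [d1 d2] := xn n.+1 w Ww; have [d3 d4] := xn n w Ww.
    split; first exact: dvB.
    by apply: dv_eq (dvB d2 d4); ring.
  - move=> w wz; have Ww : W w by exact: forward_cone wz.
    have [_ _ h1] := xg n.+2; have [a1 a2] := h1 w Ww.
    have [_ _ h2] := xg n.+1; have [a3 a4] := h2 w Ww.
    by split; apply: le_trans (le_normcB _ _) _; lra.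
  - move=> w wz; have Ww : W w by exact: forward_cone wz.
    have [b1 b2] := IH w Ww.
    have [_ _ h1] := xg n.+1; have [a1 a2] := h1 w Ww.
    have [_ _ h2] := xg n; have [a3 a4] := h2 w Ww.
    apply: le_trans (bN_lip m0 m1 (Wm Ww) a1 a3 b1 b2) _.
    rewrite ler_peMr //.
      by rewrite !mulr_ge0 ?invr_ge0 ?exprn_ge0 // ltW.
    apply: le_trans (expR_ge1Dx _); rewrite lerDl mulr_ge0 ?(cone_Im m0 wz) //.
    by rewrite divr_ge0 // ltW.
have lim (p : (C -> C) * (C -> C) -> C -> C) :
    (forall n z, W z -> normc (p (x n.+1) z - p (x n) z) <= m / 16 / 2 ^+ n) ->
    exists f : C -> C, forall n z, W z -> normc (p (x n) z - f z) <= 4 * (m / 16) / 2 ^+ n.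
  move=> H; have L z : exists l, W z -> forall n, normc (p (x n) z - l) <= 4 * (m / 16) / 2 ^+ n.
    have [Wz|nW] := pselect (W z); last by exists 0 => /nW.
    have [l Hl] := geometric_cauchy_complex (fun n => H n z Wz).
    by exists l.
  by have [f Hf] := choice L; exists f => n z Wz; exact: Hf.
have [f fL] := lim (fun y => y.1) (fun n z Wz => (dif n z Wz).1).
have [g gL] := lim (fun y => y.2) (fun n z Wz => (dif n z Wz).2).
have fgb z : W z -> normc (f z) <= m / 32 /\ normc (g z) <= m / 32.
  move=> Wz; split; rewrite -subr_le0; apply: (@geometric_le0 _ _ (4 * (m / 16))) => n.
    have [_ _ h1] := xg n; have [a1 a2] := h1 z Wz.
    have := fL n z Wz; have := lerB_normc (f z) ((x n).1 z); rewrite normcB; lra.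
  have [_ _ h1] := xg n; have [a1 a2] := h1 z Wz.
  have := gL n z Wz; have := lerB_normc (g z) ((x n).2 z); rewrite normcB; lra.
exists f, g; split; last exact: fgb.
move=> z Wz; split.
  apply: (@uniform_limit_hd R W (fun n => (x n.+1).1) (fun n => (x n.+1).2) f g
    (4 * (m / 16)) Wo) => //.
  - by move=> n w Ww; have [] := xn n w Ww.
  - move=> n w Ww; apply: le_trans (fL n.+1 w Ww) _.
    apply: ler_wpM2l; first by rewrite mulr_ge0 // divr_ge0 // ltW.
    by rewrite lef_pV2 ?posrE ?exprn_gt0 // ler_weXn2l // ler1n.
  - move=> n w Ww; apply: le_trans (gL n.+1 w Ww) _.
    apply: ler_wpM2l; first by rewrite mulr_ge0 // divr_ge0 // ltW.
    by rewrite lef_pV2 ?posrE ?exprn_gt0 // ler_weXn2l // ler1n.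
apply: (@uniform_limit_hd R W (fun n => (x n.+1).2)
  (fun n z => (x n.+1).1 z + bN z ((x n).1 z) ((x n).2 z)) g
  (fun z => f z + bN z (f z) (g z)) (8 * (m / 16)) Wo) => //.
- by move=> n w Ww; have [] := xn n w Ww.
- move=> n w Ww; apply: le_trans (gL n.+1 w Ww) _; rewrite exprS.
  have : 0 <= m / 16 / 2 ^+ n by rewrite !mulr_ge0 ?invr_ge0 ?exprn_ge0 // ltW.
  by rewrite invfM; lra.
- move=> n w Ww.
  have -> : (x n.+1).1 w + bN w ((x n).1 w) ((x n).2 w) - (f w + bN w (f w) (g w)) =
    ((x n.+1).1 w - f w) + (bN w ((x n).1 w) ((x n).2 w) - bN w (f w) (g w)) by ring.
  apply: le_trans (le_normcD _ _) _.
  have [_ _ h1] := xg n; have [a1 a2] := h1 w Ww; have [b1 b2] := fgb w Ww.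
  have := bN_lip m0 m1 (Wm Ww) a1 b1 (fL n w Ww) (gL n w Ww).
  have := fL n.+1 w Ww; rewrite exprS invfM.
  have q0 : 0 <= m / 16 / 2 ^+ n by rewrite !mulr_ge0 ?invr_ge0 ?exprn_ge0 // ltW.
  have := ler_wpM2r q0 m1; move: (normc _) (normc _) => u v.
  have -> : 4 * (m / 16) * (2^-1 / 2 ^+ n) = 2 * (m / 16 / 2 ^+ n) by field; rewrite expf_neq0 ?pnatr_eq0.
  have -> : 4 * (m / 16) / 2 ^+ n = 4 * (m / 16 / 2 ^+ n) by ring.
  have -> : 8 * (m / 16) / 2 ^+ n = 8 * (m / 16 / 2 ^+ n) by ring.
  by move: (m / 16 / 2 ^+ n) q0 => q q0; lra.
Qed.

End Existence.

(** The difference of two solutions satisfies the contraction with [H = 0]. Smallness is asked of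
    [f] and [f'] only; for the derivatives any common bound suffices, as [bN] is affine in them. *)
Lemma boutroux_unique m (z0 : C) (f g f' g' : C -> C) : 0 < m -> m <= 1 ->
  boutroux (cone m z0) f g -> boutroux (cone m z0) f' g' ->
  (forall z, cone m z0 z -> [/\ 16 / m <= normc z, normc (f z) <= m / 32 &
     normc (f' z) <= m / 32]) ->
  (exists B, forall z, cone m z0 z -> normc (g z) <= B /\ normc (g' z) <= B) ->
  f z0 = f' z0 /\ g z0 = g' z0.
Proof.
move=> m0 m1 fg fg' bd [B gB].
have d32 : 0 <= m / 32 by rewrite divr_ge0 // ltW.
have B0 : 0 <= B by apply: le_trans (gB z0 (cone_refl _ _)).1; exact: normc_ge0.
have := @contraction_bound R m m0 m1 (fun z => f z - f' z) (fun z => g z - g' z)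
  (fun z => bN z (f z) (g z) - bN z (f' z) (g' z)) z0 0 (m / 32 + m / 32 + B + B) (lexx 0).
rewrite mulr0 mul0r => H; have {H} [] := H.
- move=> z zc; have [d1 d2] := fg z zc; have [d3 d4] := fg' z zc; split; first exact: dvB.
  by apply: dv_eq (dvB d2 d4); ring.
- move=> z zc; have [b0 b1 b2] := bd z zc; have [b3 b4] := gB z zc.
  by split; apply: le_trans (le_normcB _ _) _; lra.
- move=> z S zc s1 s2; have [b0 b1 b2] := bd z zc.
  by rewrite mul0r addr0; exact: bN_lip.
move=> e1 e2; split; apply/eqP; rewrite -subr_eq0 -normc_eq0; apply/eqP/le_anti.
  by rewrite e1 normc_ge0.
by rewrite e2 normc_ge0.
Qed.

End Boutroux.

(** * Gluing the solutions over all half-planes *)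

Section HalfPlanes.
Variable R : realType.
Local Notation C := R[i].
Implicit Types (z w : C) (m e : R).

(** The threshold is [2 * (16 / m)]: the level [e * Re z + m * Im z] is at most [2 * normc z], and
    the estimates on [bN] need [normc z >= 16 / m]. *)
Definition hp m e : set C := [set z | 32 / m < e * Re z + m * Im z].

Lemma hp_level_le m e z : 0 < m -> m <= 1 -> e ^+ 2 = 1 -> e * Re z + m * Im z <= 2 * normc z.
Proof.
move=> m0 m1 e2; have h1 := normc_Re z; have h2 := normc_Im z.
have h3 : e * Re z <= `|Re z|.
  by apply: le_trans (ler_norm _) _; rewrite normrM (sqr1_norm e2) mul1r.
have h4 : m * Im z <= `|Im z|.
  apply: le_trans (ler_norm _) _; rewrite normrM ger0_norm ?(ltW m0) //.
  by rewrite ler_piMl.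
lra.
Qed.

(** Admitting a cone narrower than the slope of the half-plane is what allows half-planes of
    different slopes to be compared along one common cone. *)
Lemma hp_level_forward m m' e z w : 0 < m' -> m' <= m -> e ^+ 2 = 1 -> cone m' z w ->
  e * Re z + m * Im z <= e * Re w + m * Im w.
Proof.
move=> m0 mm e2 zw; have i0 := cone_Im m0 zw.
have : - (e * Re (w - z)) <= m * Im (w - z).
  apply: le_trans (ler_norm _) _; rewrite normrN normrM (sqr1_norm e2) mul1r.
  by apply: le_trans zw _; exact: ler_wpM2r.
rewrite cReD cReN cImD cImN; lra.
Qed.

Lemma hp_norm m e z : 0 < m -> m <= 1 -> e ^+ 2 = 1 -> hp m e z -> 16 / m <= normc z.
Proof.
move=> m0 m1 e2 zh; have := hp_level_le z m0 m1 e2; have := zh; rewrite /hp /=.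
have -> : 32 / m = 2 * (16 / m) by ring.
lra.
Qed.

Lemma open_hp m e : 0 < m -> m <= 1 -> e ^+ 2 = 1 -> open (hp m e).
Proof.
move=> m0 m1 e2; rewrite openE => z zh; apply/nbhs_normcP.
exists ((e * Re z + m * Im z - 32 / m) / 2); first by rewrite divr_gt0 // subr_gt0.
move=> w wz; rewrite /hp /=.
have := hp_level_le (z - w) m0 m1 e2; rewrite normcB cReD cReN cImD cImN.
by have := zh; rewrite /hp /=; lra.
Qed.

Lemma convexc_hp m e : convexc (hp m e).
Proof.
move=> a b s ah bh s01; rewrite /hp /= Re_segpt Im_segpt.
have -> : e * ((1 - s) * Re a + s * Re b) + m * ((1 - s) * Im a + s * Im b) =
  (1 - s) * (e * Re a + m * Im a) + s * (e * Re b + m * Im b) by ring.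
exact: lt_convex.
Qed.

Lemma forward_hp m m' e : 0 < m' -> m' <= m -> e ^+ 2 = 1 -> forward m' (hp m e).
Proof.
move=> m0 mm e2 z sg s zh sg2 s0.
have : cone m' z (z + s%:C * raydir m' sg) by apply: cone_forward => //; exact: cone_refl.
by move=> /(hp_level_forward m0 mm e2); exact: lt_le_trans.
Qed.

(** Going up the cone can bring [z] closer to the origin, but by at most [2 * Im (z - z0)]; for
    [normc z >= 4 * n / m] the weight absorbs the loss. This converts a forcing of size
    [normc z ^- n] into the weighted form that [contraction_bound] accepts. *)
Lemma cone_weight m z0 z n : 0 < m -> m <= 1 -> cone m z0 z -> 0 < normc z ->
  4 * n%:R / m <= normc z ->
  normc z0 ^+ n <= normc z ^+ n * expR (m / 2 * Im (z - z0)).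
Proof.
move=> m0 m1 zc z0p zn; have i0 := cone_Im m0 zc.
have h1 : normc z0 <= normc z * (1 + 2 * Im (z - z0) / normc z).
  have -> : normc z * (1 + 2 * Im (z - z0) / normc z) = normc z + 2 * Im (z - z0).
    by field; rewrite gt_eqF.
  have := le_normcB z (z - z0); rewrite opprB [z + _]addrCA subrr addr0.
  by have := cone_normc m0 m1 zc; lra.
have h2 := le_trans h1 (ler_wpM2l (ltW z0p) (expR_ge1Dx (2 * Im (z - z0) / normc z))).
apply: le_trans (_ : (normc z * expR (2 * Im (z - z0) / normc z)) ^+ n <= _).
  by rewrite lerXn2r ?nnegrE ?normc_ge0 // mulr_ge0 ?expR_ge0 // normc_ge0.
rewrite exprMn; apply: ler_wpM2l; first by rewrite exprn_ge0 // normc_ge0.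
rewrite -expRM_natl ler_expR.
have -> : n%:R * (2 * Im (z - z0) / normc z) = (2 * n%:R / normc z) * Im (z - z0) by ring.
apply: ler_wpM2r => //; rewrite ler_pdivrMr //.
move: zn; rewrite ler_pdivrMr // => zn; lra.
Qed.

(** The forcing left at [f = g = 0] is [bN z 0 0 = 4 / 25 / z ^+ 2], and the contraction transmits
    this order of decay to the solution. *)
Lemma boutroux_decay m z0 (f g : C -> C) : 0 < m -> m <= 1 ->
  boutroux (cone m z0) f g ->
  (forall z, cone m z0 z -> [/\ 16 / m <= normc z, normc (f z) <= m / 32 &
     normc (g z) <= m / 32]) ->
  normc (f z0) <= 2 / m / normc z0 ^+ 2 /\ normc (g z0) <= 2 / m / normc z0 ^+ 2.
Proof.
move=> m0 m1 fg bd; have d32 : 0 <= m / 32 by rewrite divr_ge0 // ltW.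
have n425 : normc (4 / 25 : C) = 4 / 25 by rewrite normcM normcV !normc_nat.
have zp z : cone m z0 z -> 0 < normc z.
  by move=> zc; have [h _ _] := bd z zc; apply: lt_le_trans h; rewrite divr_gt0.
have z0p := zp z0 (cone_refl _ _).
have z02 : 0 < normc z0 ^+ 2 by rewrite exprn_gt0.
pose H := 4 / 25 / normc z0 ^+ 2.
have H0 : 0 <= H by rewrite divr_ge0 // ltW.
have := @contraction_bound R m m0 m1 f g (fun z => bN z (f z) (g z)) z0 H (m / 32) H0 fg.
move=> HC; have {HC} [] := HC.
- by move=> z zc; have [_ b1 b2] := bd z zc.
- move=> z S zc fS gS; have [b0 b1 b2] := bd z zc.
  have := @bN_lip R m z (f z) (g z) 0 0 S m0 m1 b0 b1; rewrite normc0 !subr0.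
  move=> /(_ d32 fS gS) L.
  have -> : bN z (f z) (g z) = (bN z (f z) (g z) - bN z 0 0) + bN z 0 0 by ring.
  apply: le_trans (le_normcD _ _) _; apply: lerD => //.
  have -> : bN z 0 0 = 4 / 25 / z ^+ 2 by rewrite /bN; ring.
  rewrite normcM n425 normcV normcX /H -[leRHS]mulrA; apply: ler_wpM2l => //.
  have zz := zp z zc; have z2 : 0 < normc z ^+ 2 by rewrite exprn_gt0.
  have w : 4 * 2%:R / m <= normc z.
    by apply: le_trans b0; rewrite -natrM ler_pM2r ?invr_gt0 // ler_nat.
  have cw := cone_weight m0 m1 zc zz w.
  by rewrite -(ler_pM2l z02) mulVKf ?gt_eqF // ler_pdivrMr // [_ * normc z ^+ 2]mulrC.
move=> e1 e2; have E : 8 * H / m <= 2 / m / normc z0 ^+ 2.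
  have -> : 8 * H / m = (32 / 25) * (m^-1 / normc z0 ^+ 2) by rewrite /H; ring.
  have -> : 2 / m / normc z0 ^+ 2 = 2 * (m^-1 / normc z0 ^+ 2) by ring.
  apply: ler_wpM2r; last by lra.
  by rewrite mulr_ge0 ?invr_ge0 // ltW.
by split; [exact: le_trans e1 E|exact: le_trans e2 E].
Qed.

Theorem boutroux_global : exists f g : C -> C, forall m e, 0 < m -> m <= 1 -> e ^+ 2 = 1 ->
  boutroux (hp m e) f g /\
  forall z, hp m e z -> normc (f z) <= m / 32 /\ normc (g z) <= m / 32.
Proof.
pose ok (p : R * R) := [/\ 0 < p.1, p.1 <= 1 & p.2 ^+ 2 = 1].
have ex (p : R * R) : exists fg : (C -> C) * (C -> C), ok p ->
   boutroux (hp p.1 p.2) fg.1 fg.2 /\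
   forall z, hp p.1 p.2 z -> normc (fg.1 z) <= p.1 / 32 /\ normc (fg.2 z) <= p.1 / 32.
  have [[m0 m1 e2]|no] := pselect (ok p); last by exists (id, id) => /no.
  have hz : hp p.1 p.2 (0 +i* (33 / p.1 ^+ 2)).
    rewrite /hp /= mulr0 add0r.
    have -> : p.1 * (33 / p.1 ^+ 2) = 33 / p.1 by field; rewrite gt_eqF.
    by rewrite ltr_pM2r ?invr_gt0 // ltr_nat.
  have [f [g H]] := boutroux_exists m0 m1 (open_hp m0 m1 e2) (@convexc_hp p.1 p.2)
    (forward_hp m0 (lexx _) e2) hz (fun z => hp_norm m0 m1 e2).
  by exists (f, g).
have [F FP] := choice ex.
have glue' p p' z : ok p -> ok p' -> p.1 <= p'.1 -> hp p.1 p.2 z -> hp p'.1 p'.2 z ->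
    (F p).1 z = (F p').1 z /\ (F p).2 z = (F p').2 z.
  move=> okp okp' pp zp zp'; have [m0 m1 e2] := okp; have [m0' m1' e2'] := okp'.
  have [S1 B1] := FP p okp; have [S2 B2] := FP p' okp'.
  have i1 w : cone p.1 z w -> hp p.1 p.2 w.
    by move=> /(hp_level_forward m0 (lexx _) e2); exact: lt_le_trans.
  have i2 w : cone p.1 z w -> hp p'.1 p'.2 w.
    by move=> /(hp_level_forward m0 pp e2'); exact: lt_le_trans.
  (* Uniqueness at the smaller slope [p.1] requires [p.1 / 32], while the solution of slope [p'.1]
     is only known to be below [p'.1 / 32]. Its quadratic decay closes the gap, since
     [normc w >= 16 / p.1] on the cone. *)
  have dec w : cone p.1 z w -> normc ((F p').1 w) <= p.1 / 32.
    move=> wc; have wn := hp_norm m0 m1 e2 (i1 w wc).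
    have sub v : cone p'.1 w v -> hp p'.1 p'.2 v.
      by move=> /(hp_level_forward m0' (lexx _) e2'); apply: lt_le_trans; exact: i2.
    have [|v vc|h _] := @boutroux_decay p'.1 w (F p').1 (F p').2 m0' m1'.
    - by move=> v /sub; exact: S2.
    - by have vh := sub v vc; have [b1 b2] := B2 v vh; split => //; exact: hp_norm vh.
    apply: le_trans h _.
    have wp : 0 < normc w by apply: lt_le_trans wn; rewrite divr_gt0.
    have q : (normc w ^+ 2)^-1 <= (p.1 / 16) ^+ 2.
      rewrite -exprVn lerXn2r ?nnegrE ?invr_ge0 ?normc_ge0 ?divr_ge0 ?(ltW m0) //.
      by rewrite -[p.1 / 16]invrK invf_div lef_pV2 ?posrE // divr_gt0.
    have q2 : 2 / p'.1 <= 2 / p.1 by rewrite ler_pM2l // lef_pV2.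
    have q3 : 0 <= 2 / p'.1 by rewrite divr_ge0 // ltW.
    have q4 : 0 <= (normc w ^+ 2)^-1 by rewrite invr_ge0 exprn_ge0 // normc_ge0.
    apply: le_trans (ler_pM q3 q4 q2 q) _.
    have -> : 2 / p.1 * (p.1 / 16) ^+ 2 = p.1 / 128 by field; rewrite gt_eqF.
    lra.
  apply: (@boutroux_unique R p.1 z) => //.
  - by move=> w /i1; exact: S1.
  - by move=> w /i2; exact: S2.
  - move=> w wc; have [b1 _] := B1 w (i1 w wc); split=> //; last exact: dec.
    exact: hp_norm (i1 w wc).
  - exists (p.1 / 32 + p'.1 / 32) => w wc.
    have [_ b1] := B1 w (i1 w wc); have [_ b2] := B2 w (i2 w wc).
    by split; lra.
have glue p p' z : ok p -> ok p' -> hp p.1 p.2 z -> hp p'.1 p'.2 z ->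
    (F p).1 z = (F p').1 z /\ (F p).2 z = (F p').2 z.
  move=> okp okp' zp zp'; have [pp|/ltW pp] := leP p.1 p'.1; first exact: glue'.
  by have [-> ->] := glue' p' p z okp' okp pp zp' zp.
(* Each point selects some half-plane containing it; the pair [(1, 1)] is a dummy for points in
   none. By [glue] the selection does not affect the value. *)
have exsel z : exists p, (exists p, ok p /\ hp p.1 p.2 z) -> ok p /\ hp p.1 p.2 z.
  have [[p H]|no] := pselect (exists p, ok p /\ hp p.1 p.2 z); first by exists p.
  by exists (1, 1) => /no.
have [sel selP] := choice exsel.
exists (fun z => (F (sel z)).1 z), (fun z => (F (sel z)).2 z) => m e m0 m1 e2.
have okp : ok (m, e) by split.
have E z : hp m e z -> (F (sel z)).1 z = (F (m, e)).1 z /\ (F (sel z)).2 z = (F (m, e)).2 z.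
  move=> zh; have [ok' h'] := selP z (ex_intro _ (m, e) (conj okp zh)).
  exact: glue.
have [S B] := FP (m, e) okp.
split; last by move=> z zh; have [-> ->] := E z zh; exact: B.
move=> z zh; have [E1 E2] := E z zh; have [d1 d2] := S z zh.
have N : \forall w \near z, hp m e w by apply: (open_nbhs_nbhs (conj (open_hp m0 m1 e2) zh)).
rewrite E1 E2; split.
  by apply: near_hd d1; apply: filterS N => w /E [].
by apply: near_hd d2; apply: filterS N => w /E [].
Qed.

End HalfPlanes.

(** * The formal solution and Gevrey estimates *)

Section Series.
Variable R : realType.
Local Notation C := R[i].
Implicit Types (z w : C) (m e : R).

(** A new coefficient depends on all earlier ones, so the sequence is grown as a list. The last case
    solves the coefficient of [z^-(n+2)] in Boutroux' equation, where [Y'' + Y' / z] contributes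
    [n^2 y_n]. *)
Definition ynext (s : seq R) : R :=
  match size s with
  | 0 => 1
  | 1 => 0
  | n.+2 => (n%:R ^+ 2 - 4 / 25) * s`_n - (\sum_(i < n.+1) s`_i.+1 * s`_(n.+1 - i)) / 2
  end.

Definition yseq n : seq R := iter n (fun s => rcons s (ynext s)) [::].

(* The coefficients of the formal solution [1 + sum_(k >= 1) y_k z^-k] of the
   Boutroux equation. *)
Definition ycoef n : R := (yseq n.+1)`_n.

Lemma size_yseq n : size (yseq n) = n.
Proof. by elim: n => //= n IH; rewrite size_rcons IH. Qed.

Lemma nth_yseq n k : (k < n)%N -> (yseq n)`_k = ycoef k.
Proof.
elim: n => // n IH; rewrite ltnS leq_eqVlt => /orP[/eqP -> //|kn].
by rewrite /= nth_rcons size_yseq kn IH.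
Qed.

Lemma ycoef_next n : ycoef n = ynext (yseq n).
Proof. by rewrite /ycoef /= nth_rcons size_yseq ltnn eqxx. Qed.

Lemma ycoef0 : ycoef 0 = 1. Proof. by rewrite ycoef_next. Qed.
Lemma ycoef1 : ycoef 1 = 0. Proof. by rewrite ycoef_next. Qed.

Lemma ycoefS n : ycoef n.+2 = (n%:R ^+ 2 - 4 / 25) * ycoef n -
  (\sum_(i < n.+1) ycoef i.+1 * ycoef (n.+1 - i)) / 2.
Proof.
rewrite ycoef_next /ynext size_yseq nth_yseq ?leqnSn //; congr (_ - _ / 2).
by apply: eq_bigr => i _; rewrite !nth_yseq ?ltnS ?leq_subr //; case: i => i /= ii; exact: ii.
Qed.

(** Each product in the convolution falls one index short of the target factorial; this pays for the
    number of terms in the sum. *)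
Lemma fact_mul_le a b : (a.+1`! * b.+1`! <= (a + b).+1`!)%N.
Proof.
elim: b => [|b IH]; first by rewrite muln1 addn0.
rewrite [b.+2`!]factS mulnCA addnS [(_).+2`!]factS; apply: leq_mul => //.
by rewrite !ltnS leq_addl.
Qed.

Lemma ycoef_factor_bound n :
  (forall k, (k.+1 <= n)%N -> `|ycoef k.+1| <= k.+1`!%:R * 2 ^+ k.+1 / 2) ->
  `|(n%:R ^+ 2 - 4 / 25) * ycoef n| <= n.+1%:R * n.+1`!%:R * 2 ^+ n.
Proof.
move=> IH.
have yn : `|ycoef n| <= n`!%:R * 2 ^+ n.
  case: n IH => [_|n IH]; first by rewrite ycoef0 normr1 mul1r.
  apply: le_trans (IH n _) _ => //.
  by rewrite ler_pdivrMr // ler_peMr ?ler1n // mulr_ge0 // exprn_ge0.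
rewrite normrM.
have -> : n.+1%:R * n.+1`!%:R * 2 ^+ n = n.+1%:R ^+ 2 * (n`!%:R * 2 ^+ n) :> R.
  by rewrite factS natrM; ring.
apply: ler_pM => //.
have n0 : 0 <= n%:R :> R by [].
rewrite -[n.+1%:R]natr1 ler_norml; apply/andP; split; move: (n%:R : R) n0 => x x0;
  have := mulr_ge0 x0 x0; rewrite !expr2 => x2; lra.
Qed.

(** The extra 1/2 becomes 1/4 in the products of the convolution, and this closes the induction: the
    linear and quadratic parts add up to at most [3 / 2] of [(n+1) (n+1)! 2^n], against
    [2 (n+2) (n+1)! 2^n] available. *)
Lemma ycoef_bound n : `|ycoef n.+1| <= n.+1`!%:R * 2 ^+ n.+1 / 2.
Proof.
elim/ltn_ind: n => -[|n] IH.
  by rewrite ycoef1 normr0 divr_ge0 // mulr_ge0 // exprn_ge0.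
have h1 := ycoef_factor_bound (fun k kn => IH k (ltnW kn)).
have h2 : `|\sum_(i < n.+1) ycoef i.+1 * ycoef (n.+1 - i)| <=
    n.+1%:R * (n.+1`!%:R * 2 ^+ n).
  have -> : n.+1%:R * (n.+1`!%:R * 2 ^+ n) = \sum_(i < n.+1) (n.+1`!%:R * 2 ^+ n) :> R.
    by rewrite sumr_const card_ord mulr_natl.
  apply: le_trans (ler_norm_sum _ _ _) _; apply: ler_sum => i _.
  have iN := ltn_ord i.
  have E : (n.+1 - i)%N = (n - i).+1 by rewrite subSn // -ltnS.
  have b1 := IH i iN.
  have b2 := IH (n - i)%N (leq_ltn_trans (leq_subr _ _) (ltnSn _)).
  rewrite normrM E; apply: le_trans (ler_pM (normr_ge0 _) (normr_ge0 _) b1 b2) _.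
  have -> : i.+1`!%:R * 2 ^+ i.+1 / 2 * ((n - i).+1`!%:R * 2 ^+ (n - i).+1 / 2) =
      (i.+1`! * (n - i).+1`!)%:R * 2 ^+ n :> R.
    have -> : 2 ^+ n = 2 ^+ i * 2 ^+ (n - i) :> R by rewrite -exprD subnKC // -ltnS.
    by rewrite natrM !exprS; field.
  rewrite ler_pM2r ?exprn_gt0 // ler_nat.
  by apply: leq_trans (fact_mul_le _ _) _; rewrite subnKC // -ltnS.
rewrite ycoefS; apply: le_trans (ler_normB _ _) _.
rewrite [`|_ / 2|]normrM (ger0_norm (_ : 0 <= 2^-1)) ?invr_ge0 //.
have E : n.+2`!%:R * 2 ^+ n.+2 / 2 = 2 * (n.+2%:R * (n.+1`!%:R * 2 ^+ n)) :> R.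
  by rewrite [n.+2`!]factS natrM !exprS; field.
rewrite E -[n.+2%:R]natr1 [(_ + 1) * _]mulrDl.
rewrite -mulrA in h1.
have X0 : 0 <= n.+1`!%:R * 2 ^+ n :> R by rewrite mulr_ge0 // exprn_ge0.
have X1 : 0 <= n.+1%:R * (n.+1`!%:R * 2 ^+ n) :> R by rewrite mulr_ge0.
lra.
Qed.

End Series.

(** * The residual of the truncated formal series *)

Section Residual.
Variable R : realType.
Local Notation C := R[i].
Implicit Types (z w x : C) (m e : R).

Definition yC n : C := (ycoef R n)%:C.

Lemma normc_yC n : normc (yC n) = `|ycoef R n|. Proof. exact: normc_real. Qed.

Lemma realCB (a b : R) : (a - b)%:C = a%:C - b%:C :> C. Proof. by rewrite rmorphB. Qed.

Lemma realCM (a b : R) : (a * b)%:C = a%:C * b%:C :> C. Proof. by rewrite rmorphM. Qed.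

Lemma yC_factor n : (n%:R ^+ 2 - 4 / 25) * yC n = ((n%:R ^+ 2 - 4 / 25) * ycoef R n)%:C.
Proof.
rewrite realCM realCB; congr ((_ - _) * _); first by rewrite rmorphXn /= rmorph_nat.
by rewrite realCM fmorphV /= !rmorph_nat.
Qed.

Lemma yC_S n : 2 * yC n.+2 + \sum_(i < n.+1) yC i.+1 * yC (n.+1 - i) =
  2 * ((n%:R ^+ 2 - 4 / 25) * yC n).
Proof.
have -> : \sum_(i < n.+1) yC i.+1 * yC (n.+1 - i) =
    (\sum_(i < n.+1) ycoef R i.+1 * ycoef R (n.+1 - i))%:C.
  by rewrite rmorph_sum; apply: eq_bigr => i _; exact/esym/realCM.
have -> : 2 = (2%:R : R)%:C :> C by rewrite rmorph_nat.
rewrite yC_factor /yC -!realCM -rmorphD; congr (_%:C).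
by rewrite ycoefS; field.
Qed.

(** The square is taken as a product of polynomials. In degrees up to [n + 1] truncation is
    invisible and the recursion evaluates the coefficients; in higher degrees only their factorial
    size matters. *)
Lemma psum_sqr n x : exists a : nat -> C,
  (forall N, (n.+2 <= N)%N -> normc (a N) <= N`!%:R * 2 ^+ N) /\
  (\sum_(k < n.+2) yC k * x ^+ k) ^+ 2 =
    1 + 2 * (\sum_(k < n) (k%:R ^+ 2 - 4 / 25) * yC k * x ^+ k.+2) +
    \sum_(j < n.+2) a (n.+2 + j)%N * x ^+ (n.+2 + j).
Proof.
pose P : {poly C} := \poly_(k < n.+2) yC k.
have PE k : P`_k = if (k < n.+2)%N then yC k else 0 by rewrite coef_poly.
have Pb k : normc P`_k.+1 <= k.+1`!%:R * 2 ^+ k.+1 / 2.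
  rewrite PE; case: ifP => _; first by rewrite normc_yC; exact: ycoef_bound.
  by rewrite normc0 divr_ge0 // mulr_ge0 // exprn_ge0.
exists (fun N => (P * P)`_N); split.
  case=> // N nN; rewrite coefM.
  (* The two end terms vanish because the coefficient of degree [N.+1] is truncated away; the others
     satisfy [fact_mul_le]. Finally [N + 2 <= 4 * (N + 1)] counts the terms. *)
  apply: le_trans (_ : \sum_(i < N.+2) (N`!%:R * 2 ^+ N.+1 / 4) <= _).
    have P0 : P`_N.+1 = 0 by rewrite PE ltnNge nN.
    have nonneg : 0 <= N`!%:R * 2 ^+ N.+1 / 4 :> R.
      by rewrite divr_ge0 // mulr_ge0 // exprn_ge0.
    apply: (big_ind2 (fun (u : C) (v : R) => normc u <= v)).
    - by rewrite normc0.
    - by move=> u1 v1 u2 v2 h1 h2; apply: le_trans (le_normcD _ _) _; exact: lerD.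
    move=> [[|i] iN] _ /=; first by rewrite subn0 P0 mulr0 normc0.
    have : (i.+1 <= N.+1)%N by [].
    rewrite leq_eqVlt => /orP[/eqP ->|iN']; first by rewrite P0 mul0r normc0.
    have E : (N.+1 - i.+1)%N = (N - i.+1).+1 by rewrite subSn.
    rewrite E normcM; apply: le_trans (ler_pM (normc_ge0 _) (normc_ge0 _) (Pb _) (Pb _)) _.
    have -> : i.+1`!%:R * 2 ^+ i.+1 / 2 * ((N - i.+1).+1`!%:R * 2 ^+ (N - i.+1).+1 / 2) =
        (i.+1`! * (N - i.+1).+1`!)%:R * (2 ^+ N.+1 / 4) :> R.
      have -> : 2 ^+ N.+1 = 2 ^+ i.+1 * 2 ^+ (N - i.+1).+1 :> R.
        by rewrite -exprD addnS subnKC.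
      by rewrite natrM; field.
    rewrite -[leRHS]mulrA ler_wpM2r ?divr_ge0 ?exprn_ge0 // ler_nat.
    apply: leq_trans (fact_mul_le _ _) _.
    by rewrite -addSn subnKC.
  rewrite sumr_const card_ord -[leLHS]mulr_natl factS natrM.
  have -> : N.+1%:R * N`!%:R * 2 ^+ N.+1 = (4 * N.+1%:R) * (N`!%:R * 2 ^+ N.+1 / 4) :> R.
    by field.
  rewrite ler_wpM2r ?divr_ge0 ?mulr_ge0 ?exprn_ge0 //.
  by rewrite -natrM ler_nat mulSn -[N.+2]addn1 leq_add2l muln_gt0.
have HE : \sum_(k < n.+2) yC k * x ^+ k = P.[x] by rewrite horner_poly.
have sz : (size (P * P)%R <= n.+2 + n.+2)%N.
  apply: leq_trans (size_polyMleq _ _) _; apply: leq_trans (leq_pred _) _.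
  by apply: leq_add; exact: size_poly.
rewrite HE expr2 -hornerM (horner_coef_wide _ sz) big_split_ord /=; congr (_ + _).
have low N : (N < n.+2)%N -> (P * P)`_N = \sum_(i < N.+1) yC i * yC (N - i).
  move=> Nn; rewrite coefM; apply: eq_bigr => i _; rewrite !PE.
  rewrite (leq_trans (ltn_ord i)) //.
  by rewrite (leq_ltn_trans (leq_subr _ _) Nn).
under eq_bigr => i _ do rewrite low //.
have y0 : yC 0 = 1 by rewrite /yC ycoef0.
have y1 : yC 1 = 0 by rewrite /yC ycoef1.
rewrite 2!big_ord_recl /= mulr_sumr addrA; congr (_ + _).
  by rewrite big_ord1 /bump /= addn0 2!big_ord_recl big_ord0 /= y0 y1 !(mul0r, mulr0, addr0) !mulr1.
apply: eq_bigr => i _; rewrite /bump /= !add1n.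
rewrite mulrA -yC_S; congr (_ * _).
rewrite big_ord_recl big_ord_recr /= /bump /= !add1n subn0 subnn y0 mul1r mulr1.
set S := (X in yC i.+2 + (X + _)); set S' := (X in _ = 2 * _ + X).
suff -> : S = S' by ring.
by apply: eq_bigr => j _; rewrite /bump /= add1n subSS.
Qed.

End Residual.

Section FormalResidual.
Variable R : realType.
Local Notation C := R[i].
Local Notation yC := (@yC R).
Implicit Types (z w x : C) (m e : R).

Lemma hd_invX k z : z != 0 -> hd (fun w => w^-1 ^+ k) z (- k%:R * z^-1 ^+ k.+1).
Proof.
move=> z0; have V := dvV (@id_continuous R) (dv_emb id z) z0.
have := @hd_comp R (fun w => w ^+ k) (fun w => w^-1) z _ _ (hdX k z^-1) V.
apply: dv_eq; case: k => [|k]; first by rewrite !mul0r oppr0 mul0r.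
by rewrite /= [_ ^+ k.+2]exprS [_ ^+ k.+1]exprS; move: (z^-1 ^+ k) => u; field.
Qed.

Lemma hd_sum n (F : nat -> C -> C) (l : nat -> C) z :
  (forall k, hd (F k) z (l k)) -> hd (fun w => \sum_(k < n) F k w) z (\sum_(k < n) l k).
Proof.
move=> H; elim: n => [|n IH].
  under eq_fun do rewrite big_ord0; rewrite big_ord0; exact: dv_cst.
under eq_fun do rewrite big_ord_recr; rewrite big_ord_recr /=; exact: dvD IH (H n).
Qed.

(** The constant 1 is removed because the unknown is [f = Y - 1]; [ps1] and [ps2] are the termwise
    derivatives. *)
Definition ps n z := \sum_(k < n) yC k * z^-1 ^+ k - 1.
Definition ps1 n z := \sum_(k < n) yC k * (- k%:R * z^-1 ^+ k.+1).
Definition ps2 n z := \sum_(k < n) yC k * (- k%:R * (- k.+1%:R * z^-1 ^+ k.+2)).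

Lemma hd_ps n z : z != 0 -> hd (ps n) z (ps1 n z).
Proof.
move=> z0; have A : hd (fun w => \sum_(k < n) yC k * w^-1 ^+ k) z (ps1 n z).
  apply: (@hd_sum n (fun k w => yC k * w^-1 ^+ k)
    (fun k => yC k * (- k%:R * z^-1 ^+ k.+1))) => k.
  exact: (dvZ (@id_continuous R) _ (hd_invX k z0)).
have := dvB A (dv_cst id 1 z); rewrite subr0; exact.
Qed.

Lemma hd_ps1 n z : z != 0 -> hd (ps1 n) z (ps2 n z).
Proof.
move=> z0; apply: (@hd_sum n (fun k w => yC k * (- k%:R * w^-1 ^+ k.+1))
  (fun k => yC k * (- k%:R * (- k.+1%:R * z^-1 ^+ k.+2)))) => k.
exact: (dvZ (@id_continuous R) _ (dvZ (@id_continuous R) _ (hd_invX k.+1 z0))).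
Qed.

(** The defect of the truncation in [f'' = f + bN z f f']: it is the forcing in the equation for the
    difference with a true solution. *)
Definition pres n z := ps2 n z - ps n z - bN z (ps n z) (ps1 n z).

Lemma pres_eq n z : exists a : nat -> C,
  (forall N, (n.+2 <= N)%N -> normc (a N) <= N`!%:R * 2 ^+ N) /\
  pres n.+2 z = (n%:R ^+ 2 - 4 / 25) * yC n * z^-1 ^+ n.+2 +
    (n.+1%:R ^+ 2 - 4 / 25) * yC n.+1 * z^-1 ^+ n.+3 -
    (\sum_(j < n.+2) a (n.+2 + j)%N * z^-1 ^+ (n.+2 + j)) / 2.
Proof.
have [a [ab aE]] := psum_sqr n z^-1; exists a; split => //.
have s1 : ps1 n.+2 z / z = - \sum_(k < n.+2) k%:R * yC k * z^-1 ^+ k.+2.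
  rewrite /ps1 mulr_suml -sumrN; apply: eq_bigr => k _.
  by rewrite [z^-1 ^+ k.+2]exprSr; ring.
have s0 : (1 + ps n.+2 z) / z ^+ 2 = \sum_(k < n.+2) yC k * z^-1 ^+ k.+2.
  rewrite /ps addrCA subrr addr0 mulr_suml; apply: eq_bigr => k _.
  by rewrite -mulrA -exprVn -exprD addn2.
have E : pres n.+2 z = \sum_(k < n.+2) (k%:R ^+ 2 - 4 / 25) * yC k * z^-1 ^+ k.+2 -
    ((1 + ps n.+2 z) ^+ 2 - 1) / 2.
  have -> : \sum_(k < n.+2) (k%:R ^+ 2 - 4 / 25) * yC k * z^-1 ^+ k.+2 =
      ps2 n.+2 z + ps1 n.+2 z / z - 4 / 25 * ((1 + ps n.+2 z) / z ^+ 2).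
    rewrite s1 s0 mulr_sumr /ps2 -!sumrB; apply: eq_bigr => k _.
    rewrite -[k.+1%:R]natr1; move: (z^-1 ^+ k.+2) (k%:R : C) => u v; ring.
  rewrite /pres /bN; move: (ps2 _ _) (ps1 _ _) (ps _ _) (z^-1) ((z ^+ 2)^-1) => s2 s1' s u v.
  by field; rewrite ?pnatr_eq0.
rewrite E /ps addrCA subrr addr0 aE 2!big_ord_recr /=.
set A := \sum_(i < n) _; set B := \sum_(j < n.+2) _.
by field; rewrite ?pnatr_eq0.
Qed.

Lemma fact_le_pow n j : (j <= n -> (n + j)`! <= n`! * (2 * n) ^ j)%N.
Proof.
elim: j => [|j IH] jn; first by rewrite addn0 expn0 muln1.
rewrite addnS factS expnSr mulnA mulnC; apply: leq_mul; first exact: IH (ltnW jn).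
by rewrite mul2n -addnn -addnS leq_add2l.
Qed.

(** With [normc z] at least the order of truncation, the higher powers of [z^-1] compensate the
    growth of the factorials, so the whole residual has the size of its first neglected term up to a
    geometric factor. *)
Lemma pres_bound n z : n.+2%:R <= normc z ->
  normc (pres n.+2 z) <= 3 * 16 ^+ n.+2 * n.+2`!%:R / normc z ^+ n.+2.
Proof.
move=> nz; have [a [ab ->]] := pres_eq n z.
have z0 : 0 < normc z by apply: lt_le_trans nz.
pose q := (normc z)^-1; have q0 : 0 <= q by rewrite invr_ge0 ltW.
have nq : n.+2%:R * q <= 1 by rewrite /q ler_pdivrMr // mul1r.
have nE k : normc (z^-1 ^+ k) = q ^+ k by rewrite normcX normcV.
have qN : 0 <= q ^+ n.+2 by rewrite exprn_ge0.
have fa k : normc ((k%:R ^+ 2 - 4 / 25) * yC k) <= k.+1%:R * k.+1`!%:R * 2 ^+ k.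
  rewrite yC_factor normc_real; apply: ycoef_factor_bound => l _; exact: ycoef_bound.
pose X := n.+2`!%:R * q ^+ n.+2; have X0 : 0 <= X by rewrite mulr_ge0.
have t1 : normc ((n%:R ^+ 2 - 4 / 25) * yC n * z^-1 ^+ n.+2) <= 2 ^+ n.+2 * X.
  rewrite normcM nE /X mulrA ler_wpM2r //; apply: le_trans (fa n) _.
  rewrite [n.+2`!]factS natrM [leRHS]mulrC.
  apply: ler_pM; rewrite ?mulr_ge0 ?exprn_ge0 //.
    by rewrite ler_wpM2r // ler_nat.
  by rewrite ler_eXn2l // ?ltr1n //; exact: leqW.
have t2 : normc ((n.+1%:R ^+ 2 - 4 / 25) * yC n.+1 * z^-1 ^+ n.+3) <= 2 ^+ n.+2 * X.
  rewrite normcM nE exprS mulrA /X.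
  rewrite [2 ^+ _ * _]mulrA ler_wpM2r //.
  apply: le_trans (ler_wpM2r q0 (fa n.+1)) _.
  have -> : n.+2%:R * n.+2`!%:R * 2 ^+ n.+1 * q = n.+2`!%:R * 2 ^+ n.+1 * (n.+2%:R * q) by ring.
  have h : 0 <= n.+2`!%:R * 2 ^+ n.+1 :> R by rewrite mulr_ge0 // exprn_ge0.
  apply: le_trans (ler_wpM2l h nq) _.
  by rewrite mulr1 mulrC ler_wpM2r // ler_eXn2l // ltr1n.
(* With [N = n + 2], [(N + j)! <= N! (2 N)^j] and [N <= normc z] leave powers of 2 bounded by
   [8 ^+ N]; counting the [N <= 2 ^+ N] terms turns 8 into 16. *)
have t3 : normc (\sum_(j < n.+2) a (n.+2 + j)%N * z^-1 ^+ (n.+2 + j)) <= 16 ^+ n.+2 * X.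
  apply: le_trans (_ : \sum_(j < n.+2) 8 ^+ n.+2 * X <= _).
    apply: (big_ind2 (fun (u : C) (v : R) => normc u <= v)).
    - by rewrite normc0.
    - by move=> u1 v1 u2 v2 h1 h2; apply: le_trans (le_normcD _ _) _; exact: lerD.
    move=> j _; have jn := ltnW (ltn_ord j).
    rewrite normcM nE.
    apply: le_trans (ler_wpM2r (exprn_ge0 _ q0) (ab _ (leq_addr _ _))) _.
    have h1 : (n.+2 + j)`!%:R <= n.+2`!%:R * (2 * n.+2%:R) ^+ j :> R.
      by rewrite -[2]/(2%:R) -natrM -natrX -natrM ler_nat; exact: fact_le_pow.
    have w : 0 <= 2 ^+ (n.+2 + j) * q ^+ (n.+2 + j) by rewrite mulr_ge0 ?exprn_ge0.
    rewrite -mulrA; apply: le_trans (ler_wpM2r w h1) _.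
    have -> : n.+2`!%:R * (2 * n.+2%:R) ^+ j * (2 ^+ (n.+2 + j) * q ^+ (n.+2 + j)) =
        (2 ^+ (n.+2 + j + j) * (n.+2%:R * q) ^+ j) * X.
      by rewrite /X !exprD !exprMn; ring.
    rewrite ler_wpM2r //; apply: le_trans (_ : 2 ^+ (n.+2 + j + j) * 1 <= _).
      rewrite ler_wpM2l ?exprn_ge0 //; apply: exprn_ile1 => //.
      by rewrite mulr_ge0.
    have -> : 8 ^+ n.+2 = 2 ^+ (n.+2 + n.+2 + n.+2) :> R.
      by rewrite !exprD -!exprMn -!natrM.
    by rewrite mulr1 ler_eXn2l ?ltr1n // !leq_add.
  rewrite sumr_const card_ord -[leLHS]mulr_natl mulrA ler_wpM2r //.
  have -> : 16 ^+ n.+2 = 2 ^+ n.+2 * 8 ^+ n.+2 :> R by rewrite -exprMn -natrM.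
  by rewrite ler_wpM2r ?exprn_ge0 // -natrX ler_nat ltnW // ltn_expl.
have E : 3 * 16 ^+ n.+2 * n.+2`!%:R / normc z ^+ n.+2 = 3 * (16 ^+ n.+2 * X).
  by rewrite /X /q exprVn; ring.
have t4 : 2 ^+ n.+2 * X <= 16 ^+ n.+2 * X.
  by rewrite ler_wpM2r // lerXn2r ?nnegrE // ler_nat.
rewrite E; apply: le_trans (le_normcB _ _) _.
have n2 : normc (2^-1 : C) = 2^-1 by rewrite normcV normc_nat.
rewrite [normc (_ / 2)]normcM n2.
have := le_normcD ((n%:R ^+ 2 - 4 / 25) * yC n * z^-1 ^+ n.+2)
  ((n.+1%:R ^+ 2 - 4 / 25) * yC n.+1 * z^-1 ^+ n.+3).
have X16 : 0 <= 16 ^+ n.+2 * X by rewrite mulr_ge0 // exprn_ge0.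
move: (2 ^+ n.+2 * X) (16 ^+ n.+2 * X) t1 t2 t3 t4 X16 => u v t1 t2 t3 t4 X16 t5.
lra.
Qed.

End FormalResidual.

(** * Estimates far from and near the optimal truncation *)

Section Gevrey.
Variable R : realType.
Local Notation C := R[i].
Local Notation yC := (@yC R).
Implicit Types (z w x : C) (m e : R).

Lemma geometric_le2 (p : R) n : 0 <= p -> p <= 1 / 2 -> \sum_(k < n) p ^+ k <= 2.
Proof.
move=> p0 p2; have := subrX1 p n; have := exprn_ge0 n p0.
have S0 : 0 <= \sum_(k < n) p ^+ k by apply: sumr_ge0 => k _; exact: exprn_ge0.
by move: (p ^+ n) (\sum_(k < n) _) S0 => u S S0 u0 E; nra.
Qed.

Lemma fact_le_expn n k : (k <= n -> k`! <= n ^ k)%N.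
Proof.
elim: k => // k IH kn; rewrite factS expnS; apply: leq_mul => //; exact: IH (ltnW kn).
Qed.

Lemma normc_sum n (F : nat -> C) : normc (\sum_(k < n) F k) <= \sum_(k < n) normc (F k).
Proof.
apply: (big_ind2 (fun (u : C) (v : R) => normc u <= v)) => [|u1 v1 u2 v2 h1 h2|//].
  by rewrite normc0.
by apply: le_trans (le_normcD _ _) _; exact: lerD.
Qed.

Lemma ps_small m n z : 0 < m -> m <= 1 -> 128 * n.+2%:R / m <= normc z ->
  normc (ps n.+2 z) <= m / 32.
Proof.
move=> m0 m1 zn; pose p := m / 64.
have p0 : 0 <= p by rewrite divr_ge0 // ltW.
have p2 : p <= 1 / 2 by rewrite /p; lra.
have z0 : 0 < normc z by apply: lt_le_trans zn; rewrite divr_gt0 // mulr_gt0.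
have q : 2 * n.+2%:R * (normc z)^-1 <= p.
  rewrite /p ler_pdivrMr //; move: zn; rewrite ler_pdivrMr // => zn; lra.
rewrite /ps big_ord_recl /= /yC ycoef0 mulr1 addrAC subrr add0r.
rewrite -/(yC _); apply: le_trans (@normc_sum n.+1 (fun k => yC (bump 0 k) * z^-1 ^+ bump 0 k)) _.
apply: le_trans (_ : \sum_(k < n.+1) (p / 2) * p ^+ k <= _); last first.
  rewrite -mulr_sumr; apply: le_trans (ler_wpM2l _ (geometric_le2 _ p0 p2)) _.
    by rewrite divr_ge0.
  by rewrite divfK ?pnatr_eq0 // /p; lra.
apply: ler_sum => k _; rewrite /bump /= add1n normcM normcX normcV normc_yC.
have v0 : 0 <= (normc z)^-1 by rewrite invr_ge0 ltW.
apply: le_trans (ler_wpM2r (exprn_ge0 _ v0) (ycoef_bound _ _)) _.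
have -> : p / 2 * p ^+ k = p ^+ k.+1 / 2 by rewrite exprS; ring.
have -> : k.+1`!%:R * 2 ^+ k.+1 / 2 * (normc z)^-1 ^+ k.+1 =
   k.+1`!%:R * (2 * (normc z)^-1) ^+ k.+1 / 2 by rewrite exprMn; ring.
rewrite ler_pM2r ?invr_gt0 //.
have w0 : 0 <= 2 * (normc z)^-1 by rewrite mulr_ge0.
apply: le_trans (_ : (n.+2%:R * (2 * (normc z)^-1)) ^+ k.+1 <= _).
  rewrite [leRHS]exprMn ler_wpM2r ?exprn_ge0 // -natrX ler_nat.
  by apply: fact_le_expn; rewrite ltnS ltnW.
have q' : n.+2%:R * (2 * (normc z)^-1) <= p by rewrite mulrCA mulrA.
by apply: lerXn2r q'; rewrite nnegrE // mulr_ge0.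
Qed.

Lemma ps1_bounded n : exists B : R, forall z, 1 <= normc z -> normc (ps1 n z) <= B.
Proof.
exists (\sum_(k < n) normc (yC k * - k%:R)) => z z1.
apply: le_trans (@normc_sum n (fun k => yC k * (- k%:R * z^-1 ^+ k.+1))) _.
apply: ler_sum => k _; rewrite mulrA normcM ler_piMr ?normc_ge0 //.
rewrite normcX normcV; apply: exprn_ile1; first by rewrite invr_ge0 normc_ge0.
by rewrite invf_le1 // (lt_le_trans _ z1).
Qed.

(** For [n] small against [normc z0], the truncation lies in the same small ball as [f], so the
    contraction applies to their difference with forcing [pres]; [cone_weight] moves the power of
    [normc z] to the apex. *)
Lemma boutroux_far m e (f g : C -> C) z0 n : 0 < m -> m <= 1 -> e ^+ 2 = 1 ->
  boutroux (hp m e) f g ->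
  (forall z, hp m e z -> normc (f z) <= m / 32 /\ normc (g z) <= m / 32) ->
  256 * n.+2%:R / m <= e * Re z0 + m * Im z0 ->
  normc (f z0 - ps n.+2 z0) <= 24 / m * 16 ^+ n.+2 * n.+2`!%:R / normc z0 ^+ n.+2.
Proof.
move=> m0 m1 e2 fg fb lev.
have N1 : 1 <= n.+2%:R :> R by rewrite ler1n.
have conv w : cone m z0 w -> hp m e w /\ 128 * n.+2%:R / m <= normc w.
  move=> /(hp_level_forward m0 (lexx _) e2) /(le_trans lev) lw.
  split; last first.
    move: lw (hp_level_le w m0 m1 e2).
    have -> : 256 * n.+2%:R / m = 2 * (128 * n.+2%:R / m) by ring.
    by move=> h1 h2; have := le_trans h1 h2; rewrite ler_pM2l.
  apply: lt_le_trans lw; rewrite ltr_pM2r ?invr_gt0 //; lra.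
have zp w : cone m z0 w -> n.+2%:R <= normc w.
  move=> /conv[_]; apply: le_trans; rewrite ler_pdivlMr //.
  apply: le_trans (_ : n.+2%:R * 1 <= _); first by rewrite ler_wpM2l.
  by rewrite mulr1; lra.
have zp0 w : cone m z0 w -> 0 < normc w by move=> /zp; exact: lt_le_trans.
have z00 := zp0 z0 (cone_refl _ _).
pose H : R := 3 * 16 ^+ n.+2 * n.+2`!%:R / normc z0 ^+ n.+2.
have K0 : 0 <= 3 * 16 ^+ n.+2 * n.+2`!%:R :> R by rewrite mulr_ge0 // mulr_ge0 // exprn_ge0.
have H0 : 0 <= H by rewrite divr_ge0 // exprn_ge0 // ltW.
have [B1 B1P] := ps1_bounded n.+2.
have BP w : cone m z0 w -> normc (ps1 n.+2 w) <= B1.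
  by move=> /zp wn; apply: B1P; exact: le_trans N1 wn.
have B10 : 0 <= B1 by apply: le_trans (normc_ge0 _) (BP z0 (cone_refl _ _)).
have := @contraction_bound R m m0 m1 (fun z => f z - ps n.+2 z) (fun z => g z - ps1 n.+2 z)
  (fun z => bN z (f z) (g z) - bN z (ps n.+2 z) (ps1 n.+2 z) - pres n.+2 z) z0 H
  (m / 32 + m / 32 + B1) H0.
move=> HC; have {HC} [] := HC.
- move=> w wc; have [wh w128] := conv w wc; have [fd gd] := fg w wh.
  have wn : w != 0 by rewrite -normc_gt0; exact: zp0.
  split; first exact: dvB fd (hd_ps _ wn).
  by apply: dv_eq (dvB gd (hd_ps1 _ wn)); rewrite /pres; ring.
- move=> w wc; have [wh w128] := conv w wc; have [b1 b2] := fb w wh.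
  have b3 := ps_small m0 m1 w128; have b4 := BP w wc.
  have := le_normcB (f w) (ps n.+2 w); have := le_normcB (g w) (ps1 n.+2 w).
  by split; lra.
- move=> w S wc rS gS; have [wh w128] := conv w wc; have [b1 b2] := fb w wh.
  have b3 := ps_small m0 m1 w128.
  apply: le_trans (le_normcB _ _) _; apply: lerD.
    apply: bN_lip => //; exact: hp_norm wh.
  apply: le_trans (pres_bound (zp w wc)) _.
  rewrite /H -[leRHS]mulrA; apply: ler_wpM2l => //.
  have z02 : 0 < normc z0 ^+ n.+2 by rewrite exprn_gt0.
  have w2 : 0 < normc w ^+ n.+2 by rewrite exprn_gt0 // zp0.
  have ww : 4 * n.+2%:R / m <= normc w.
    apply: le_trans w128; rewrite ler_pM2r ?invr_gt0 //; lra.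
  have cw := cone_weight m0 m1 wc (zp0 w wc) ww.
  by rewrite -(ler_pM2l z02) mulVKf ?gt_eqF // ler_pdivrMr // [_ * normc w ^+ _]mulrC.
move=> E _; apply: le_trans E _.
by rewrite le_eqVlt; apply/orP; left; apply/eqP; rewrite /H; ring.
Qed.

(** Induction on [n], each step costing [(1 + 1 / n) ^ n <= e]. *)
Lemma expn_le_fact n : n%:R ^+ n <= expR 1 ^+ n * n`!%:R :> R.
Proof.
elim: n => [|[|n] IH]; first by rewrite !expr0 mul1r.
  by rewrite !expr1 mulr1; have := expR_ge1Dx (1 : R); lra.
have h : n.+2%:R <= n.+1%:R * expR (n.+1%:R^-1) :> R.
  apply: le_trans (ler_wpM2l _ (expR_ge1Dx _)) => //.
  by rewrite mulrDr mulr1 divff // natr1.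
have h2 : n.+2%:R ^+ n.+1 <= n.+1%:R ^+ n.+1 * expR 1 :> R.
  have -> : n.+1%:R ^+ n.+1 * expR 1 = (n.+1%:R * expR (n.+1%:R^-1)) ^+ n.+1 :> R.
    by rewrite exprMn -expRM_natl divff.
  by rewrite lerXn2r ?nnegrE // mulr_ge0 // expR_ge0.
rewrite exprS factS natrM.
have -> : expR 1 ^+ n.+2 * (n.+2%:R * n.+1`!%:R) =
   n.+2%:R * (expR 1 ^+ n.+1 * n.+1`!%:R * expR 1) :> R by rewrite exprS; ring.
apply: ler_wpM2l => //; apply: le_trans h2 _.
by apply: ler_wpM2r IH; exact: expR_ge0.
Qed.

(** Beyond the optimal truncation the solution enters only through its boundedness:
    [normc z ^+ n <= (L n)^n] is already at most [(L e)^n n!], and so is each term of the sum up to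
    geometric factors. *)
Lemma boutroux_near (L : R) (f : C -> C) z n : 1 <= L -> 1 <= normc z ->
  normc z <= L * n%:R -> normc (f z) <= 1 ->
  normc (1 + f z - \sum_(k < n) yC k * z^-1 ^+ k) <=
    2 * (4 * L * expR 1) ^+ n * n`!%:R / normc z ^+ n.
Proof.
move=> L1 z1 zn f1; have z0 : 0 < normc z by apply: lt_le_trans z1.
have zN : 0 < normc z ^+ n by rewrite exprn_gt0.
have L0 : 0 <= L by lra.
have Ln : 1 <= L * n%:R by exact: le_trans zn.
rewrite ler_pdivlMr // mulrC.
have Q : 0 <= (2 * (L * n%:R)) ^+ n by rewrite exprn_ge0 // mulr_ge0 // mulr_ge0.
have t : normc z ^+ n * \sum_(k < n) normc (yC k * z^-1 ^+ k) <=
    n%:R * (2 * (L * n%:R)) ^+ n.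
  rewrite mulr_sumr; apply: le_trans (_ : \sum_(k < n) (2 * (L * n%:R)) ^+ n <= _); last first.
    by rewrite sumr_const card_ord [leRHS]mulr_natl.
  apply: ler_sum => k _; have kn := ltn_ord k.
  have yk : normc (yC k) <= k`!%:R * 2 ^+ k.
    rewrite normc_yC; case: (k : nat) => [|k']; first by rewrite ycoef0 normr1 mulr1.
    apply: le_trans (ycoef_bound _ _) _.
    by rewrite ler_pdivrMr // ler_peMr ?ler1n // mulr_ge0 // exprn_ge0.
  rewrite normcM normcX normcV.
  have -> : normc z ^+ n * (normc (yC k) * (normc z)^-1 ^+ k) = normc (yC k) * normc z ^+ (n - k).
    rewrite mulrCA; congr (_ * _); rewrite exprVn.
    by rewrite -{1}(subnK (ltnW kn)) exprD mulfK // expf_neq0 // gt_eqF.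
  apply: le_trans (_ : (k`!%:R * 2 ^+ k) * (L * n%:R) ^+ (n - k) <= _).
    apply: ler_pM; rewrite ?normc_ge0 ?exprn_ge0 ?(ltW z0) //.
    by rewrite lerXn2r ?nnegrE ?(ltW z0) // mulr_ge0.
  have -> : (2 * (L * n%:R)) ^+ n =
     ((L * n%:R) ^+ k * 2 ^+ n) * (L * n%:R) ^+ (n - k).
    have E : (L * n%:R) ^+ n = (L * n%:R) ^+ k * (L * n%:R) ^+ (n - k).
      by rewrite -exprD subnKC // ltnW.
    by rewrite exprMn E mulrA [2 ^+ n * _]mulrC.
  rewrite ler_wpM2r ?exprn_ge0 ?mulr_ge0 //; apply: ler_pM; rewrite ?exprn_ge0 //.
    apply: le_trans (_ : n%:R ^+ k <= _).
      by rewrite -natrX ler_nat; apply: fact_le_expn; exact: ltnW.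
    by rewrite lerXn2r ?nnegrE ?mulr_ge0 // ler_peMl.
  by rewrite ler_eXn2l ?ltr1n // ltnW.
have b : normc (1 + f z - \sum_(k < n) yC k * z^-1 ^+ k) <=
    2 + \sum_(k < n) normc (yC k * z^-1 ^+ k).
  apply: le_trans (le_normcB _ _) _; apply: lerD; last exact: (@normc_sum n (fun k => yC k * z^-1 ^+ k)).
  by apply: le_trans (le_normcD _ _) _; rewrite normc1; lra.
apply: le_trans (ler_wpM2l (ltW zN) b) _; rewrite mulrDr.
have u : normc z ^+ n * 2 <= 2 * (2 * (L * n%:R)) ^+ n.
  rewrite mulrC ler_wpM2l // lerXn2r ?nnegrE ?(ltW z0) //; last by lra.
  by rewrite mulr_ge0 // mulr_ge0.
apply: le_trans (lerD u t) _; rewrite -mulrDl.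
have n2 : 2 + n%:R <= 2 * 2 ^+ n :> R.
  rewrite -exprS -natrX -natrD ler_nat expnS mul2n -addnn.
  by rewrite -[(2 + n)%N]/(1 + n.+1)%N leq_add ?expn_gt0 // ltn_expl.
apply: le_trans (ler_wpM2r Q n2) _.
have -> : 2 * 2 ^+ n * (2 * (L * n%:R)) ^+ n = 2 * (4 * L) ^+ n * n%:R ^+ n.
  have -> : 4 * L = 2 * 2 * L by ring.
  by rewrite !exprMn; ring.
have -> : 2 * (4 * L * expR 1) ^+ n * n`!%:R = 2 * (4 * L) ^+ n * (expR 1 ^+ n * n`!%:R).
  by rewrite [(4 * L * _) ^+ n]exprMn; ring.
apply: ler_wpM2l (expn_le_fact n).
by rewrite mulr_ge0 // exprn_ge0 // mulr_ge0.
Qed.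

End Gevrey.

Section GevreyBound.
Variable R : realType.
Local Notation C := R[i].
Local Notation yC := (@yC R).
Implicit Types (z w x : C) (m e : R).

Lemma boutroux_gevrey m : 0 < m -> m <= 1 -> exists K M : R, [/\ 0 < K, 0 < M &
  forall (f g : C -> C) e z n, e ^+ 2 = 1 -> boutroux (hp m e) f g ->
    (forall z, hp m e z -> normc (f z) <= m / 32 /\ normc (g z) <= m / 32) ->
    hp m e z -> m * normc z <= e * Re z + m * Im z ->
    normc (1 + f z - \sum_(k < n) yC k * z^-1 ^+ k) <= K * M ^+ n * n`!%:R / normc z ^+ n].
Proof.
(* [L = 256 / m ^+ 2] makes the two regimes exhaustive: failing the far condition means that the
   level is below [256 * n / m], and [m * normc z] is at most the level. *)
move=> m0 m1; have e1 : 1 <= expR 1 :> R by rewrite -expR0 ler_expR.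
pose L := 256 / m ^+ 2; have L1 : 256 <= L.
  by rewrite /L ler_pdivlMr ?exprn_gt0 // ler_piMr // exprn_ile1 // ltW.
have L0 : 1 <= L by lra.
have K24 : 24 <= 24 / m by rewrite ler_pdivlMr // ler_piMr.
have M16 : 16 <= 4 * L * expR 1.
  apply: le_trans (_ : 16 * 1 <= _); first by rewrite mulr1.
  by apply: ler_pM => //; lra.
have M0 : 0 < 4 * L * expR 1 by lra.
exists (24 / m), (4 * L * expR 1); split; [by lra|exact: M0|].
move=> f g e z n e2 fg fb zh lev.
have zn := hp_norm m0 m1 e2 zh.
have z16 : 16 <= normc z by apply: le_trans zn; rewrite ler_pdivlMr // ler_piMr.
have z0 : 0 < normc z by lra.
have [f1 _] := fb z zh.
have [far|near] := leP (256 * n%:R / m) (e * Re z + m * Im z); last first.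
  have [zL|zL] := leP (normc z) (L * n%:R); last first.
    suff : m * (L * n%:R) < m * normc z.
      have -> : m * (L * n%:R) = 256 * n%:R / m by rewrite /L; field; rewrite gt_eqF.
      by lra.
    by rewrite ltr_pM2l.
  apply: le_trans (boutroux_near L0 _ zL _) _; [by lra|by lra|].
  rewrite ler_pM2r ?invr_gt0 ?exprn_gt0 // ler_wpM2r // ler_wpM2r ?exprn_ge0 ?(ltW M0) //; lra.
have inc w : cone m z w -> hp m e w.
  by move=> /(hp_level_forward m0 (lexx _) e2); exact: lt_le_trans.
have [fz _] : normc (f z) <= 2 / m / normc z ^+ 2 /\ normc (g z) <= 2 / m / normc z ^+ 2.
  apply: (boutroux_decay m0 m1) => [w /inc|w /inc wh]; first exact: fg.
  by have [b1 b2] := fb w wh; split => //; exact: hp_norm wh.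
(* The far estimate starts at order 2; orders 0 and 1 follow from the bound and the decay of [f]. *)
case: n far => [|[|n]] far.
- rewrite big_ord0 subr0 !expr0 invr1 !mulr1.
  by have := le_normcD 1 (f z); rewrite normc1; lra.
- rewrite big_ord1 expr0 mulr1 /yC ycoef0 [1 + _]addrC addrK !expr1 mulr1.
  apply: le_trans fz _; rewrite ler_pdivrMr ?exprn_gt0 // expr2 mulrA divfK ?gt_eqF //.
  apply: le_trans (_ : 24 / m * 1 <= _).
    by rewrite mulr1 ler_pM2r ?invr_gt0 // ler_nat.
  rewrite -[leRHS]mulrA; apply: ler_wpM2l; first by lra.
  by apply: mulr_ege1; lra.
- have := boutroux_far m0 m1 e2 fg fb far; rewrite /ps opprB addrA [f z + 1]addrC.
  move=> h; apply: le_trans h _.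
  rewrite ler_pM2r ?invr_gt0 ?exprn_gt0 // ler_wpM2r //; apply: ler_wpM2l; first by lra.
  by rewrite lerXn2r ?nnegrE //; lra.
Qed.

End GevreyBound.

(** * Stokes sectors and sectorial neighbourhoods *)

Section Connectedness.
Variable T : topologicalType.

Lemma joined_component (R : realType) (A : set T) (g : R -> T) (x y : T) :
  {within `[0, 1], continuous g} -> (forall s, s \in `[0, 1] -> A (g s)) ->
  g 0 = x -> g 1 = y -> connected_component A x y.
Proof.
move=> gc gA g0 g1; have z1 : (0 : R) \in `[0, 1] by rewrite in_itv /= lexx ler01.
have o1 : (1 : R) \in `[0, 1] by rewrite in_itv /= lexx ler01.
apply: (@connected_component_max _ A (g @` `[0, 1])).
- by exists 0.
- by move=> _ [s s01 <-]; exact: gA.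
- apply: connected_continuous_connected gc; apply/connected_intervalP; exact: interval_is_interval.
- by exists 1.
Qed.

Lemma connected_joined (A : set T) (x : T) :
  (forall y, A y -> connected_component A x y) -> connected A.
Proof.
move=> H; suff -> : A = connected_component A x by exact: component_connected.
by apply/seteqP; split => [y /H//|]; exact: connected_component_sub.
Qed.

End Connectedness.

Lemma convexc_component (R : realType) (A : set R[i]) x y :
  convexc A -> A x -> A y -> connected_component A x y.
Proof.
move=> Ac Ax Ay; apply: (@joined_component _ R A (segpt x y)).
- by apply: continuous_subspaceT => s; exact: rd_continuous (rd_affine x (y - x) s).
- by move=> s s01; exact: Ac.
- by rewrite /segpt rmorph0 mul0r addr0.
- by rewrite /segpt rmorph1 mul1r subrKC.
Qed.

(** * Stokes sectors as rotated wedges *)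

Section StokesSector.
Variable R : realType.
Local Notation C := R[i].
Implicit Types (z w x : C).

Lemma realCX (a : R) n : (a ^+ n)%:C = a%:C ^+ n :> C. Proof. exact: rmorphXn. Qed.

Lemma realCV (a : R) : (a^-1)%:C = (a%:C)^-1 :> C. Proof. exact: fmorphV. Qed.

Lemma polar z : exists theta : R, z = (normc z)%:C * cis theta.
Proof.
have H w : uhp w -> exists theta : R, w = (normc w)%:C * cis theta.
  move=> wu; exists (Im (clog w)); rewrite -{1}(clogK wu) /cexp /= lnK //.
  by rewrite posrE normc_gt0 uhp_neq0.
have [i0|i0|i0] := ltgtP (Im z) 0; last 1 first.
- case: z i0 => a b /= ->; rewrite expr0n /= addr0 sqrtr_sqr.
  have [a0|a0] := leP 0 a.
    by exists 0; rewrite /cis cos0 sin0 ger0_norm // mulr1.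
  exists pi; rewrite /cis cospi sinpi ltr0_norm //.
  by apply: complex_ext; rewrite ?cReM ?cImM /=; ring.
- have [|theta E] := H (- z); first by rewrite /uhp /= cImN oppr_gt0.
  exists (theta + pi); rewrite /cis cosDpi sinDpi; move: E; rewrite normcN => E.
  have -> : (- cos theta) +i* (- sin theta) = - cis theta by [].
  by rewrite mulrN -E opprK.
- exact: H.
Qed.

Lemma cis_periodic (theta : R) (k : int) : cis (theta + 2 * pi * k%:~R) = cis theta.
Proof.
have P n t : cis (t + 2 * pi * n%:R) = cis t :> C.
  elim: n => [|n IH]; first by rewrite mulr0 addr0.
  have -> : t + 2 * pi * n.+1%:R = (t + 2 * pi * n%:R) + pi *+ 2.
    by rewrite -natr1 mulr2n; ring.
  by rewrite /cis sinD2pi cosD2pi; exact: IH.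
case: k => n; first exact: P.
rewrite NegzE mulrNz mulrN -[in RHS](subrK (2 * pi * n.+1%:R) theta).
by rewrite P.
Qed.

Lemma cisD (a b : R) : cis (a + b) = cis a * cis b.
Proof.
rewrite /cis cosD sinD; apply: complex_ext; rewrite ?cReM ?cImM /=; ring.
Qed.

Lemma cis_cexp (a : R) : cis a = cexp (0 +i* a).
Proof. by rewrite /cexp /= expR0 mul1r. Qed.

Definition phi0 : R := 2 * pi / 5.

Lemma phi0_bounds : 0 < phi0 < pi.
Proof. have := pi_gt0 R; rewrite /phi0 => p; apply/andP; split; lra. Qed.

(** The sector of arguments in []0, phi0[]. As [phi0 < pi], it is an intersection of two
    half-planes, which makes openness and convexity immediate. *)
Definition wedge : set C := [set x | 0 < Im x /\ Im (x * cis (- phi0)) < 0].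

Lemma Im_cexp w : Im (cexp w) = expR (Re w) * sin (Im w).
Proof. by rewrite /cexp cImM /=; ring. Qed.

Lemma wedgeP x : wedge x <-> exists w, 0 < Im w < phi0 /\ x = cexp w.
Proof.
have /andP[f0 fp] := phi0_bounds; split.
  move=> [x0]; rewrite -[x in x * _](clogK x0) cis_cexp -cexpD Im_cexp cImD cReD /=.
  have := clog_arg x0; rewrite /= => /andP[a0 ap] s0; exists (clog x); rewrite clogK //.
  split=> //; rewrite a0 /= ltNge; apply/negP => fa.
  move: s0; rewrite pmulr_rlt0 ?expR_gt0 // ltNge sin_ge0_pi //.
  by apply/andP; split; lra.
move=> [w [/andP[w0 w1] ->]]; split.
  by rewrite Im_cexp mulr_gt0 ?expR_gt0 // sin_gt0_pi // w0 /=; lra.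
rewrite cis_cexp -cexpD Im_cexp cImD cReD /= pmulr_rlt0 ?expR_gt0 //.
rewrite -[_ + _]opprK sinN oppr_lt0 sin_gt0_pi //; apply/andP; split; lra.
Qed.

(** Both boundary rays of the wedge are Stokes lines, so the wedge is relatively clopen in their
    complement; being convex, it is a component. *)
Lemma stokes_sector_wedge (alpha : R) (V : set C) : stokes_sector alpha V ->
  exists tc : C, tc ^+ 5 = (25 / 6912)%:C * cis (2 * alpha) /\
    V = [set tau | wedge (tau / tc)].
Proof.
move=> [tau0 tau0n ->]; have [theta E0] := polar tau0.
have p0 := pi_gt0 R; have /andP[f0 fp] := phi0_bounds.
pose u := (5 * theta - 2 * alpha) / (2 * pi).
(* [th k] is the last Stokes direction not beyond [theta], and [th (k + 1)] the next one; [tc] is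
   placed on the ray of [th k], with fifth power of modulus [c]. *)
pose k := Num.floor u; have k1 : k%:~R <= u by rewrite ge_floor.
have k2 : u < k%:~R + 1 by have := floorD1_gt u; rewrite intrD.
pose c : R := 25 / 6912; have c0 : 0 < c by rewrite /c; lra.
pose th (j : int) := (2 * alpha + 2 * pi * j%:~R) / 5.
pose tc := cexp ((ln c / 5) +i* th k).
have tc0 : tc != 0 by exact: cexp_neq0.
have tcE : tc = (expR (ln c / 5))%:C * cis (th k) by [].
have line j (x : R) : 0 <= x -> stokes_lines alpha (x%:C * tc * cis (th j - th k)).
  move=> x0; exists (th j), (x * expR (ln c / 5)); split.
  - by rewrite mulr_ge0 // expR_ge0.
  - by exists j; rewrite /th; field.
  - rewrite tcE rmorphM -!mulrA; congr (_ * (_ * _)); rewrite -cisD; congr (cis _); ring.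
have fiveM (a b : R) : 5%:R * (a +i* b) = (5 * a) +i* (5 * b) :> C.
  by rewrite -(rmorph_nat (real_complex R) 5); apply: complex_ext; rewrite ?cReM ?cImM /=; ring.
have tc5 : tc ^+ 5 = c%:C * cis (2 * alpha).
  rewrite /tc -cexpMn fiveM /cexp /=.
  have -> : 5 * (ln c / 5) = ln c by field.
  have -> : 5 * th k = 2 * alpha + 2 * pi * k%:~R by rewrite /th; field.
  by rewrite cis_periodic lnK.
exists tc; split; first exact: tc5.
pose K : set C := [set tau | wedge (tau / tc)].
(* On a Stokes line the fifth power of [tau / tc] is real and nonnegative. In the wedge its argument
   lies strictly between 0 and [2 pi], so being real forces it to be negative. *)
have Kdisj tau : K tau -> ~ stokes_lines alpha tau.
  move=> /wedgeP[w [/andP[w0 w1] tw]] [t [r [r0 [j tj] tauE]]].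
  have := congr1 (fun z => z ^+ 5) tw; rewrite expr_div_n tc5 tauE exprMn.
  have -> : cis t ^+ 5 = cis (2 * alpha).
    rewrite [cis t]cis_cexp -cexpMn fiveM mulr0 -cis_cexp tj; exact: cis_periodic.
  rewrite -cexpMn => E; have cn : cis (2 * alpha) != 0 by rewrite cis_cexp cexp_neq0.
  have {E} E : cexp (5%:R * w) = (r ^+ 5 / c)%:C.
    have -> : (r ^+ 5 / c)%:C = r%:C ^+ 5 / c%:C by rewrite realCM realCX realCV.
    rewrite -E; field.
    by rewrite cn /= (_ : c%:C != 0) // -normc_gt0 normc_real gtr0_norm.
  have Ei : Im (cexp (5%:R * w)) = 0 by rewrite E.
  have Er : Re (cexp (5%:R * w)) = r ^+ 5 / c by rewrite E.
  move: Ei; rewrite Im_cexp => /eqP; rewrite mulf_eq0 gt_eqF ?expR_gt0 //=.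
  have ImE : Im (5%:R * w) = (5 / 2 * Im w) *+ 2.
    by case: (w) => a b; rewrite fiveM /= mulr2n; field.
  have sp : 0 < sin (5 / 2 * Im w).
    by rewrite sin_gt0_pi //; apply/andP; move: w1; rewrite /phi0 => w1; split; lra.
  rewrite ImE sin_mulr2n mulrn_eq0 /= mulf_eq0 (gt_eqF sp) orbF => /eqP cE.
  have : 0 <= r ^+ 5 / c by rewrite divr_ge0 ?exprn_ge0 // ltW.
  rewrite -Er /cexp cReM /= mul0r subr0 pmulr_rge0 ?expR_gt0 //.
  by rewrite ImE cos_mulr2n cE expr0n /= mul0rn; lra.
have Kcover tau : ~ stokes_lines alpha tau -> ~ K tau ->
    Im (tau / tc) < 0 \/ 0 < Im (tau / tc * cis (- phi0)).
  move=> nl nK; apply: contrapT => /not_orP[/negP]; rewrite -leNgt => i1 /negP.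
  rewrite -leNgt => i2; have tE : tau = tc * (tau / tc) by rewrite mulrC divfK.
  have [e1|e1] := eqVneq (Im (tau / tc)) 0.
    apply: nl; have xE : tau / tc = (Re (tau / tc))%:C.
      by apply: complex_ext.
    have x0 : 0 <= Re (tau / tc).
      move: i2; rewrite xE cImM /= mul0r addr0 sinN mulrN oppr_le0.
      by rewrite pmulr_lge0 // sin_gt0_pi // f0.
    rewrite tE xE; have := line k _ x0; rewrite subrr /cis cos0 sin0.
    by rewrite -[1 +i* 0]/(1 : C) mulr1 mulrC.
  have [e2|e2] := eqVneq (Im (tau / tc * cis (- phi0))) 0; last first.
    by apply: nK; split; rewrite lt_def; [rewrite e1|rewrite eq_sym e2].
  apply: nl; pose a := Re (tau / tc * cis (- phi0)).
  have xE : tau / tc = a%:C * cis phi0.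
    have -> : a%:C = tau / tc * cis (- phi0) by apply: complex_ext.
    by rewrite -mulrA -cisD addNr /cis cos0 sin0 -[1 +i* 0]/(1 : C) mulr1.
  have a0 : 0 <= a.
    move: i1; rewrite xE cImM /= mul0r addr0.
    by rewrite pmulr_lge0 // sin_gt0_pi // f0.
  rewrite tE xE; have := line (k + 1)%R _ a0.
  have -> : th (k + 1) - th k = phi0 by rewrite /th /phi0 intrD; field.
  by rewrite [tc * (_ * _)]mulrCA mulrA.
have oI (a : C) : open [set z : C | 0 < Im (z * a)].
  rewrite openE => z /= za; have a1 : 0 < normc a + 1 by rewrite ltr_wpDl // normc_ge0.
  apply/nbhs_normcP; exists (Im (z * a) / (normc a + 1)); first by rewrite divr_gt0.
  move=> w wz /=; have := normc_Im ((w - z) * a); rewrite normcM mulrBl cImD cImN.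
  move: wz; rewrite ltr_pdivlMr // mulrDr mulr1 => h1 h2.
  have := normc_ge0 (w - z); have := lerNnormlW h2; lra.
have tauK : K tau0.
  have r0 : 0 < normc tau0.
    rewrite normc_gt0; apply/eqP => t0; apply: tau0n; rewrite t0.
    have := line k _ (lexx 0); by rewrite !mul0r.
  apply/wedgeP; exists ((ln (normc tau0) - ln c / 5) +i* (theta - th k)).
  have d0 : 0 <= theta - th k.
    move: k1; rewrite /u ler_pdivlMr ?mulr_gt0 // /th; lra.
  have d1 : theta - th k < phi0.
    move: k2; rewrite /u ltr_pdivrMr ?mulr_gt0 // /th /phi0; lra.
  split.
    apply/andP; split => //=; rewrite lt_def d0 andbT; apply/eqP => e.
    apply: tau0n; rewrite E0; exists theta, (normc tau0); split; [exact: normc_ge0| |by []].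
    by exists k; move: e; rewrite /th; lra.
  apply: (mulIf tc0); rewrite divfK // /tc -cexpD.
  rewrite {1}E0 polar_cexp //; congr cexp.
  by apply: complex_ext; rewrite /= subrK.
have KI tau : K tau <-> 0 < Im (tau * tc^-1) /\ 0 < Im (tau * (- (tc^-1 * cis (- phi0)))).
  by rewrite mulrN mulrA cImN oppr_gt0.
have Ko : open K.
  have -> : K = [set z | 0 < Im (z * tc^-1)] `&`
      [set z | 0 < Im (z * (- (tc^-1 * cis (- phi0))))].
    by apply/seteqP; split => z /KI.
  by apply: openI; exact: oI.
apply/seteqP; split; last first.
  apply: (connected_component_max (tauK : K tau0)); first by move=> tau; exact: Kdisj.
  apply: (@connected_joined _ K tau0) => y yK.
  apply: convexc_component => // a b s aK bK s01; apply/KI.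
  have [a1 a2] := (KI _).1 aK; have [b1 b2] := (KI _).1 bK.
  by rewrite !segptM !Im_segpt; split; exact: lt_convex.
(* Inside a connected [B] off the Stokes lines, [Kcover] identifies the complement of [K] with the
   open set [N]; thus [K] is both open and closed in [B], and [B] stays in [K]. *)
move=> y [B [Bt Bsub Bc] yB]; suff BE : B `&` K = B by move: yB; rewrite -BE => -[].
pose N : set C := [set z | 0 < Im (z * - tc^-1)] `|` [set z | 0 < Im (z * (tc^-1 * cis (- phi0)))].
apply: Bc; first by exists tau0.
  by exists K.
exists (~` N); first by apply: open_closedC; apply: openU; exact: oI.
apply/seteqP; split => z [Bz]; last first.
  move=> zN; split => //; apply: contrapT => /(Kcover z (Bsub z Bz)) H; apply: zN.
  by case: H => h; [left|right]; rewrite /= ?mulrN ?cImN ?oppr_gt0 // mulrA.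
move=> /KI[h1 h2]; split => // -[/=|/=]; first by rewrite mulrN cImN oppr_gt0; lra.
by move: h2; rewrite mulrN cImN oppr_gt0; lra.
Qed.

End StokesSector.

Lemma cvg_pairs (X : Type) (T U : topologicalType) (F : set_system X) (f : X -> T)
    (g : X -> U) (a : T) (b : U) : Filter F ->
  f @ F --> a -> g @ F --> b -> (fun x => (f x, g x)) @ F --> (a, b).
Proof.
move=> FF fa gb W [[P Q] /= [Pa Qb] PQ].
have h1 : F (f @^-1` P) := fa P Pa; have h2 : F (g @^-1` Q) := gb Q Qb.
apply: (@filterS _ F FF _ _ _ (filterI h1 h2)) => x [Px Qx].
exact: (PQ (f x, g x) (conj Px Qx)).
Qed.

(** * Simple connectedness by contraction *)

Section Contraction.
Variables (R : realType) (T : topologicalType) (A : set T) (K : R -> T -> T -> T).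

(** [K r x y] moves [x] to [y] inside [A], which gives paths; contracting every point of a loop to
    its base point gives the homotopy, and [K r x x = x] keeps the ends fixed. *)
Lemma simply_connected_contract : A !=set0 ->
  (forall r x y, r \in `[0, 1] -> A x -> A y -> A (K r x y)) ->
  (forall x y, A x -> A y -> K 0 x y = x /\ K 1 x y = y) ->
  (forall r x, r \in `[0, 1] -> A x -> K r x x = x) ->
  (forall r x y, r \in `[0, 1] -> A x -> A y ->
     {for (r, x), continuous (fun p : R * T => K p.1 p.2 y)}) ->
  simply_connected R A.
Proof.
move=> A0 KA K01 Kx Kc; split => // [x y Ax Ay|x g [gc gA g0 g1]].
  have [k0 k1] := K01 x y Ax Ay.
  exists (fun s => K s x y); split; [|by move=> s s01; exact: KA|exact: k0|exact: k1].
  apply/subspace_continuousP => s s01; apply: cvg_within_filter.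
  have C := Kc s x y s01 Ax Ay.
  apply: (@cont_comp R (R * T)%type T (fun p => K p.1 p.2 y) (fun s => (s, x)) s C).
  apply: cvg_pairs; [exact: cvg_id|exact: cvg_cst].
have z1 : (0 : R) \in `[0, 1] by rewrite in_itv /= lexx ler01.
have o1 : (1 : R) \in `[0, 1] by rewrite in_itv /= lexx ler01.
have Ax : A x by rewrite -g0; exact: gA.
exists (fun p => K p.1 (g p.2) x); split.
- apply/subspace_continuousP => -[r s] [/= r01 s01].
  have C := Kc r (g s) x r01 (gA s s01) Ax.
  have gW : g @ within `[0, 1] (nbhs s) --> g s by move/subspace_continuousP : gc; apply.
  suff P : (fun p : R * R => (p.1, g p.2)) @ within (`[0, 1] `*` `[0, 1]) (nbhs (r, s)) --> (r, g s).
    exact: (cvg_comp _ _ P C).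
  apply: cvg_pairs => /=.
    apply: cvg_within_filter; exact: cvg_fst.
  move=> W /gW; rewrite /= /within /= => HW.
  have : \forall q \near (r, s), q.2 \in `[0, 1]%R -> (g @^-1` W) q.2.
    by apply: (@cvg_snd _ _ (nbhs r) (nbhs s) _ _ HW).
  by apply: filterS => q qW [q1 q2]; exact: qW.
- by move=> r s r01 s01; apply: KA => //; exact: gA.
- by move=> s s01; have [] := K01 (g s) x (gA s s01) Ax.
- by move=> r r01; rewrite g0 g1; split; exact: Kx.
Qed.

End Contraction.

(** * Half-discs as sectorial neighbourhoods *)

Section HalfDisc.
Variable R : realType.
Local Notation C := R[i].
Implicit Types (z w x : C).

Lemma simply_connected_convexc (W : set C) : convexc W -> W !=set0 -> simply_connected R W.
Proof.
move=> Wc W0; apply: (@simply_connected_contract R C W (fun r x y => segpt x y r)) => //.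
- by move=> r x y r01 Wx Wy; exact: Wc.
- by move=> x y _ _; rewrite /segpt rmorph0 rmorph1 mul0r mul1r addr0 subrKC.
- by move=> r x _ _; rewrite /segpt subrr mulr0 addr0.
move=> r x y r01 Wx Wy; rewrite /segpt.
have c2 : {for (r, x), continuous (fun p : R * C => p.2)} by exact: cvg_snd.
apply: contD; first exact: c2.
apply: contM; last by apply: contB; [exact: cont_cst|exact: c2].
apply: (@cont_comp _ R C (real_complex R) (fun p : R * C => p.1) (r, x)).
  exact: continuous_real_complex.
exact: cvg_fst.
Qed.

Variable alpha : R.

Definition half_disc (rho : R) : set C :=
  [set z | 0 < Re (z * cis (- alpha)) /\ normc z < rho].

(** The half-disc with its arc of directions attached at [p.1 = 0]; it is the set that the blow-up
    clause of [sectorial_nbhd] asks for. *)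
Definition blown_half_disc (rho : R) : set (R * C) :=
  [set p | [/\ 0 <= p.1, p.1 < rho, normc p.2 = 1 & 0 < Re (p.2 * cis (- alpha))]].

Let ReZ (a : R) (z : C) : Re (a%:C * z) = a * Re z.
Proof. by rewrite cReM /= mul0r subr0. Qed.

Lemma cisK (a : R) : cis a * cis (- a) = 1 :> C.
Proof. by rewrite -cisD subrr /cis cos0 sin0. Qed.

Lemma convexc_half_disc rho : convexc (half_disc rho).
Proof.
move=> a b s [a1 a2] [b1 b2] s01; have := @convexc_ball R 0 rho a b s.
rewrite /= !subr0 => /(_ a2 b2 s01) h; split => //.
by rewrite segptM Re_segpt; exact: lt_convex.
Qed.

Lemma continuous_Re_mul (a z : C) : {for z, continuous (fun w => Re (w * a))}.
Proof.
apply: (@cont_comp C C R (@complex.Re R) (fun w => w * a) z); first exact: continuous_Re.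
apply: contM; [exact: cvg_id|exact: cont_cst].
Qed.

Lemma open_Re_mul (a : C) : open [set z | 0 < Re (z * a)].
Proof.
rewrite openE => z /= za; apply: (@continuous_Re_mul a z [set x | 0 < x]).
by apply: open_nbhs_nbhs; split; [exact: open_gt|exact: za].
Qed.

Lemma open_half_disc rho : open (half_disc rho).
Proof.
have -> : half_disc rho = [set z | 0 < Re (z * cis (- alpha))] `&` [set z | normc (z - 0) < rho].
  by apply/seteqP; split=> z; rewrite /half_disc /= subr0.
apply: openI; [exact: open_Re_mul|exact: open_ballc].
Qed.

Lemma half_disc_nonempty rho : 0 < rho -> half_disc rho ((rho / 2)%:C * cis alpha).
Proof.
move=> r0; split; first by rewrite -mulrA cisK mulr1 /= divr_gt0.
rewrite normcM normc_real normc_cis mulr1 gtr0_norm ?divr_gt0 //; lra.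
Qed.

Lemma simply_connected_blown rho : 0 < rho -> simply_connected R (blown_half_disc rho).
Proof.
move=> rho0.
pose v (r : R) (x y : C) := segpt x y r.
(* Radii are interpolated linearly, directions along the chord and then renormalised. The chord
   avoids 0 because both ends lie in one open half-plane. *)
pose K (r : R) (p q : R * C) : R * C :=
  ((1 - r) * p.1 + r * q.1, v r p.2 q.2 * ((normc (v r p.2 q.2))^-1)%:C).
have vr r p q : r \in `[0, 1] -> blown_half_disc rho p -> blown_half_disc rho q ->
    0 < Re (v r p.2 q.2 * cis (- alpha)) /\ v r p.2 q.2 != 0.
  move=> r01 [_ _ _ p4] [_ _ _ q4].
  have h : 0 < Re (v r p.2 q.2 * cis (- alpha)) by rewrite segptM Re_segpt; exact: lt_convex.
  by split => //; apply/eqP => v0; move: h; rewrite v0 mul0r ltxx.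
apply: (@simply_connected_contract R (R * C)%type _ K).
- have h : 0 < Re (cis alpha * cis (- alpha)) by rewrite cisK /= ltr01.
  by exists (0, cis alpha); split; [exact: lexx|exact: rho0|exact: normc_cis|exact: h].
- move=> r p q r01 pB qB; have [v1 v2] := vr r p q r01 pB qB.
  case: pB qB => p1 p2 p3 p4 [q1 q2 q3 q4]; move: (r01); rewrite in_itv /= => /andP[r0 r1].
  have n0 : 0 < normc (v r p.2 q.2) by rewrite normc_gt0.
  split.
  + by rewrite addr_ge0 // mulr_ge0 // subr_ge0.
  + have [E|rn] := eqVneq r 1; first by rewrite /K /= E subrr mul0r add0r mul1r.
    have r2 : 0 < 1 - r by rewrite subr_gt0 lt_def eq_sym rn.
    rewrite /K /=; have := ler_wpM2l r0 (ltW q2); rewrite -(ltr_pM2l r2) in p2; lra.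
  + by rewrite /K /= normcM normc_real gtr0_norm ?invr_gt0 // divff // gt_eqF.
  + by rewrite /K /= mulrAC mulrC ReZ mulr_gt0 // invr_gt0.
- move=> [p1 p2] [q1 q2] [_ _ p3 _] [_ _ q3 _]; rewrite /K /v /segpt /=.
  rewrite subr0 subrr rmorph0 rmorph1 !mul0r !mul1r add0r !addr0 subrKC.
  by move: p3 q3 => /= -> ->; rewrite invr1 rmorph1 !mulr1.
- move=> r [p1 p2] r01 [_ _ p3 _]; rewrite /K /v /segpt /= subrr mulr0 addr0.
  by move: p3 => /= ->; rewrite invr1 rmorph1 mulr1 -mulrDl subrK mul1r.
move=> r p q r01 pB qB; have [_ v2] := vr r p q r01 pB qB.
pose X := ((R * (R * C))%type : topologicalType).
have c1 : {for (r, p), continuous (fun x : X => x.1)} by exact: cvg_fst.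
have c2 : {for (r, p), continuous (fun x : X => x.2)} by exact: cvg_snd.
have c21 : {for (r, p), continuous (fun x : X => x.2.1)}.
  by apply: (@cont_comp X _ R fst (fun x : X => x.2) (r, p)); [exact: cvg_fst|exact: c2].
have c22 : {for (r, p), continuous (fun x : X => x.2.2)}.
  by apply: (@cont_comp X _ C snd (fun x : X => x.2) (r, p)); [exact: cvg_snd|exact: c2].
have cv : {for (r, p), continuous (fun x : X => v x.1 x.2.2 q.2)}.
  rewrite /v /segpt; apply: contD; first exact: c22.
  apply: contM; last by apply: contB; [exact: cont_cst|exact: c22].
  apply: (@cont_comp X R C (real_complex R) (fun x : X => x.1) (r, p)); last exact: c1.
  exact: continuous_real_complex.
rewrite /K; apply: cvg_pairs.
  apply: cvgD; apply: cvgM.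
  - by apply: cvgB; [exact: cvg_cst|exact: c1].
  - exact: c21.
  - exact: c1.
  - exact: cvg_cst.
apply: (@contM R X (fun x : X => v x.1 x.2.2 q.2)
  (fun x : X => ((normc (v x.1 x.2.2 q.2))^-1)%:C) (r, p) cv).
apply: (@cont_comp X R C (real_complex R) (fun x : X => (normc (v x.1 x.2.2 q.2))^-1) (r, p)).
  exact: continuous_real_complex.
apply: cvgV; first by rewrite gt_eqF // normc_gt0.
apply: (@cont_comp X C R (@normc R) (fun x : X => v x.1 x.2.2 q.2) (r, p)); last exact: cv.
exact: continuous_normc.
Qed.

Lemma Arc_piE u : Arc_pi alpha u <-> normc u = 1 /\ 0 < Re (u * cis (- alpha)).
Proof.
split.
  move=> [theta]; rewrite /= in_itv /= => /andP[t1 t2] <-; split; first exact: normc_cis.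
  by rewrite -cisD /= cos_gt0_pihalf //; apply/andP; split; lra.
move=> [u1 ur]; pose w := u * cis (- alpha).
have w1 : normc w = 1 by rewrite normcM u1 normc_cis mulr1.
have := sqr_normcE w; rewrite w1 expr1n => E.
have re2 : 0 < Re w ^+ 2 by rewrite exprn_gt0.
have i1 : -1 < Im w < 1.
  by rewrite -ltr_norml -(@ltr_pXn2r _ 2) ?nnegrE // expr1n real_normK ?num_real //; lra.
have /andP[i2 i3] := i1.
have i4 : -1 <= Im w <= 1 by rewrite (ltW i2) (ltW i3).
exists (alpha + asin (Im w)).
  have a1 := asin_ltpi2 (_ : -1 <= Im w < 1); have a2 := asin_gtNpi2 (_ : -1 < Im w <= 1).
  rewrite /= in_itv /=; apply/andP; split.
    by rewrite ltrD2l a2 // i2 ltW.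
  by rewrite ltrD2l a1 // i3 ltW.
have wE : cis (asin (Im w)) = w.
  rewrite /cis cos_asin // asinK ?in_itv //=.
  have -> : 1 - Im w ^+ 2 = Re w ^+ 2 by lra.
  by rewrite sqrtr_sqr gtr0_norm //; case: (w).
by rewrite cisD wE /w mulrCA cisK mulr1.
Qed.

Lemma half_disc_sectorial rho : 0 < rho -> sectorial_nbhd (Arc_pi alpha) (half_disc rho).
Proof.
move=> rho0; have ne := half_disc_nonempty rho0; split.
- split; [exact: open_half_disc|by eexists; exact: ne|].
  apply: (connected_joined (x := (rho / 2)%:C * cis alpha)) => y yS.
  by apply: convexc_component ne yS; exact: convexc_half_disc.
- apply: simply_connected_convexc; first exact: convexc_half_disc.
  by eexists; exact: ne.
- by case; rewrite mul0r /= ltxx.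
exists (blown_half_disc rho); split.
- by move=> p [p1 p2 p3 p4]; split => //=; rewrite normcE' p3.
- apply/open_subspaceP; exists [set p : R * C | p.1 < rho /\ 0 < Re (p.2 * cis (- alpha))].
    have -> : [set p : R * C | p.1 < rho /\ 0 < Re (p.2 * cis (- alpha))] =
        (fst @^-1` [set x | x < rho]) `&` (snd @^-1` [set z | 0 < Re (z * cis (- alpha))]) by [].
    apply: openI; apply: open_comp.
    + by move=> p _; exact: cvg_fst.
    + exact: open_lt.
    + by move=> p _; exact: cvg_snd.
    + exact: open_Re_mul.
  apply/seteqP; split => p /=.
    move=> [[h1 h2] [h3 h4]]; split; last by split.
    by split => //; move: h4; rewrite normcE' => -[].
  by move=> [[h1 h2 h3 h4] h5].
- exact: simply_connected_blown.
- apply/seteqP; split => [z [z1 z2]|_ [p [[p1 p2 p3 p4] p5] <-]].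
    have zn : 0 < normc z.
      by rewrite normc_gt0; apply/eqP => z0; move: z1; rewrite z0 mul0r /= ltxx.
    have zc : (normc z)%:C != 0 :> C by rewrite -normc_gt0 normc_real gtr0_norm.
    have zE : (normc z)%:C * (((normc z)^-1)%:C * z) = z.
      by rewrite realCV mulVKf.
    exists (normc z, ((normc z)^-1)%:C * z); last exact: zE.
    split; last exact: zn.
    split; [exact: ltW|exact: z2| |].
      by rewrite /= normcM normc_real gtr0_norm ?invr_gt0 // mulVf // gt_eqF.
    by rewrite /= -mulrA ReZ mulr_gt0 // invr_gt0.
  split; first by rewrite -mulrA ReZ mulr_gt0.
  by rewrite normcM p3 mulr1 normc_real gtr0_norm.
apply/seteqP; split => u; first by move=> /Arc_piE[u1 u2]; split.
by move=> [_ _ u1 u2]; apply/Arc_piE.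
Qed.

End HalfDisc.

(** * Existence *)

Section Coordinates.
Variables (R : realType) (alpha : R) (tc : R[i]).
Local Notation C := R[i].
Local Notation yC := (@yC R).
Local Notation phi0 := (phi0 R).
Implicit Types (z w x t : C).

Hypothesis tc5 : tc ^+ 5 = (25 / 6912)%:C * cis (2 * alpha).

Definition tau_sector : set C := [set tau | wedge (tau / tc)].
Definition t_sector : set C := [set proj_t x | x in tau_sector].
Local Notation V := tau_sector.
Local Notation U := t_sector.
Let tcc : C := proj_t tc.

Lemma realCn n : (n%:R)%:C = n%:R :> C. Proof. exact: rmorph_nat. Qed.

Lemma realC2512 : (25 / 6912)%:C = 25 / 6912 :> C.
Proof. by rewrite realCM realCV !realCn. Qed.

Lemma tc_neq0 : tc != 0.
Proof.
apply/eqP => E; move/eqP: tc5; rewrite E expr0n /= eq_sym mulf_eq0.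
have -> : (cis (2 * alpha) == 0 :> C) = false by apply/negbTE; rewrite cis_cexp cexp_neq0.
by rewrite orbF realC2512 mulf_eq0 invr_eq0 !pnatr_eq0.
Qed.

Lemma tcc_neq0 : tcc != 0.
Proof. by rewrite /tcc /proj_t mulf_neq0 ?oppr_eq0 ?pnatr_eq0 // expf_neq0 // tc_neq0. Qed.

Definition sect : set C := [set x | uhp x /\ Im (clog x) < 2 * phi0].

Definition tauf t : C := tc * cpow (1 / 2) (t / tcc).
Definition Zf t : C := cpow (5 / 4) (t / tcc).

(** The power [5 / 4] opens the sector of angle [2 * phi0] exactly onto the upper half-plane. *)
Lemma phi0_5 : 5 / 4 * (2 * phi0) = pi.
Proof. by rewrite /phi0; field. Qed.

Lemma sect_tauf t : sect (t / tcc) -> V (tauf t) /\ proj_t (tauf t) = t.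
Proof.
move=> [xu xs]; have /andP[f0 fp] := phi0_bounds R.
split; last first.
  rewrite /proj_t /tauf exprMn cpowX.
  have -> : 2%:R * (1 / 2) = 1 :> R by field.
  by rewrite cpow1 // mulrA -/(proj_t tc) -/tcc mulrC divfK // tcc_neq0.
apply/wedgeP; exists ((1 / 2 : R)%:C * clog (t / tcc)); split; last first.
  by rewrite /tauf mulrAC divff ?mul1r // tc_neq0.
have /andP[a0 a1] := clog_arg xu.
by rewrite cImM /= mul0r addr0; rewrite /= in a0 a1 xs; apply/andP; split; lra.
Qed.

Lemma t_sectorP t : U t <-> sect (t / tcc).
Proof.
have /andP[f0 fp] := phi0_bounds R; have p5 := phi0_5; split.
  move=> [tau /wedgeP[w [/andP[w0 w1] tw]] <-].
  have -> : proj_t tau / tcc = cexp (w + w).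
    rewrite cexpD -tw /tcc /proj_t; field.
    by rewrite tc_neq0 ?oppr_eq0 ?pnatr_eq0.
  have h : 0 < Im (w + w) < pi by rewrite cImD; apply/andP; split; lra.
  by split; [exact: uhp_cexp|rewrite cexpK // cImD; lra].
by move=> /sect_tauf [Vt tE]; exists (tauf t).
Qed.

Lemma tauf_proj t : U t -> V (tauf t) /\ proj_t (tauf t) = t.
Proof. by move=> /t_sectorP; exact: sect_tauf. Qed.

Lemma open_sect : open sect.
Proof.
rewrite openE => x [xu xs].
have cl : {for x, continuous (fun w => Im (clog w))}.
  apply: (@cont_comp C C R (@complex.Im R) (@clog R) x); first exact: continuous_Im.
  exact: hd_continuous (hd_clog xu).
have N1 : \forall w \near x, uhp w by apply: open_nbhs_nbhs; split; [exact: open_uhp|exact: xu].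
have N2 : \forall w \near x, Im (clog w) < 2 * phi0.
  apply: (cl [set a | a < 2 * phi0]); apply: open_nbhs_nbhs.
  by split; [exact: open_lt|exact: xs].
exact: filterI N1 N2.
Qed.

Lemma continuous_div (a t : C) : {for t, continuous (fun s : C => s / a)}.
Proof. apply: contM; [exact: cvg_id|exact: cont_cst]. Qed.

Lemma open_t_sector : open U.
Proof.
have -> : U = (fun t => t / tcc) @^-1` sect by apply/seteqP; split => t /t_sectorP.
by apply: open_comp; [move=> t _; exact: continuous_div|exact: open_sect].
Qed.

Lemma hd_div (a t : C) : hd (fun s : C => s / a) t a^-1.
Proof.
have := dvM (@id_continuous R) (dv_emb id t) (dv_cst id a^-1 t).
by apply: dv_eq; rewrite mul1r mulr0 addr0.
Qed.

Lemma U_neq0 t : U t -> t != 0.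
Proof.
move=> /t_sectorP[/uhp_neq0 + _]; apply: contraNneq => ->; by rewrite mul0r.
Qed.

Lemma hd_cpow_div a t : U t ->
  hd (fun s => cpow a (s / tcc)) t (a%:C * cpow a (t / tcc) / t).
Proof.
move=> Ut; have [xu _] := (t_sectorP t).1 Ut; have t0 := U_neq0 Ut.
have := @hd_comp R (cpow a) (fun s : C => s / tcc) t _ _ (hd_cpow a xu) (hd_div tcc t).
apply: dv_eq; have := tcc_neq0; move: tcc => c c0; field.
by rewrite t0 c0.
Qed.

Lemma hd_tauf t : U t -> hd tauf t (tauf t / (2 * t)).
Proof.
move=> Ut; have t0 := U_neq0 Ut.
have := dvZ (@id_continuous R) tc (hd_cpow_div (1 / 2) Ut).
apply: dv_eq; rewrite /tauf realCM realCV (realCn 2) (realCn 1).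
move: (cpow _ _) => p; field.
by rewrite ?t0 ?pnatr_eq0.
Qed.

Lemma hd_Zf t : U t -> hd Zf t (5 / 4 * Zf t / t).
Proof.
move=> Ut; apply: dv_eq (hd_cpow_div (5 / 4) Ut).
by rewrite realCM realCV (realCn 5) (realCn 4).
Qed.

Lemma tauf_sqr t : U t -> t = - 6 * tauf t ^+ 2.
Proof. by move=> /tauf_proj[_ E]; rewrite -{1}E. Qed.

Lemma tauf_neq0 t : tauf t != 0.
Proof. by rewrite mulf_neq0 ?tc_neq0 // cpow_neq0. Qed.

Lemma Zf_neq0 t : Zf t != 0. Proof. exact: cpow_neq0. Qed.

Lemma Zf_uhp t : U t -> uhp (Zf t).
Proof.
move=> /t_sectorP[xu xs]; apply: cpow_uhp; have /andP[a0 a1] := clog_arg xu.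
by have := phi0_5; rewrite /= in a0 a1 xs *; move=> p; apply/andP; split; lra.
Qed.

Lemma tauf_pow5 t : tauf t ^+ 5 = 25 / 6912 * cis (2 * alpha) * Zf t ^+ 2.
Proof.
have E x : cpow (1 / 2) x ^+ 5 = cpow (5 / 4) x ^+ 2.
  rewrite !cpowX; have -> : 5%:R * (1 / 2) = 2%:R * (5 / 4) :> R by field.
  by [].
by rewrite /tauf /Zf exprMn tc5 (E (t / tcc)) realC2512.
Qed.

Lemma cis_sqr : cis alpha ^+ 2 = cis (2 * alpha) :> C.
Proof. by rewrite expr2 -cisD; congr cis; ring. Qed.

Lemma cis_neq0 (a : R) : cis a != 0 :> C.
Proof. by rewrite cis_cexp cexp_neq0. Qed.

(* The normalisation of [tc] is what makes this constant equal to 12. *)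
Lemma scale_identity t : U t ->
  tauf t / t ^+ 2 * (25 / 16) * (cis alpha * Zf t) ^+ 2 = 12 * tauf t ^+ 2.
Proof.
move=> Ut; have E := tauf_pow5 t; have T := tauf_sqr Ut; have n0 := tauf_neq0 t.
rewrite exprMn cis_sqr {2}T; move: E n0.
move: (tauf t) (Zf t ^+ 2) (cis (2 * alpha)) => u v c E u0.
have -> : u / (- 6 * u ^+ 2) ^+ 2 * (25 / 16) * (c * v) =
  12 * (25 / 6912 * c * v) / u ^+ 3.
  by field; rewrite ?u0 ?pnatr_eq0.
by rewrite -E; field; rewrite ?u0 ?pnatr_eq0.
Qed.

Lemma near_U t : U t -> \forall s \near t, U s.
Proof. by move=> Ut; apply: open_nbhs_nbhs; split; [exact: open_t_sector|exact: Ut]. Qed.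

(** With [theta = t d/dt], [t^2 d^2/dt^2] is [theta (theta - 1)]. The factor [tauf], of degree 1/2
    in [t], turns it into [D^2 - 1/4] acting on [Y], where [D = (5/4) z d/dz]. *)
Lemma second_derivative (F : C -> C) (h : C) (Y g : C -> C) (k : C) t : U t -> h != 0 ->
  (forall s, U s -> F s = tauf s * Y (Zf s / h)) ->
  (\forall z \near Zf t / h, hd Y z (g z)) -> hd g (Zf t / h) k ->
  derive1n 2 F t =
    tauf t / t ^+ 2 * (25 / 16 * ((Zf t / h) ^+ 2 * k + Zf t / h * g (Zf t / h)) -
      Y (Zf t / h) / 4).
Proof.
move=> Ut h0 FE Yg gk; have ic := @id_continuous R; have t0 := U_neq0 Ut.
pose z s := Zf s / h.
have dz s : U s -> hd z s (5 / 4 * z s / s).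
  move=> Us; have := dvM ic (hd_Zf Us) (dv_cst id h^-1 s).
  by apply: dv_eq; rewrite /z; ring.
pose G1 s := tauf s / (2 * s) * Y (z s) + tauf s * (g (z s) * (5 / 4 * z s / s)).
apply: (@derive1n2_hd R _ G1).
  have cz : {for t, continuous z} by exact: hd_continuous (dz t Ut).
  have N : \forall s \near t, hd Y (z s) (g (z s)) by exact: (cz _ Yg).
  apply: filterS (filterI (near_U Ut) N) => s [Us sY].
  apply: near_hd (dvM ic (hd_tauf Us) (@hd_comp R Y z s _ _ sY (dz s Us))).
  by apply: filterS (near_U Us) => w /FE.
have Yt : hd Y (z t) (g (z t)) by exact: nbhs_singleton Yg.
have d1 := hd_tauf Ut; have d2 := dz t Ut.
have d3 := @hd_comp R Y z t _ _ Yt d2; have d4 := @hd_comp R g z t _ _ gk d2.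
have di : hd (fun s : C => s^-1) t (- t ^- 2).
  have := dvV ic (dv_emb id t) t0; apply: dv_eq.
  by rewrite mulN1r.
have d5 : hd (fun s => tauf s / (2 * s)) t (tauf t / (2 * t) * (2 * t)^-1 + tauf t * (2^-1 * - t ^- 2)).
  have -> : (fun s => tauf s / (2 * s)) = (fun s => tauf s * (2^-1 * s^-1)).
    by apply/funext => s; rewrite invfM.
  have := dvM ic d1 (dvZ ic 2^-1 di); apply: dv_eq.
  by rewrite -invfM.
have d6 : hd (fun s => 5 / 4 * z s / s) t (5 / 4 * (5 / 4 * z t / t) / t + 5 / 4 * z t * - t ^- 2).
  exact: (@dvM R C id ic (fun s => 5 / 4 * z s) (fun s => s^-1) t _ _
    (@dvZ R C id ic (5 / 4) z t _ d2) di).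
have := dvD (dvM ic d5 d3) (dvM ic d1 (dvM ic d4 d6)).
apply: dv_eq; rewrite -/(z t).
move: (tauf t) (z t) (Y _) (g _) => u v y b.
by field; rewrite t0 ?pnatr_eq0.
Qed.

Section FormalSolution.
Variable qhat : nat -> C -> C.
Hypothesis qhat_branch : distinguished_branch V qhat.

(** Each coefficient is homogeneous in [t], so its recursion reduces to the one for [yC]. The
    unknown enters it with the factor [12 * tauf t], which is nonzero; for order 1 this forces 0. *)
Lemma qhat_eq n t : U t -> qhat n t = tauf t * (yC n * (Zf t * cis alpha)^-1 ^+ n).
Proof.
have [[_ q01 q2] q0] := qhat_branch; have ic := @id_continuous R.
have q0E t' : U t' -> qhat 0 t' = tauf t'.
  by move=> /tauf_proj[v E]; rewrite -{1}E q0.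
elim/ltn_ind: n t => -[|[|n]] IH t Ut.
- by rewrite expr0 mulr1 /yC ycoef0 mulr1; exact: q0E.
- have := q01 t Ut 1%N isT; rewrite addr0 !big_ord_recr big_ord0 /= add0r subn0 subnn q0E //.
  rewrite /yC ycoef1 mul0r mulr0 => /esym/eqP; rewrite mulf_eq0 pnatr_eq0 /=.
  by rewrite [qhat _ _ * _]mulrC -mulr2n mulrn_eq0 /= mulf_eq0 (negbTE (tauf_neq0 t)) /= => /eqP.
have c0 := cis_neq0 (- alpha); have cE : (cis (- alpha))^-1 = cis alpha :> C.
  by apply: (mulIf c0); rewrite mulVf // cisK.
(* Taking [h = cis (- alpha)] lets [second_derivative] apply to a single coefficient, with the
   monomial [yC n * w^-1 ^+ n] in the role of [Y]. *)
pose z := Zf t / cis (- alpha); have zE : z = Zf t * cis alpha by rewrite /z cE.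
have z0 : z != 0 by rewrite zE mulf_neq0 ?Zf_neq0 ?cis_neq0.
have := q2 t Ut n.
rewrite (@second_derivative _ (cis (- alpha)) (fun w => yC n * w^-1 ^+ n)
  (fun w => yC n * (- n%:R * w^-1 ^+ n.+1)) (yC n * (- n%:R * (- n.+1%:R * z^-1 ^+ n.+2)))) //;
  first last.
- exact: (@dvZ R C id ic (yC n) (fun w => - n%:R * w^-1 ^+ n.+1) z _
    (@dvZ R C id ic (- n%:R) (fun w => w^-1 ^+ n.+1) z _ (hd_invX n.+1 z0))).
- apply/nbhs_normcP; exists (normc z) => [|w wz]; first by rewrite normc_gt0.
  have w0 : w != 0 by apply/eqP => w0; move: wz; rewrite w0 sub0r normcN -/z ltxx.
  exact: (@dvZ R C id ic (yC n) (fun w => w^-1 ^+ n) w _ (hd_invX n w0)).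
- by move=> s Us; rewrite (IH n (leqnSn n.+1) s Us) cE.
rewrite -/z big_ord_recl big_ord_recr /= subn0 subnn q0E // /bump /= !add1n.
have -> : \sum_(i < n.+1) qhat (1 + i)%N t * qhat (n.+2 - (1 + i))%N t =
    tauf t ^+ 2 * z^-1 ^+ n.+2 * \sum_(i < n.+1) yC i.+1 * yC (n.+1 - i).
  rewrite mulr_sumr; apply: eq_bigr => i _; have iN := ltn_ord i.
  rewrite add1n subSS !IH //; last by rewrite ltnS leq_subr.
  rewrite -zE.
  have -> : z^-1 ^+ n.+2 = z^-1 ^+ i.+1 * z^-1 ^+ (n.+1 - i).
    by rewrite -exprD addSn subnKC // ltnW.
  ring.
have S := yC_S R n; have sc := scale_identity Ut.
have {}S : \sum_(i < n.+1) yC i.+1 * yC (n.+1 - i) =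
    2 * ((n%:R ^+ 2 - 4 / 25) * yC n) - 2 * yC n.+2 by rewrite -S; ring.
rewrite [cis alpha * _]mulrC -zE in sc.
have e1 := exprS z^-1 n; have e2 := exprS z^-1 n.+1; rewrite e1 in e2.
rewrite S -zE e2 e1 -[n.+1%:R]natr1 => E.
have tau0 := tauf_neq0 t; have t0 := U_neq0 Ut.
have z2 : z ^+ 2 != 0 by rewrite expf_neq0.
have K : tauf t / t ^+ 2 * (25 / 16) = 12 * tauf t ^+ 2 / z ^+ 2.
  by rewrite -sc mulfK.
have t12 : 12 * tauf t != 0 by rewrite mulf_neq0 // pnatr_eq0.
apply: (mulfI t12).
move: E K z0 tau0.
move: (z^-1 ^+ n) (yC n) (yC n.+2) (n%:R) (tauf t) (qhat _ _) => X y y2 N u q E K z0 u0.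
set L := (X in X = _) in E; set A := u ^+ 2 * _ * _ in E.
have EL : L = 12 * u ^+ 2 / z ^+ 2 * ((N ^+ 2 - 4 / 25) * y * X).
  by rewrite -K /L; field; rewrite z0 t0 ?pnatr_eq0.
have -> : 12 * u * q = 6 * (u * q + (A + q * u)) - 6 * A by ring.
by rewrite -E EL /A; field; rewrite z0 ?pnatr_eq0.
Qed.

End FormalSolution.

End Coordinates.

Section SectorGeometry.
Variable R : realType.
Local Notation C := R[i].
Implicit Types (z h : C) (m : R).

(** The sign [e] is that of [Re z] for [z = Z / h]. When [Im z] is negative,
    [Im Z = Re z * Im h + Im z * Re h] is at most [|Re z|] times the modulus of [h], so
    [|Re z| >= 2 * m * normc z] and the level stays above [m * normc z]. *)
Lemma hp_sector m (Z h : C) : 0 < m -> m <= 1 / 2 -> 0 < Re h ->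
  2 * m * normc Z <= Im Z -> 32 / m ^+ 2 < normc (Z / h) ->
  exists e : R, [/\ e ^+ 2 = 1, hp m e (Z / h) &
    m * normc (Z / h) <= e * Re (Z / h) + m * Im (Z / h)].
Proof.
move=> m0 m2 h0 Zm; set z := Z / h => zm.
have hn : h != 0 by apply/eqP => E; move: h0; rewrite E /= ltxx.
have hp0 : 0 < normc h by rewrite normc_gt0.
have ZE : Z = z * h by rewrite divfK.
have lev : m * normc z <= `|Re z| + m * Im z.
  have n1 := normc_leD z; have n2 := normc_ge0 z.
  have [y0|y0] := leP 0 (Im z).
    have := ler_wpM2l (ltW m0) n1; rewrite (ger0_norm y0) mulrDr.
    have : m * `|Re z| <= `|Re z| by rewrite ler_piMl //; lra.
    lra.
  have : 2 * m * normc z * normc h <= `|Re z| * normc h.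
    move: Zm; rewrite ZE normcM mulrA => H; apply: le_trans H _.
    rewrite cImM; apply: le_trans (_ : Re z * Im h <= _).
      by rewrite gerDl mulr_le0_ge0 // ltW.
    apply: le_trans (ler_norm _) _; rewrite normrM ler_wpM2l //; exact: normc_Im.
  rewrite ler_pM2r // => H.
  have := normc_Im z; rewrite ltr0_norm // => H2.
  have := ler_wpM2l (ltW m0) H2; lra.
have [e [e2 eE]] : exists e : R, e ^+ 2 = 1 /\ e * Re z = `|Re z|.
  have [x0|x0] := leP 0 (Re z).
    by exists 1; rewrite expr1n mul1r ger0_norm.
  by exists (-1); rewrite sqrrN expr1n mulN1r ltr0_norm.
exists e; rewrite eE; split => //.
rewrite /hp /= eE; apply: lt_le_trans lev.
have -> : 32 / m = m * (32 / m ^+ 2) by field; rewrite gt_eqF.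
by rewrite ltr_pM2l.
Qed.

End SectorGeometry.

(** * The domain of the solution and its connectedness *)

Section Existence.
Variables (R : realType) (alpha : R) (tc : R[i]).
Local Notation C := R[i].
Local Notation yC := (@yC R).
Local Notation U := (t_sector tc).
Local Notation tcc := (proj_t tc).
Local Notation tauf := (tauf tc).
Local Notation Zf := (Zf tc).
Implicit Types (z w x t : C).

Hypothesis tc5 : tc ^+ 5 = (25 / 6912)%:C * cis (2 * alpha).

Definition Omega : set C :=
  [set z | exists m e : R, [/\ 0 < m, m <= 1, e ^+ 2 = 1 & hp m e z]].

Definition hh (hbar : C) : C := hbar * cis (- alpha).
Definition zf (p : C * C) : C := Zf p.1 / hh p.2.
Definition Dom : set (C * C) := [set p | [/\ U p.1, 0 < Re (hh p.2) & Omega (zf p)]].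

Lemma open_Omega : open Omega.
Proof.
rewrite openE => z [m [e [m0 m1 e2 zh]]].
have N : \forall w \near z, hp m e w.
  by apply: open_nbhs_nbhs; split; [exact: open_hp|exact: zh].
by apply: filterS N => w wh; exists m, e.
Qed.

Lemma near_Omega z : Omega z -> \forall w \near z, Omega w.
Proof. by move=> zo; apply: open_nbhs_nbhs; split; [exact: open_Omega|exact: zo]. Qed.

Lemma Im_realM (a : R) z : Im (a%:C * z) = a * Im z.
Proof. by rewrite cImM /= mul0r addr0. Qed.

Lemma Re_neq0 z : 0 < Re z -> z != 0.
Proof. by move=> z0; apply/eqP => E; move: z0; rewrite E /= ltxx. Qed.

(** The half-planes do not contain 0, so enlarging [z] keeps it inside; in the domain this means
    that [hbar] may be shrunk along its ray. *)
Lemma Omega_scale z (c : R) : 1 <= c -> Omega z -> Omega (c%:C * z).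
Proof.
move=> c1 [m [e [m0 m1 e2 zh]]]; exists m, e; split => //.
have -> : hp m e (c%:C * z) = (32 / m < c * (e * Re z + m * Im z)) :> Prop.
  by rewrite /hp /= cReM cImM /=; congr is_true; congr (_ < _); ring.
have l0 : 0 < e * Re z + m * Im z by apply: lt_trans zh; rewrite divr_gt0.
by apply: lt_le_trans zh _; rewrite ler_peMl // ltW.
Qed.

Lemma continuous_hh hbar : {for hbar, continuous hh}.
Proof. apply: contM; [exact: cvg_id|exact: cont_cst]. Qed.

Lemma continuous_zf p : U p.1 -> hh p.2 != 0 -> {for p, continuous zf}.
Proof.
move=> Up hp0; apply: contM.
  apply: (@cont_comp (C * C)%type C C Zf fst p); last exact: cvg_fst.
  exact: hd_continuous (hd_Zf tc5 Up).
apply: contV; first exact: hp0.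
apply: (@cont_comp (C * C)%type C C hh snd p); last exact: cvg_snd.
exact: continuous_hh.
Qed.

Lemma open_Dom : open Dom.
Proof.
rewrite openE => p [Up hp0 zo].
have h0 := Re_neq0 hp0.
have N1 : \forall q \near p, U q.1.
  have c1 : {for p, continuous (fun q : C * C => q.1)} by exact: cvg_fst.
  exact: (c1 _ (near_U tc5 Up)).
have N2 : \forall q \near p, 0 < Re (hh q.2).
  have c2 : {for p, continuous (fun q : C * C => q.2)} by exact: cvg_snd.
  apply: (c2 [set h | 0 < Re (hh h)]); apply: open_nbhs_nbhs.
  by split; [exact: open_Re_mul|exact: hp0].
have N3 : \forall q \near p, Omega (zf q) by exact: (continuous_zf Up h0 (near_Omega zo)).
by apply: filterS (filterI N1 (filterI N2 N3)) => q [a [b c]].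
Qed.

Definition Dom' : set (C * C) := [set p | [/\ uhp p.1, 0 < Re p.2 & Omega (p.1 / p.2)]].

Lemma segment_component (A : set (C * C)) (p q : C * C) :
  (forall s, s \in `[0, 1] -> A (segpt p.1 q.1 s, segpt p.2 q.2 s)) ->
  connected_component A p q.
Proof.
move=> H; apply: (@joined_component _ R A (fun s => (segpt p.1 q.1 s, segpt p.2 q.2 s))) => //.
- apply: continuous_subspaceT => s; apply: cvg_pairs.
    exact: (rd_continuous (rd_affine p.1 (q.1 - p.1) s)).
  exact: (rd_continuous (rd_affine p.2 (q.2 - p.2) s)).
- by case: p {H} => a b; rewrite /segpt rmorph0 !mul0r !addr0.
- by case: q {H} => a b; rewrite /segpt rmorph1 !mul1r !subrKC.
Qed.

Lemma Dom'_scale Z h (l : R) : 0 < l -> l <= 1 -> Dom' (Z, h) ->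
  connected_component Dom' (Z, h) (Z, l%:C * h).
Proof.
move=> l0 l1 [/= Zu h0 Zh]; apply: segment_component => s s01.
have -> : segpt (Z, h).1 (Z, l%:C * h).1 s = Z by rewrite /segpt /= subrr mulr0 addr0.
pose k := 1 - s + s * l; have [k0 k1] : 0 < k /\ k <= 1.
  move: s01; rewrite in_itv /= /k => /andP[s0 s1]; split.
    have [->|sn] := eqVneq s 1; first by rewrite subrr add0r mul1r.
    apply: ltr_wpDr; first by rewrite mulr_ge0 // ltW.
    by rewrite subr_gt0 lt_def eq_sym sn.
  have : s * l <= s by rewrite ler_piMr.
  by lra.
have -> : segpt (Z, h).2 (Z, l%:C * h).2 s = k%:C * h.
  have -> : k%:C = (1 - s%:C) + s%:C * l%:C by rewrite -realCM -onem_complex -rmorphD.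
  by rewrite /segpt /=; ring.
split => /=; first exact: Zu.
  by rewrite cReM /= mul0r subr0 mulr_gt0.
have -> : Z / (k%:C * h) = (k^-1)%:C * (Z / h).
  by rewrite realCV invfM; ring.
by apply: Omega_scale Zh; rewrite invf_ge1.
Qed.

(** [Omega] is a union of many half-planes, so straight segments may leave the set. Shrinking the
    second coordinate at both ends first makes all quotients large, and then [hp_sector] covers the
    whole segment with one slope. *)
Lemma connected_Dom' : connected Dom'.
Proof.
pose Z0 : C := 0 +i* 33.
have base : Dom' (Z0, 1).
  split; [by rewrite /uhp /=|by rewrite /= ltr01|].
  exists 1, 1; split; rewrite ?expr1n //.
  by rewrite divr1 /hp /= mulr0 add0r mul1r divr1 ltr_nat.
apply: (@connected_joined _ Dom' (Z0, 1)) => -[Z h] Zh.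
have [/= Zu h0 zo] := Zh.
(* [mu], [M] and [N] control [Im Z], [normc Z] and [normc h] along the segment. [m] is chosen with
   [2 * m * M = mu], and [l] with [mu / (l * N) = 64 / m ^+ 2 + mu / N], above the threshold
   [32 / m ^+ 2]. *)
pose mu := Num.min (Im Z0) (Im Z).
have mu0 : 0 < mu by rewrite lt_min; apply/andP; split; [rewrite /=|exact: Zu].
have muZ0 : mu <= Im Z0 by rewrite ge_min lexx.
have muZ : mu <= Im Z by rewrite ge_min lexx orbT.
pose M := normc Z0 + normc Z; pose N := 1 + normc h.
have M0 : mu <= M.
  have := normc_Im Z0; have := ler_norm (Im Z0); have := normc_ge0 Z; rewrite /M; lra.
have Mp : 0 < M by exact: lt_le_trans M0.
have N0 : 0 < N by rewrite /N ltr_wpDr // normc_ge0.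
pose m := mu / (2 * M).
have m0 : 0 < m by rewrite divr_gt0 // mulr_gt0.
have m2 : m <= 1 / 2 by rewrite /m ler_pdivrMr ?mulr_gt0 //; lra.
have mm : 0 < mu * m ^+ 2 by rewrite mulr_gt0 // exprn_gt0.
pose l := mu * m ^+ 2 / (mu * m ^+ 2 + 64 * N).
have d0 : 0 < mu * m ^+ 2 + 64 * N by rewrite addr_gt0 // mulr_gt0.
have l0 : 0 < l by rewrite divr_gt0.
have l1 : l <= 1 by rewrite ler_pdivrMr // mul1r lerDl mulr_ge0 // ltW.
apply: (@connected_component_trans _ Dom' (Z0, l%:C * 1)).
  exact: Dom'_scale.
apply: (@connected_component_trans _ Dom' (Z, l%:C * h)); last first.
  by apply: connected_component_sym; exact: Dom'_scale.
apply: segment_component => s s01.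
change (Dom' (segpt Z0 Z s, segpt (l%:C * 1) (l%:C * h) s)).
move: (s01); rewrite in_itv /= => /andP[s0 s1].
have hE : segpt (l%:C * 1) (l%:C * h) s = l%:C * segpt 1 h s by rewrite /segpt; ring.
have ImZ : mu <= Im (segpt Z0 Z s).
  rewrite Im_segpt; have s1' : 0 <= 1 - s by rewrite subr_ge0.
  have := ler_wpM2l s1' muZ0; have := ler_wpM2l s0 muZ; lra.
have nZ : normc (segpt Z0 Z s) <= M by exact: normc_segpt.
have nh : normc (segpt 1 h s) <= N.
  by apply: le_trans (normc_segpt _ _ s01) _; rewrite normc1.
have Reh : 0 < Re (segpt 1 h s) by rewrite Re_segpt; apply: lt_convex => //=; exact: ltr01.
have Rel : 0 < Re (l%:C * segpt 1 h s).
  by rewrite cReM [Im _]/= mul0r subr0 mulr_gt0.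
have [||e [e2 zh _]] := @hp_sector R m (segpt Z0 Z s) (l%:C * segpt 1 h s) m0 m2 Rel.
- apply: le_trans ImZ; apply: le_trans (ler_wpM2l _ nZ) _; first by rewrite mulr_ge0 // ltW.
  by rewrite le_eqVlt; apply/orP; left; apply/eqP; rewrite /m; field; rewrite gt_eqF.
- rewrite !normcM normcV normcM normc_real gtr0_norm //.
  set n := normc (segpt 1 h s) in nh *; have n0 : 0 < n by rewrite normc_gt0; exact: Re_neq0.
  have hz : mu <= normc (segpt Z0 Z s).
    by apply: le_trans ImZ _; apply: le_trans (ler_norm _) (normc_Im _).
  apply: lt_le_trans (_ : mu / (l * N) <= _); last first.
    apply: ler_pM => //; [exact: ltW|by rewrite invr_ge0 mulr_ge0 // ltW|].
    have ln : l * n <= l * N by rewrite ler_pM2l.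
    by rewrite lef_pV2 ?posrE //; exact: mulr_gt0.
  have -> : mu / (l * N) = 64 / m ^+ 2 + mu / N.
    by rewrite /l; field; rewrite !gt_eqF.
  have := divr_gt0 mu0 N0; have : 32 / m ^+ 2 < 64 / m ^+ 2.
    by rewrite ltr_pM2r ?invr_gt0 ?exprn_gt0 // ltr_nat.
  by lra.
rewrite hE; split; [by rewrite /uhp /=; exact: lt_le_trans ImZ|exact: Rel|].
by exists m, e; split => //; lra.
Qed.

Lemma Zf_inverse Z : uhp Z -> U (tcc * cpow (4 / 5) Z) /\ Zf (tcc * cpow (4 / 5) Z) = Z.
Proof.
move=> Zu; have /andP[a0 a1] := clog_arg Zu; have t0 := tcc_neq0 tc5.
have E : tcc * cpow (4 / 5) Z / tcc = cpow (4 / 5) Z by rewrite mulrC mulKf.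
have p0 := pi_gt0 R.
have b : 0 < 4 / 5 * Im (clog Z) < pi by apply/andP; split; lra.
split.
  apply/(t_sectorP tc5); rewrite E; split; first exact: cpow_uhp.
  rewrite cpow_log // Im_realM /phi0; lra.
rewrite /Zf E cpow_pow //.
have -> : 5 / 4 * (4 / 5) = 1 :> R by field.
exact: cpow1.
Qed.

Lemma t_of_Zf t : U t -> tcc * cpow (4 / 5) (Zf t) = t.
Proof.
move=> Ut; have [xu xs] := (t_sectorP tc5 t).1 Ut; have /andP[a0 a1] := clog_arg xu.
have p5 := phi0_5 R; rewrite /Zf cpow_pow.
  have -> : 4 / 5 * (5 / 4) = 1 :> R by field.
  by rewrite cpow1 // mulrC divfK // (tcc_neq0 tc5).
by rewrite /= in a0 a1 xs *; apply/andP; split; lra.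
Qed.

Lemma hhK h : hh (cis alpha * h) = h.
Proof. by rewrite /hh mulrAC cisK mul1r. Qed.

Lemma hhE hbar : cis alpha * hh hbar = hbar.
Proof. by rewrite /hh mulrCA cisK mulr1. Qed.

Lemma connected_Dom : connected Dom.
Proof.
pose Phi (p : C * C) : C * C := (tcc * cpow (4 / 5) p.1, cis alpha * p.2).
have -> : Dom = Phi @` Dom'.
  apply/seteqP; split=> [[t hbar] [/= Ut h0 zo]|_ [[Z h] [/= Zu h0 zo] <-]].
    exists (Zf t, hh hbar); first by split => //; exact: Zf_uhp tc5 _ Ut.
    by rewrite /Phi /= t_of_Zf // hhE.
  have [Ut ZE] := Zf_inverse Zu; split; rewrite /Phi /=.
  - exact: Ut.
  - by rewrite hhK.
  - by rewrite /zf /= ZE hhK.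
apply: connected_continuous_connected; first exact: connected_Dom'.
apply/subspace_continuousP => -[Z h] [/= Zu _ _]; apply: cvg_within_filter.
apply: cvg_pairs.
  apply: (@contM R (C * C)%type (fun=> tcc) (fun p : C * C => cpow (4 / 5) p.1) (Z, h)).
    exact: cont_cst.
  apply: (@cont_comp (C * C)%type C C (cpow (4 / 5)) fst (Z, h)); last exact: cvg_fst.
  exact: hd_continuous (hd_cpow (4 / 5) Zu).
apply: (@contM R (C * C)%type (fun=> cis alpha) (fun p : C * C => p.2) (Z, h)).
  exact: cont_cst.
exact: cvg_snd.
Qed.

Lemma Dom_nonempty : Dom !=set0.
Proof.
have Zu : uhp (0 +i* 33 : C) by rewrite /uhp /=.
have [Ut ZE] := Zf_inverse Zu; exists (tcc * cpow (4 / 5) (0 +i* 33), cis alpha * 1).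
split; [exact: Ut|by rewrite hhK /= ltr01|rewrite /zf /= ZE hhK].
exists 1, 1; split; rewrite ?expr1n //.
by rewrite divr1 /hp /= mulr0 add0r mul1r divr1 ltr_nat.
Qed.

Lemma domain_Dom : domain Dom.
Proof. by split; [exact: open_Dom|exact: Dom_nonempty|exact: connected_Dom]. Qed.

End Existence.

(** * The solution and its asymptotics *)

Section Solution.
Variables (R : realType) (alpha : R) (tc : R[i]).
Local Notation C := R[i].
Local Notation yC := (@yC R).
Local Notation U := (t_sector tc).
Local Notation tcc := (proj_t tc).
Local Notation tauf := (tauf tc).
Local Notation Zf := (Zf tc).
Local Notation hh := (hh alpha).
Local Notation zf := (zf alpha tc).
Local Notation Dom := (Dom alpha tc).
Implicit Types (z w x t : C).

Hypothesis tc5 : tc ^+ 5 = (25 / 6912)%:C * cis (2 * alpha).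

Variables f g : C -> C.
Hypothesis fgH : forall m e, 0 < m -> m <= 1 -> e ^+ 2 = 1 ->
  boutroux (hp m e) f g /\
  forall z, hp m e z -> normc (f z) <= m / 32 /\ normc (g z) <= m / 32.

Definition qsol (p : C * C) : C := tauf p.1 * (1 + f (zf p)).

Lemma Omega_boutroux z : Omega z -> hd f z (g z) /\ hd g z (f z + bN z (f z) (g z)).
Proof. by move=> [m [e [m0 m1 e2 zh]]]; have [S _] := fgH m0 m1 e2; exact: S. Qed.

Lemma differentiable_fst (p : C * C) : differentiable (fst : C * C -> C) p.
Proof. by apply: linear_differentiable => x; exact: cvg_fst. Qed.

Lemma differentiable_snd (p : C * C) : differentiable (snd : C * C -> C) p.
Proof. by apply: linear_differentiable => x; exact: cvg_snd. Qed.

Lemma hd_hh hbar : hd hh hbar (cis (- alpha)).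
Proof.
have := dvM (@id_continuous R) (dv_emb id hbar) (dv_cst id (cis (- alpha)) hbar).
by apply: dv_eq; rewrite mul1r mulr0 addr0.
Qed.

Lemma holomorphic_qsol : holomorphic_on Dom qsol.
Proof.
move=> p [Up hp0 zo]; have h0 := Re_neq0 hp0; have ic := @id_continuous R.
have d1 : differentiable (tauf \o fst : C * C -> C) p.
  exact: differentiable_comp (differentiable_fst p) (hd_differentiable (hd_tauf tc5 Up)).
have d2 : differentiable (Zf \o fst : C * C -> C) p.
  exact: differentiable_comp (differentiable_fst p) (hd_differentiable (hd_Zf tc5 Up)).
have d3 : differentiable ((fun h => (hh h)^-1) \o snd : C * C -> C) p.
  apply: differentiable_comp (differentiable_snd p) _.
  exact: hd_differentiable (dvV ic (hd_hh p.2) h0).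
have d4 : differentiable zf p by exact: (differentiableM d2 d3).
have d5 : differentiable ((fun z => 1 + f z) \o zf : C * C -> C) p.
  apply: differentiable_comp d4 _; have [fd _] := Omega_boutroux zo.
  exact: hd_differentiable (dvD (dv_cst id 1 (zf p)) fd).
exact: (differentiableM d1 d5).
Qed.

(** Stated pointwise, with [y], [b], [k] in place of [f], [f'], [f''], and as an equivalence:
    existence uses it from right to left, uniqueness from left to right. *)
Lemma painleve1_boutroux t hbar (y b k : C) : U t -> hh hbar != 0 ->
  let z := Zf t / hh hbar in
  hbar ^+ 2 * (tauf t / t ^+ 2 * (25 / 16 * (z ^+ 2 * k + z * b) - (1 + y) / 4)) =
    6 * (tauf t * (1 + y)) ^+ 2 + t <-> k = y + bN z y b.
Proof.
move=> Ut h0 z; have z0 : z != 0 by rewrite mulf_neq0 ?Zf_neq0 // invr_eq0.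
have u0 := tauf_neq0 tc5 t; have t0 := U_neq0 tc5 Ut.
have sc := scale_identity tc5 Ut.
have hz : cis alpha * Zf t = hbar * z.
  rewrite /z -{1}(hhE alpha hbar); move: (hh hbar) h0 => h h0; field.
  by rewrite h0.
have z2 : z ^+ 2 != 0 by rewrite expf_neq0.
rewrite hz exprMn in sc.
have E : hbar ^+ 2 * (tauf t / t ^+ 2 * (25 / 16 * (z ^+ 2 * k + z * b) - (1 + y) / 4)) =
    12 * tauf t ^+ 2 * (k - (y + bN z y b)) + 6 * (tauf t * (1 + y)) ^+ 2 + t.
  have T := tauf_sqr tc5 Ut.
  have L : hbar ^+ 2 * (tauf t / t ^+ 2 * (25 / 16 * (z ^+ 2 * k + z * b) - (1 + y) / 4)) =
      tauf t / t ^+ 2 * (25 / 16) * (hbar ^+ 2 * z ^+ 2) *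
        (k - (y + bN z y b) + (y + y ^+ 2 / 2)).
    rewrite /bN; clear sc hz T z2; move: (tauf t) z z0 => u v v0; field.
    by rewrite ?v0 ?t0 ?pnatr_eq0.
  rewrite L sc; suff : 12 * tauf t ^+ 2 * (k - (y + bN z y b) + (y + y ^+ 2 / 2)) =
      12 * tauf t ^+ 2 * (k - (y + bN z y b)) + 6 * (tauf t * (1 + y)) ^+ 2 +
      (- 6 * tauf t ^+ 2) by rewrite -T.
  by move: (bN z y b) (tauf t) => B u; field; rewrite ?pnatr_eq0.
have u12 : 12 * tauf t ^+ 2 != 0 by rewrite mulf_neq0 ?expf_neq0 // pnatr_eq0.
rewrite E; split.
  move=> /eqP; rewrite -addrA -subr_eq0 addrK mulf_eq0 (negbTE u12) /= subr_eq0 => /eqP; exact.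
by move=> ->; rewrite subrr mulr0 add0r.
Qed.

Lemma painleve1_qsol : painleve1_solution Dom qsol.
Proof.
move=> t hbar [/= Ut hp0 zo]; have h0 := Re_neq0 hp0.
have [fd gd] := Omega_boutroux zo.
have := @second_derivative R alpha tc tc5 (fun s => qsol (s, hbar)) (hh hbar) (fun z => 1 + f z) g
  (f (zf (t, hbar)) + bN (zf (t, hbar)) (f (zf (t, hbar))) (g (zf (t, hbar)))) t Ut h0.
move=> E; apply: etrans (congr1 (fun u => hbar ^+ 2 * u) (E _ _ _)) _.
- by [].
- apply: filterS (near_Omega zo) => z /Omega_boutroux[zd _].
  by have := dvD (dv_cst id 1 z) zd; rewrite add0r.
- exact: gd.
exact: (painleve1_boutroux (f (zf (t, hbar))) (g (zf (t, hbar))) _ Ut h0).2.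
Qed.

Variable qhat : nat -> C -> C.
Hypothesis qhat_branch : distinguished_branch (tau_sector tc) qhat.

Lemma qhat_hbar k t hbar : U t -> hh hbar != 0 ->
  qhat k t * hbar ^+ k = tauf t * (yC k * (Zf t / hh hbar)^-1 ^+ k).
Proof.
move=> Ut h0; rewrite (qhat_eq tc5 qhat_branch k Ut).
have cn := cis_neq0 alpha; have Zn := Zf_neq0 tc t.
rewrite -{1}(hhE alpha hbar); move: h0 cn Zn.
move: (hh hbar) (cis alpha) (Zf t) (tauf t) (yC k) => h c Z u y h0 cn Zn.
rewrite -!mulrA -exprMn; suff -> : (Z * c)^-1 * (c * h) = (Z / h)^-1 by [].
by field; rewrite ?h0 ?cn ?Zn.
Qed.

Lemma asymptotic_qsol : asymptotic_to (Arc_pi alpha) U Dom qsol qhat.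
Proof.
move=> t0 Ut0; have Zu := Zf_uhp tc5 Ut0.
pose mu := Im (Zf t0) / 2; have mu0 : 0 < mu by rewrite divr_gt0.
pose M := normc (Zf t0) + mu; have M0 : mu < M.
  by rewrite /M ltrDr normc_gt0 (Zf_neq0 tc).
have Mp : 0 < M by exact: lt_trans M0.
pose T := normc (tauf t0) + 1; have T0 : 0 < T by rewrite /T ltr_wpDl // normc_ge0.
(* Then [2 * m * M = mu], so [hp_sector] applies with one slope for all [t] in [U0]; the radius
   [rho] below makes [normc (Zf t / hh hbar)] exceed [32 / m ^+ 2]. *)
pose m := mu / (2 * M).
have m0 : 0 < m by rewrite divr_gt0 // mulr_gt0.
have m2 : m <= 1 / 2 by rewrite /m ler_pdivrMr ?mulr_gt0 //; lra.
have m1 : m <= 1 by lra.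
pose rho := mu * m ^+ 2 / 64; have rho0 : 0 < rho by rewrite divr_gt0 // mulr_gt0 // exprn_gt0.
pose U0 : set C := [set t | [/\ U t, normc (Zf t - Zf t0) < mu & normc (tauf t - tauf t0) < 1]].
have U0mu t : U0 t -> [/\ mu < Im (Zf t), normc (Zf t) < M & normc (tauf t) < T].
  move=> [Ut Zt tt]; split.
  - have := le_lt_trans (normc_Im _) Zt; rewrite cImD cImN ltr_norml => /andP[h _].
    have E : Im (Zf t0) = 2 * mu by rewrite /mu; field.
    by lra.
  - have := le_normcD (Zf t - Zf t0) (Zf t0); rewrite subrK /M; lra.
  - have := le_normcD (tauf t - tauf t0) (tauf t0); rewrite subrK /T; lra.
have key t hbar : U0 t -> half_disc alpha rho hbar ->
    exists e : R, [/\ e ^+ 2 = 1, hp m e (Zf t / hh hbar) &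
      m * normc (Zf t / hh hbar) <= e * Re (Zf t / hh hbar) + m * Im (Zf t / hh hbar)].
  move=> Ut [h0 hr]; have [a1 a2 a3] := U0mu t Ut.
  apply: hp_sector => //.
    apply: le_trans (ltW a1); have -> : mu = 2 * m * M by rewrite /m; field; rewrite gt_eqF.
    by rewrite ler_wpM2l ?(ltW a2) // mulr_ge0 // ltW.
  have hn : 0 < normc (hh hbar) by rewrite normc_gt0; exact: Re_neq0.
  have nh : normc (hh hbar) < rho by rewrite /hh normcM normc_cis mulr1.
  have E : normc (Zf t / hh hbar) = normc (Zf t) / normc (hh hbar) by rewrite normcM normcV.
  rewrite E ltr_pdivlMr //; apply: le_lt_trans (_ : 32 / m ^+ 2 * rho < _).
    by rewrite ler_wpM2l ?(ltW nh) // divr_ge0 // exprn_ge0 // ltW.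
  have -> : 32 / m ^+ 2 * rho = mu / 2 by rewrite /rho; field; rewrite gt_eqF.
  have := ler_norm (Im (Zf t)); have := normc_Im (Zf t); lra.
exists U0, (half_disc alpha rho); split.
- have N1 : \forall t \near t0, normc (Zf t - Zf t0) < mu.
    have := hd_continuous (hd_Zf tc5 Ut0) => /continuous_normcP /(_ mu mu0) H.
    by apply/nbhs_normcP.
  have N2 : \forall t \near t0, normc (tauf t - tauf t0) < 1.
    have := hd_continuous (hd_tauf tc5 Ut0) => /continuous_normcP /(_ 1 ltr01) H.
    by apply/nbhs_normcP.
  by apply: filterS (filterI (near_U tc5 Ut0) (filterI N1 N2)) => t [a [b c]].
- by move=> t [].
- exact: half_disc_sectorial.
- move=> [t hbar] [/= Ut hS]; have [e [e2 zh _]] := key t hbar Ut hS.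
  by case: Ut hS => [Ut _ _] [h0 _]; split => //; exists m, e; split.
have [K [M1 [K0 M10 G]]] := boutroux_gevrey m0 m1.
(* [T] bounds the prefactor [tauf t], and [normc z ^- n] is at most [(normc hbar / mu) ^+ n] because
   [normc (Zf t) >= mu]. *)
exists (T * K), (M1 / mu); split; [exact: mulr_gt0|exact: divr_gt0|].
move=> n t hbar tU hS; have [a1 a2 a3] := U0mu t tU.
have [e [e2 zh lev]] := key t hbar tU hS; have [S B] := fgH m0 m1 e2.
have [Ut _ _] := tU; have [hr _] := hS; have h0 := Re_neq0 hr.
rewrite !normcE' -realCX -realCM lecR /qsol.
have -> : \sum_(k < n) qhat k t * hbar ^+ k =
    tauf t * \sum_(k < n) yC k * (Zf t / hh hbar)^-1 ^+ k.
  by rewrite mulr_sumr; apply: eq_bigr => k _; rewrite qhat_hbar.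
rewrite [(t, hbar).1]/= -mulrBr normcM.
have H := G f g e _ n e2 S B zh lev.
have t1 : 0 <= normc (tauf t) by exact: normc_ge0.
apply: le_trans (ler_pM t1 (normc_ge0 _) (ltW a3) H) _.
have hn : 0 < normc (hh hbar) by rewrite normc_gt0.
have hE : normc (hh hbar) = normc hbar by rewrite /hh normcM normc_cis mulr1.
rewrite normcM normcV hE -exprVn invf_div.
have Zp : 0 < normc (Zf t).
  by apply: lt_le_trans (lt_trans mu0 a1) _; apply: le_trans (ler_norm _) (normc_Im _).
have -> : T * K * (M1 / mu) ^+ n * n`!%:R * normc hbar ^+ n =
    T * (K * M1 ^+ n * n`!%:R * (normc hbar / mu) ^+ n).
  by rewrite !exprMn; ring.
apply: ler_wpM2l; first exact: ltW.
apply: ler_wpM2l; first by rewrite !mulr_ge0 ?exprn_ge0 // ltW.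
have ZM : mu <= normc (Zf t).
  by apply: le_trans (ltW a1) _; apply: le_trans (ler_norm _) (normc_Im _).
have h : normc hbar / normc (Zf t) <= normc hbar / mu.
  by apply: ler_wpM2l; [exact: normc_ge0|rewrite lef_pV2].
by apply: lerXn2r h; rewrite nnegrE; apply: mulr_ge0 (normc_ge0 _) _; rewrite invr_ge0 ltW.
Qed.

Lemma asymptotic_solution_qsol : asymptotic_solution alpha U qhat Dom qsol.
Proof. by split; [exact: holomorphic_qsol|exact: painleve1_qsol|exact: asymptotic_qsol]. Qed.

End Solution.

(** * Uniqueness *)

Section Apriori.
Variable R : realType.
Local Notation C := R[i].
Implicit Types (z w c : C) (Y : C -> C).

Definition boutroux_at Y z :=
  Dh (Dh Y) z = (Y z ^+ 2 - 1) / 2 - Dh Y z / z + 4 / 25 * Y z / z ^+ 2.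

Lemma sqr_bound Y z (a b d : R) : z != 0 -> boutroux_at Y z ->
  normc (Y z) <= a -> normc (Dh Y z) <= b -> normc (Dh (Dh Y) z) <= d ->
  normc (Y z ^+ 2 - 1) <= 2 * (d + b / normc z + 4 / 25 * a / normc z ^+ 2).
Proof.
move=> z0 E Ya Yb Yd.
have -> : Y z ^+ 2 - 1 = 2 * (Dh (Dh Y) z + Dh Y z / z - 4 / 25 * Y z / z ^+ 2).
  by rewrite E; move: (Y z) (Dh Y z) => y u; field; rewrite z0.
have zp : 0 < normc z by rewrite normc_gt0.
rewrite normcM -[2]/(2%:R) normc_nat ler_wpM2l //; apply: le_trans (le_normcB _ _) _.
apply: lerD; last first.
  rewrite !normcM !normcV normcX !normc_nat; apply: ler_wpM2r.
    by rewrite invr_ge0 exprn_ge0 // ltW.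
  by rewrite ler_wpM2l.
apply: le_trans (le_normcD _ _) _; apply: lerD => //.
by rewrite normcM normcV ler_wpM2r // invr_ge0 ltW.
Qed.

(* At a maximum of [rho^2 |Y|], with [rho] the distance to the boundary of the
   disc, the Cauchy estimates bound the linear terms of the equation by a
   multiple of [|Y| / rho^2], so the quadratic term forces [|Y| <= 1 + 290 / rho^2]. *)
Lemma apriori_disc Y c (r : R) : 0 < r -> r <= normc c ->
  holo [set z | normc (z - c) < 2 * r] Y ->
  (forall z, normc (z - c) < r -> boutroux_at Y z) ->
  r ^+ 2 * normc (Y c) <= r ^+ 2 + 290.
Proof.
move=> r0 rc hY eY.
have [->|Yc0] := eqVneq (Y c) 0.
  by rewrite normc0 mulr0; have := sqr_ge0 r; lra.
pose zeta (p : R * R) : C := c + (p.1 +i* p.2).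
pose rho z := r - normc (z - c).
(* The maximum is sought on a square containing the disc, which is compact as a product of segments.
   Writing [rho] times its absolute value makes [F] nonpositive outside the disc, so a positive
   maximum lies inside; the corners of the square are why [Y] is taken on radius [2 * r]. *)
pose F (p : R * R) := rho (zeta p) * `|rho (zeta p)| * normc (Y (zeta p)).
pose A : set (R * R) := `[- r, r] `*` `[- r, r].
have in_disc p : A p -> normc (zeta p - c) < 2 * r.
  case: p => a b [/=]; rewrite !in_itv /= => /andP[a1 a2] /andP[b1 b2].
  rewrite /zeta addrAC subrr add0r -(@ltr_pXn2r _ 2) ?nnegrE ?normc_ge0 ?mulr_ge0 ?(ltW r0) //.
  rewrite sqr_normcE /=; have r2 : 0 < r * r by rewrite mulr_gt0.
  have ha : a ^+ 2 <= r ^+ 2.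
    by rewrite -real_normK ?num_real // lerXn2r ?nnegrE ?(ltW r0) // ler_norml a1 a2.
  have hb : b ^+ 2 <= r ^+ 2.
    by rewrite -real_normK ?num_real // lerXn2r ?nnegrE ?(ltW r0) // ler_norml b1 b2.
  rewrite exprMn; rewrite !expr2 in ha hb *; lra.
have r00 : - r <= 0 <= r by rewrite oppr_le0 !ltW.
have A0 : A (0, 0) by split; rewrite /= in_itv.
have Ac : compact A by apply: compact_setX; exact: segment_compact.
have zc p : {for p, continuous zeta}.
  apply: contD; first exact: cont_cst.
  by apply: cvg_complex; [exact: cvg_fst|exact: cvg_snd].
have rhoc p : {for p, continuous (fun q => rho (zeta q))}.
  apply: cvgB; first exact: cvg_cst.
  apply: (@cont_comp _ C R (@normc R) (fun q => zeta q - c) p); first exact: continuous_normc.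
  by apply: contB; [exact: zc|exact: cont_cst].
have Fc : {within A, continuous F}.
  apply/subspace_continuousP => p pA; apply: cvg_within_filter.
  apply: cvgM; first by apply: cvgM; [exact: rhoc|apply: cvg_norm; exact: rhoc].
  apply: (@cont_comp _ C R (@normc R) (fun q => Y (zeta q)) p); first exact: continuous_normc.
  apply: (@cont_comp _ C C Y zeta p); last exact: zc.
  by have [l hl] := hY (zeta p) (in_disc p pA); exact: hd_continuous hl.
have [p pA pmax] := compact_EVT_max (ex_intro _ _ A0) Ac Fc.
have zeta0 : zeta (0, 0) = c by rewrite /zeta -[0 +i* 0]/(0 : C) addr0.
have rho_c : rho c = r by rewrite /rho subrr normc0 subr0.
have Fcenter : F (0, 0) = r ^+ 2 * normc (Y c).
  by rewrite /F zeta0 rho_c gtr0_norm.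
have Fpos : 0 < F p.
  apply: lt_le_trans (pmax (0, 0) (mem_set A0)); rewrite Fcenter.
  by rewrite mulr_gt0 ?exprn_gt0 // normc_gt0.
pose q := zeta p; pose d := rho q.
have Y0 := normc_ge0 (Y q).
have d0 : 0 < d.
  rewrite ltNge; apply/negP => dn; move: Fpos; rewrite /F -/q -/d ltNge => /negP; apply.
  by rewrite mulr_le0_ge0 // mulr_le0_ge0.
have FE : F p = d ^+ 2 * normc (Y q) by rewrite /F -/q -/d gtr0_norm.
have qin : normc (q - c) < r by move: d0; rewrite /d /rho; lra.
have d20 : 0 < d ^+ 2 by rewrite exprn_gt0.
pose a := normc (Y q).
have near_q w : normc (w - q) < d / 2 -> normc (Y w) <= 4 * a.
  move=> wq; have wr : d / 2 <= rho w.
    have := le_normcD (w - q) (q - c); rewrite addrA subrK /d /rho; move: wq; rewrite /d /rho.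
    lra.
  have wc : normc (w - c) <= r by move: wr; rewrite /rho; lra.
  have wA : A (Re (w - c), Im (w - c)).
    have h1 := le_trans (normc_Re _) wc; have h2 := le_trans (normc_Im _) wc.
    by split; rewrite /= in_itv /= -ler_norml.
  have wE : zeta (Re (w - c), Im (w - c)) = w.
    by rewrite /zeta; case: (w - c) (subrK c w) => x y /= <-; rewrite addrC.
  have rw0 : 0 < rho w by apply: lt_le_trans wr; rewrite divr_gt0.
  have := pmax _ (mem_set wA); rewrite FE /F wE (gtr0_norm rw0) -expr2 => H.
  have : (d / 2) ^+ 2 * normc (Y w) <= d ^+ 2 * a.
    apply: le_trans H; rewrite ler_wpM2r ?normc_ge0 // lerXn2r ?nnegrE //; last exact: ltW.
    by rewrite divr_ge0 // ltW.
  have -> : (d / 2) ^+ 2 * normc (Y w) = d ^+ 2 * (normc (Y w) / 4).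
    by rewrite expr_div_n -natrX; field.
  by rewrite ler_pM2l //; lra.
have d2 : 0 < d / 2 by rewrite divr_gt0.
have hq : holo [set z | normc (z - q) < d / 2] Y.
  move=> w /= wq; apply: hY; rewrite /=.
  have := le_normcD (w - q) (q - c); rewrite addrA subrK; move: wq; rewrite /d /rho; lra.
have [e1 e2] := cauchy_estimate d2 hq near_q.
have dq : d <= normc q.
  have -> : q = c - (c - q) by ring.
  apply: le_trans (lerB_normc _ _); rewrite normcB /d /rho; lra.
have q0 : q != 0 by rewrite -normc_gt0; exact: lt_le_trans dq.
have := sqr_bound q0 (eY q qin) (lexx a) e1 e2.
have b1 : 2 * (4 * a) / (d / 2) / normc q <= 16 * a / d ^+ 2.
  have -> : 2 * (4 * a) / (d / 2) / normc q = 16 * a / d * (normc q)^-1.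
    by field; rewrite !gt_eqF // normc_gt0.
  have -> : 16 * a / d ^+ 2 = 16 * a / d * d^-1 by field; rewrite gt_eqF.
  apply: ler_wpM2l; first by rewrite divr_ge0 ?mulr_ge0 // ltW.
  by rewrite lef_pV2 ?posrE // (lt_le_trans d0).
have b2 : 4 / 25 * a / normc q ^+ 2 <= a / d ^+ 2.
  apply: ler_pM; rewrite ?mulr_ge0 ?invr_ge0 ?exprn_ge0 ?normc_ge0 //.
    by rewrite ler_piMl //; lra.
  by rewrite lef_pV2 ?posrE ?exprn_gt0 ?(lt_le_trans d0) // lerXn2r ?nnegrE ?normc_ge0 // ltW.
have b3 : 8 * (4 * a) / (d / 2) ^+ 2 = 128 * (a / d ^+ 2).
  by field; rewrite gt_eqF.
rewrite b3 -[16 * a / _]mulrA in b1 *.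
have := lerB_normc (Y q ^+ 2) 1; rewrite normcX normc1 -/a => h1 h2.
(* [290 = 2 * (128 + 16 + 1)], from the second derivative, the first derivative and the [4 / 25]
   term respectively. *)
have key : a ^+ 2 <= 1 + 290 * (a / d ^+ 2).
  have x0 : 0 <= a / d ^+ 2 by rewrite divr_ge0 // ltW.
  move: b1 b2 h1 h2 x0; move: (a / d ^+ 2) (2 * (4 * a) / _ / _) (4 / 25 * a / _) => x u v.
  lra.
have main : d ^+ 2 * a <= d ^+ 2 + 290.
  have [a1|a1] := leP a 1.
    have : d ^+ 2 * a <= d ^+ 2 by rewrite ler_piMr // ltW.
    lra.
  have ap : 0 < a by lra.
  rewrite -(ler_pM2r ap).
  have k2 := ler_wpM2l (ltW d20) key.
  have e3 : d ^+ 2 * (1 + 290 * (a / d ^+ 2)) = d ^+ 2 + 290 * a by field; rewrite gt_eqF.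
  rewrite e3 in k2.
  have : d ^+ 2 <= d ^+ 2 * a by rewrite ler_peMr // ltW.
  have e4 : d ^+ 2 * a * a = d ^+ 2 * a ^+ 2 by ring.
  rewrite e4 mulrDl; lra.
have := pmax (0, 0) (mem_set A0); rewrite Fcenter FE -/a.
have dr : d ^+ 2 <= r ^+ 2.
  by rewrite lerXn2r ?nnegrE ?(ltW d0) ?(ltW r0) // /d /rho gerBl normc_ge0.
lra.
Qed.

End Apriori.

(** * Solutions on a rotated half-plane *)

Section HalfPlaneUniqueness.
Variables (R : realType) (h : R[i]).
Local Notation C := R[i].
Implicit Types (z w : C) (c d : R) (Y : C -> C).

Hypothesis h_arg : `|Im h| <= Re h.
Hypothesis h_pos : 0 < Re h.

(** The points deeper than [c] behind the line [Im (z * h) = 0], which bounds the image of the upper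
    half-plane of [Z = z * h] for fixed [h]. *)
Definition hplane (c : R) : set C := [set z | c * normc h < Im (z * h)].

Let nh : 0 < normc h. Proof. by rewrite normc_gt0; exact: Re_neq0. Qed.

Lemma hplane_norm c z : hplane c z -> c < normc z.
Proof.
rewrite /hplane /= => H; rewrite -(ltr_pM2r nh) -normcM.
by apply: lt_le_trans H _; apply: le_trans (ler_norm _) (normc_Im _).
Qed.

Lemma hplane_le c d z : c <= d -> hplane d z -> hplane c z.
Proof. by move=> cd; apply: le_lt_trans; rewrite ler_pM2r. Qed.

Lemma hplane_ball c (r : R) z w : hplane (c + r) z -> normc (w - z) <= r -> hplane c w.
Proof.
rewrite /hplane /= => H wz.
have := normc_Im ((w - z) * h); rewrite normcM => H2.
have := ler_wpM2r (ltW nh) wz => H3.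
have := le_trans H2 H3; rewrite mulrBl cImD cImN ler_norml => /andP[h1 _].
move: H; rewrite mulrDl; lra.
Qed.

(** The condition [|Im h| <= Re h] keeps the rotation within [pi / 4], so the cone of slope 1
    remains forward in the rotated half-plane. *)
Lemma hplane_cone c z w : hplane c z -> cone 1 z w -> hplane c w.
Proof.
rewrite /hplane /cone /= => H; rewrite mul1r => zw.
have u0 := le_trans (normr_ge0 _) zw.
have : 0 <= Im ((w - z) * h).
  rewrite cImM; have : - (Re (w - z) * Im h) <= Im (w - z) * Re h.
    apply: le_trans (ler_norm _) _; rewrite normrN normrM.
    by apply: ler_pM.
  lra.
rewrite mulrBl cImD cImN; lra.
Qed.

Lemma hplane_hp z : hplane 32 z -> exists2 e : R, e ^+ 2 = 1 & hp 1 e z.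
Proof.
rewrite /hplane /= => H.
have rn : Re h <= normc h by apply: le_trans (ler_norm _) (normc_Re _).
have : 32 * Re h < (`|Re z| + Im z) * Re h.
  apply: le_lt_trans (_ : 32 * normc h < _); first by rewrite ler_pM2l.
  apply: lt_le_trans H _; rewrite cImM mulrDl lerD2r.
  apply: le_trans (ler_norm _) _; rewrite normrM; exact: ler_wpM2l.
rewrite ltr_pM2r // => L.
have [x0|x0] := leP 0 (Re z).
  exists 1; rewrite ?expr1n // /hp /= divr1 !mul1r; move: L; rewrite ger0_norm //.
exists (-1); rewrite ?sqrrN ?expr1n // /hp /= divr1 mulN1r mul1r.
by move: L; rewrite ltr0_norm.
Qed.

Lemma open_hplane c : open (hplane c).
Proof.
rewrite openE => z H; apply/nbhs_normcP.
pose d := (Im (z * h) / normc h - c) / 2.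
have d0 : 0 < d by rewrite divr_gt0 // subr_gt0 ltr_pdivlMr.
exists d => // w wz; apply: hplane_ball (ltW wz); rewrite /hplane /=.
have -> : (c + d) * normc h = (c * normc h + Im (z * h)) / 2 by rewrite /d; field; rewrite gt_eqF.
by move: H; rewrite /hplane /=; lra.
Qed.

Lemma convexc_hplane c : convexc (hplane c).
Proof.
by move=> a b s ah bh s01; rewrite /hplane /= segptM Im_segpt; exact: lt_convex.
Qed.

Section Deep.
Variable Y : C -> C.
Hypothesis Yh : holo (hplane 32) Y.
Hypothesis Ye : forall z, hplane 32 z -> boutroux_at Y z.

(** At large depth the Cauchy estimates make the derivatives small, and the equation then says that
    [Y ^+ 2] is nearly 1. *)
Lemma deep_bound z : hplane 300 z ->
  [/\ normc (Y z) <= 2, normc (Dh Y z) <= 1 & normc (Y z ^+ 2 - 1) <= 1 / 32].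
Proof.
move=> zP.
(* Depth 300 is spent as 100 for the Cauchy disc and 160 for the a priori disc of radius 80, leaving
   40, above 32. At radius 80 the bound is [1 + 290 / 6400], below 2. *)
have Y2 w : normc (w - z) < 100 -> normc (Y w) <= 2.
  move=> wz; have wP : hplane 200 w.
    by apply: (hplane_ball (r := 100)) (ltW wz); rewrite -natrD.
  have wn := hplane_norm wP.
  have sub v : normc (v - w) < 160 -> hplane 32 v.
    move=> vw; apply: (@hplane_le 32 40); first by rewrite ler_nat.
    by apply: (hplane_ball (r := 160)) (ltW vw); rewrite -natrD.
  have := @apriori_disc R Y w 80.
  have -> : 2 * 80 = 160 :> R by rewrite -natrM.
  move=> H; have : 80 ^+ 2 * normc (Y w) <= 80 ^+ 2 + 290.
    apply: H => //; first by lra.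
    - by move=> v /= /sub; exact: Yh.
    - by move=> v vw; apply: Ye; apply: sub; lra.
  rewrite !expr2; lra.
have r0 : 0 < 100 :> R by [].
have zn := hplane_norm zP; have zn0 : z != 0 by rewrite -normc_gt0; lra.
have sub v : normc (v - z) < 100 -> hplane 32 v.
  move=> vw; apply: (@hplane_le 32 200); first by rewrite ler_nat.
  by apply: (hplane_ball (r := 100)) (ltW vw); rewrite -natrD.
have [e1 e2] := cauchy_estimate r0 (fun v vz => Yh (sub v vz)) Y2.
have y2 : normc (Y z) <= 2 by apply: Y2; rewrite subrr normc0.
split=> //; first by apply: le_trans e1 _; lra.
have z32 : hplane 32 z by apply: sub; rewrite subrr normc0.
apply: le_trans (sqr_bound zn0 (Ye z32) y2 e1 e2) _.
have i1 : (normc z)^-1 <= 1 / 100.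
  by rewrite mul1r lef_pV2 ?posrE //; lra.
have i0 : 0 <= (normc z)^-1 by rewrite invr_ge0; lra.
have i2 : (normc z ^+ 2)^-1 <= 1 / 100.
  rewrite -exprVn expr2; apply: le_trans (_ : (normc z)^-1 * 1 <= _); last by rewrite mulr1.
  by apply: ler_wpM2l => //; lra.
have -> : 100 ^+ 2 = 10000 :> R by rewrite -natrX.
lra.
Qed.

(** Since [Y ^+ 2] is near 1, [Re Y] never vanishes at this depth, and by the intermediate value
    theorem on a convex set it keeps the sign it has at [z0]. Then [normc (Y z + 1) >= 1] turns the
    bound on [Y ^+ 2 - 1] into one on [Y - 1]. *)
Lemma deep_near1 z0 z : hplane 300 z0 -> 0 < Re (Y z0) -> hplane 300 z ->
  normc (Y z - 1) <= 1 / 32.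
Proof.
move=> z0P z0Y zP.
have no0 w : hplane 300 w -> Re (Y w) != 0.
  move=> /deep_bound[_ _ H]; apply/eqP => E.
  have := le_trans (normc_Re _) H; rewrite cReD cReN expr2 cReM E /= mul0r sub0r.
  rewrite -opprD normrN ger0_norm; last by rewrite addr_ge0 // -expr2 sqr_ge0.
  by have := sqr_ge0 (Im (Y w)); rewrite expr2; lra.
have zY : 0 < Re (Y z).
  rewrite ltNge; apply/negP => z1.
  have [||s s01 E] := @IVT R (fun s => Re (Y (segpt z0 z s))) 0 1 0 ler01.
  - apply/subspace_continuousP => s s01; apply: cvg_within_filter.
    apply: (@cont_comp R C R (@complex.Re R) (fun s => Y (segpt z0 z s)) s); first exact: continuous_Re.
    apply: (@cont_comp R C C Y (segpt z0 z) s); last exact: rd_continuous (rd_affine z0 (z - z0) s).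
    have sP := convexc_hplane z0P zP s01.
    have s32 : hplane 32 (segpt z0 z s) by apply: hplane_le sP; rewrite ler_nat.
    by have [l hl] := Yh s32; exact: hd_continuous hl.
  - have e0 : segpt z0 z 0 = z0 by rewrite /segpt rmorph0 mul0r addr0.
    have e1 : segpt z0 z 1 = z by rewrite /segpt rmorph1 mul1r subrKC.
    by rewrite e0 e1 ge_min z1 orbT le_max (ltW z0Y).
  have := no0 (segpt z0 z s) (convexc_hplane z0P zP s01); rewrite E eqxx.
  by [].
have [_ _ H] := deep_bound zP.
have n1 : 1 <= normc (Y z + 1).
  by apply: le_trans (le_trans (ler_norm _) (normc_Re _)); rewrite cReD /=; lra.
move: H; have -> : Y z ^+ 2 - 1 = (Y z - 1) * (Y z + 1) by ring.
rewrite normcM => H; apply: le_trans H.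
by rewrite ler_peMr // normc_ge0.
Qed.

Variables f g : C -> C.
Hypothesis fgH : forall e : R, e ^+ 2 = 1 ->
  boutroux (hp 1 e) f g /\
  forall z, hp 1 e z -> normc (f z) <= 1 / 32 /\ normc (g z) <= 1 / 32.

Lemma deep_unique z0 z : hplane 300 z0 -> 0 < Re (Y z0) -> hplane 300 z -> Y z = 1 + f z.
Proof.
move=> z0P z0Y zP.
have z32 : hplane 32 z by apply: hplane_le zP; rewrite ler_nat.
have [e e2 ze] := hplane_hp z32; have [S B] := fgH e2.
have inc w : cone 1 z w -> hp 1 e w.
  by move=> /(hp_level_forward ltr01 (lexx _) e2); exact: lt_le_trans.
have [] := @boutroux_unique R 1 z (fun w => Y w - 1) (Dh Y) f g ltr01 (lexx _).
- move=> w wc; have wP := hplane_cone zP wc.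
  have w32 : hplane 32 w by apply: hplane_le wP; rewrite ler_nat.
  have hY := holo_hd Yh w32.
  have hDY := holo_hd (holo_Dh (@open_hplane 32) Yh) w32.
  split; first by have := dvB hY (dv_cst id 1 w); rewrite subr0.
  apply: dv_eq hDY; rewrite (Ye w32) /bN.
  have wn : w != 0 by rewrite -normc_gt0; have := hplane_norm wP; lra.
  by move: (Y w) (Dh Y w) => y u; field; rewrite wn.
- by move=> w wc; exact: S (inc w wc).
- move=> w wc; have wP := hplane_cone zP wc; have [b1 b2] := B w (inc w wc).
  split; [|exact: deep_near1 z0P z0Y wP|exact: b1].
  by rewrite divr1; have := hplane_norm wP; lra.
- exists 1 => w wc; have wP := hplane_cone zP wc; have [b1 b2] := B w (inc w wc).
  by have [_ b3 _] := deep_bound wP; split => //; lra.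
by move=> E _; rewrite -E; ring.
Qed.

End Deep.
End HalfPlaneUniqueness.

(** * Reduction of uniqueness to slices of constant [hbar] *)

Section Uniqueness.
Variables (R : realType) (alpha : R) (tc : R[i]).
Local Notation C := R[i].
Local Notation U := (t_sector tc).
Local Notation tcc := (proj_t tc).
Local Notation tauf := (tauf tc).
Local Notation Zf := (Zf tc).
Local Notation hh := (hh alpha).
Local Notation zf := (zf alpha tc).
Local Notation Dom := (Dom alpha tc).
Implicit Types (z w t : C).

Hypothesis tc5 : tc ^+ 5 = (25 / 6912)%:C * cis (2 * alpha).

(** The set [B] is open in the blow-up and contains the boundary point of direction [alpha], hence
    the points above it at small radius. *)
Lemma sectorial_ray (S : set C) : sectorial_nbhd (Arc_pi alpha) S ->
  exists2 d : R, 0 < d & forall r, 0 < r -> r < d -> S (r%:C * cis alpha).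
Proof.
move=> [_ _ _ [B [Bb /open_subspaceP [W Wo WB] _ SE AE]]].
have B0 : B (0, cis alpha).
  have : Arc_pi alpha (cis alpha).
    by apply/Arc_piE; split; [exact: normc_cis|rewrite cisK /= ltr01].
  by rewrite AE.
have W0 : W (0, cis alpha).
  have : (B `&` blowup) (0, cis alpha) by exact: (conj B0 (Bb _ B0)).
  by rewrite -WB => -[].
have N : \forall r \near (0 : R), W (r, cis alpha).
  have c : {for (0 : R), continuous (fun r : R => (r, cis alpha))}.
    by apply: cvg_pairs; [exact: cvg_id|exact: cvg_cst].
  by apply: c; apply: open_nbhs_nbhs; split.
have [d d0 dW] := (nbhs_ballP _ _).1 N.
exists d => // r r0 rd; rewrite SE; exists (r, cis alpha) => //; split=> //.
have : (W `&` blowup) (r, cis alpha).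
  split; last by split; [exact: ltW|rewrite /= normcE' normc_cis].
  by apply: dW; rewrite -ball_normE /= sub0r normrN gtr0_norm.
by rewrite WB => -[].
Qed.

Variables f g : C -> C.
Hypothesis fgH : forall m e, 0 < m -> m <= 1 -> e ^+ 2 = 1 ->
  boutroux (hp m e) f g /\
  forall z, hp m e z -> normc (f z) <= m / 32 /\ normc (g z) <= m / 32.

Section Slice.
Variables (q : C * C -> C) (hbar : C).
Local Notation h := (hh hbar).
Hypothesis qh : holomorphic_on Dom q.
Hypothesis qe : painleve1_solution Dom q.
Hypotheses (h_arg : `|Im h| <= Re h) (h_pos : 0 < Re h).

(** [T] inverts the map from [t] to [Zf t / h], so [Y] is the competitor at fixed [hbar], written in
    the Boutroux variable. *)
Let T z : C := tcc * cpow (4 / 5) (z * h).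
Let Y z : C := q (T z, hbar) / tauf (T z).
Let hn : h != 0. Proof. exact: Re_neq0. Qed.

Lemma slice_dom z : hplane h 32 z -> [/\ uhp (z * h), U (T z), Zf (T z) / h = z & Dom (T z, hbar)].
Proof.
move=> zP; have Zu : uhp (z * h).
  by apply: le_lt_trans zP; rewrite mulr_ge0 // normc_ge0.
have [Ut ZE] := Zf_inverse tc5 Zu; have zE : Zf (T z) / h = z by rewrite ZE mulfK.
split=> //; split => //; rewrite /zf /= zE.
by have [e e2 ze] := hplane_hp h_arg h_pos zP; exists 1, e; split.
Qed.

Lemma slice_holo : holo (hplane h 32) Y.
Proof.
move=> z zP; have [Zu Ut ZE zD] := slice_dom zP; have ic := @id_continuous R.
have [l ql] : exists l, hd (fun s => q (s, hbar)) (T z) l.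
  have := @differentiable_line R q 0 hbar 1 0 (T z).
  rewrite mulr1 add0r mulr0 addr0 => H; have [l hl] := H (qh zD); exists l.
  by apply: near_hd hl; apply: filterE => w; rewrite mulr1 add0r mulr0 addr0.
have dzh : hd (fun w : C => w * h) z h.
  by have := dvM ic (dv_emb id z) (dv_cst id h z); rewrite mul1r mulr0 addr0.
have dT := dvZ ic tcc (@hd_comp R (cpow (4 / 5)) (fun w : C => w * h) z _ _ (hd_cpow (4 / 5) Zu) dzh).
have d1 := @hd_comp R (fun s => q (s, hbar)) T z _ _ ql dT.
have d2 := @hd_comp R tauf T z _ _ (hd_tauf tc5 Ut) dT.
have d3 := dvV ic d2 (tauf_neq0 tc5 (T z)).
by eexists; exact: (dvM ic d1 d3).
Qed.

Lemma slice_eq s : U s -> q (s, hbar) = tauf s * Y (Zf s / h).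
Proof.
move=> Us; rewrite /Y /T divfK // (t_of_Zf tc5 Us) mulrC divfK //.
exact: tauf_neq0 tc5 s.
Qed.

Lemma slice_boutroux z : hplane h 32 z -> boutroux_at Y z.
Proof.
move=> zP; have [Zu Ut ZE zD] := slice_dom zP.
have zn : z != 0 by rewrite -normc_gt0; have := hplane_norm h_pos zP; lra.
have D1 w (wP : hplane h 32 w) := holo_hd slice_holo wP.
have D2 := holo_hd (holo_Dh (@open_hplane R h h_pos 32) slice_holo) zP.
have N : \forall w \near z, hplane h 32 w.
  by apply: open_nbhs_nbhs; split; [exact: (@open_hplane R h h_pos 32)|exact: zP].
have := @second_derivative R alpha tc tc5 (fun s => q (s, hbar)) h Y (Dh Y) (Dh (Dh Y) z) (T z)
  Ut hn slice_eq; rewrite ZE => H.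
have {}H := H (@filterS _ _ (nbhs_filter z) _ _ D1 N) D2.
have E := qe zD.
have {E} E : hbar ^+ 2 * (tauf (T z) / T z ^+ 2 *
    (25 / 16 * (z ^+ 2 * Dh (Dh Y) z + z * Dh Y z) - Y z / 4)) = 6 * q (T z, hbar) ^+ 2 + T z.
  exact: etrans (congr1 (fun u => hbar ^+ 2 * u) (esym H)) E.
have YE : Y z = 1 + (Y z - 1) by rewrite addrC subrK.
have qE : q (T z, hbar) = tauf (T z) * (1 + (Y z - 1)).
  by rewrite -YE (slice_eq Ut) ZE.
have := (painleve1_boutroux tc5 (Y z - 1) (Dh Y z) (Dh (Dh Y) z) Ut hn).1.
rewrite /= ZE => HB; rewrite /boutroux_at HB.
  by rewrite /bN; move: (Y z) (Dh Y z) => y u; field; rewrite zn.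
by rewrite -qE -YE E.
Qed.

(** The closeness condition at [t0] says [normc (Y - 1) < 1] there, hence [Re Y > 0], which is all
    that [deep_unique] needs. *)
Lemma slice_unique t0 : U t0 -> 300 * normc h < Im (Zf t0) ->
  normc (q (t0, hbar) - tauf t0) < normc (tauf t0) ->
  forall t, U t -> 300 * normc h < Im (Zf t) -> q (t, hbar) = qsol alpha tc f (t, hbar).
Proof.
move=> Ut0 Z0 q0 t Ut Zt.
have P s : 300 * normc h < Im (Zf s) -> hplane h 300 (Zf s / h).
  by rewrite /hplane /= divfK.
have u0 := tauf_neq0 tc5 t0.
have Y0 : 0 < Re (Y (Zf t0 / h)).
  have E : q (t0, hbar) - tauf t0 = tauf t0 * (Y (Zf t0 / h) - 1).
    by rewrite (slice_eq Ut0); ring.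
  move: q0; rewrite E normcM -{2}[normc (tauf t0)]mulr1 ltr_pM2l ?normc_gt0 // => q0.
  have := le_lt_trans (normc_Re _) q0; rewrite cReD cReN /= ltr_norml => /andP[h1 _].
  by lra.
have H := @deep_unique R h h_arg h_pos Y slice_holo slice_boutroux f g _ (Zf t0 / h) (Zf t / h)
  (P t0 Z0) Y0 (P t Zt).
rewrite (slice_eq Ut) H // => e e2.
have [S B] := fgH ltr01 (lexx _) e2; split=> //.
Qed.

End Slice.

Variable qhat : nat -> C -> C.
Hypothesis qhat_branch : distinguished_branch (tau_sector tc) qhat.

Lemma asymptotic_solution_unique q : asymptotic_solution alpha U qhat Dom q ->
  forall p, Dom p -> q p = qsol alpha tc f p.
Proof.
move=> [qh qe qa].
have iu : uhp (0 +i* 1 : C) by rewrite /uhp /=.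
(* The reference point [t0] is the one with [Zf t0 = i]. *)
have [Ut0 Zt0] := Zf_inverse tc5 iu; set t0 := tcc * _ in Ut0 Zt0.
have [U0 [S0 [U0n _ S0s _ [K [M [K0 M0 H]]]]]] := qa t0 Ut0.
have u0 := tauf_neq0 tc5 t0; have un : 0 < normc (tauf t0) by rewrite normc_gt0.
have q0 hbar : S0 hbar -> normc (q (t0, hbar) - tauf t0) <= K * M * normc hbar.
  move=> hS; have := H 1%N t0 hbar (nbhs_singleton U0n) hS.
  rewrite big_ord1 expr0 mulr1 (qhat_eq tc5 qhat_branch 0 Ut0) expr0 mulr1 /yC ycoef0.
  by rewrite mulr1 !normcE' !expr1 mulr1 -realCM lecR.
have [d d0 dS] := sectorial_ray S0s.
have KM0 : 0 < K * M by exact: mulr_gt0.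
pose c : R := (40 * 40)^-1; have c0 : 0 < c by rewrite invr_gt0 mulr_gt0.
have c300 : 600 * c <= 1 / 2 by rewrite /c; lra.
have dKM : 0 < 4 * (K * M) by exact: mulr_gt0.
(* The three constraints put [hb0] in [S0], give depth 300 whenever [normc (hh hbar) < 2 * r] and
   [Im (Zf t) > 1 / 2], and make the order-one error [K * M * normc hbar] at most half of
   [normc (tauf t0)]. *)
pose r := Num.min (d / 2) (Num.min c (normc (tauf t0) / (4 * (K * M)))).
have r0 : 0 < r.
  by rewrite !lt_min c0; apply/andP; split; [exact: divr_gt0|exact: divr_gt0].
have r1 : r < d by apply: le_lt_trans (_ : d / 2 < d); [rewrite ge_min lexx|lra].
have r2 : r <= c by rewrite !ge_min lexx !orbT.
have r3 : r <= normc (tauf t0) / (4 * (K * M)) by rewrite !ge_min lexx !orbT.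
pose hb0 : C := r%:C * cis alpha.
have hb0S : S0 hb0 by exact: dS.
have hh0 : hh hb0 = r%:C by rewrite /hh -mulrA cisK mulr1.
have [d1 d10 d1U] : exists2 d1 : R, 0 < d1 & forall t, normc (t - t0) < d1 ->
    U t /\ normc (Zf t - Zf t0) < 1 / 2.
  have h12 : 0 < 1 / 2 :> R by rewrite divr_gt0.
  have N1 := (continuous_normcP _ _).1 (hd_continuous (hd_Zf tc5 Ut0)) _ h12.
  have [a a0 aP] := open_ball_sub (@open_t_sector R alpha tc tc5) Ut0; have [b b0 bP] := N1.
  exists (Num.min a b) => [|t]; first by rewrite lt_min a0.
  by rewrite lt_min => /andP[/aP h1 /bP h2].
have S0o : open S0 by case: S0s => -[].
have [d2 d20 d2S] := open_ball_sub S0o hb0S.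
(* Equality on a full neighbourhood of [(t0, hb0)] in both variables, as [identity_connected]
   requires; radius [r / 4] keeps [hh hbar] within the angle [pi / 4]. *)
have key t hbar : normc (t - t0) < d1 -> normc (hbar - hb0) < d2 -> normc (hbar - hb0) < r / 4 ->
    [/\ U t, 0 < Re (hh hbar), 300 * normc (hh hbar) < Im (Zf t) &
    q (t, hbar) = qsol alpha tc f (t, hbar)].
  move=> /d1U[Ut Zt] /d2S hS hr.
  have dh : normc (hh hbar - r%:C) < r / 4.
    by rewrite -hh0 /hh -mulrBl normcM normc_cis mulr1.
  have dre := le_lt_trans (normc_Re _) dh; have dim := le_lt_trans (normc_Im _) dh.
  rewrite cReD cReN /= in dre; rewrite cImD cImN /= subr0 in dim.
  have hn : normc (hh hbar) < 2 * r.
    have := le_normcD (hh hbar - r%:C) r%:C; rewrite subrK normc_real (gtr0_norm r0); lra.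
  have [a1 a2] : `|Im (hh hbar)| <= Re (hh hbar) /\ 0 < Re (hh hbar).
    by move: dre; rewrite ltr_norml => /andP[h1 h2]; split; lra.
  have ImZ : 1 / 2 < Im (Zf t).
    have := le_lt_trans (normc_Im _) Zt; rewrite Zt0 cImD cImN /= ltr_norml => /andP[h1 _].
    by lra.
  have lt300 : 300 * normc (hh hbar) < 1 / 2 by lra.
  split=> //; first by lra.
  apply: (@slice_unique q hbar qh qe a1 a2 t0 Ut0) => //.
  - by rewrite Zt0 /=; lra.
  - apply: le_lt_trans (q0 hbar hS) _.
    have nE : normc hbar = normc (hh hbar) by rewrite /hh normcM normc_cis mulr1.
    move: r3; rewrite ler_pdivlMr ?mulr_gt0 // => r3.
    have := ler_wpM2l (ltW KM0) (ltW hn); rewrite -nE; lra.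
  - by lra.
have zz z : normc (z - z) = 0 by rewrite subrr normc0.
have p0D : Dom (t0, hb0).
  have [|||_ h0 Zh _] := key t0 hb0; rewrite ?zz ?divr_gt0 //.
  split; [exact: Ut0|exact: h0|].
  have hn := Re_neq0 h0.
  have h_arg : `|Im (hh hb0)| <= Re (hh hb0) by rewrite hh0 /= normr0 ltW.
  have zP : hplane (hh hb0) 32 (zf (t0, hb0)).
    change (32 * normc (hh hb0) < Im (Zf t0 / hh hb0 * hh hb0)).
    rewrite divfK //; apply: le_lt_trans Zh.
    by rewrite ler_wpM2r ?normc_ge0 // ler_nat.
  by have [e e2 ze] := hplane_hp h_arg h0 zP; exists 1, e; split.
have F0 : \forall p \near (t0, hb0), q p - qsol alpha tc f p = 0.
  apply/nbhs_pairP; exists (Num.min d1 (Num.min d2 (r / 4))).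
    by rewrite !lt_min d10 d20 divr_gt0.
  move=> t hbar; rewrite !lt_min => /and3P[t1 _ _] /and3P[_ hb2 hb3].
  by have [_ _ _ ->] := key t hbar t1 hb2 hb3; rewrite subrr.
have Fd p : Dom p -> differentiable (fun p => q p - qsol alpha tc f p) p.
  move=> pD; exact: (differentiableB (qh p pD) (holomorphic_qsol tc5 fgH pD)).
have I := identity_connected (@open_Dom R alpha tc tc5) (@connected_Dom R alpha tc tc5) Fd p0D F0.
by move=> p /I /eqP; rewrite subr_eq0 => /eqP.
Qed.

End Uniqueness.

Theorem corollary2p15 (R : realType) (alpha : R) (V : set R[i])
    (qhat : nat -> R[i] -> R[i]) :
  stokes_sector alpha V ->
  distinguished_branch V qhat ->
  let U := proj_t @` V in
  exists (D : set (R[i] * R[i])) (q : R[i] * R[i] -> R[i]),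
    [/\ domain D, D `<=` U `*` setT,
        asymptotic_solution alpha U qhat D q &
        forall q' : R[i] * R[i] -> R[i],
          asymptotic_solution alpha U qhat D q' ->
          forall p, D p -> q' p = q p].
Proof.
move=> /stokes_sector_wedge [tc [tc5 ->]] qb U.
have [f [g fgH]] := boutroux_global R.
exists (Dom alpha tc), (qsol alpha tc f); split.
- exact: domain_Dom.
- by move=> p [Up _ _]; split.
- exact: (asymptotic_solution_qsol tc5 fgH qb).
- by move=> q qs; exact: (asymptotic_solution_unique tc5 fgH qb).
Qed.
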